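(* Let $M\subset\mathbb{R}^{n+m}$ be a smooth, compact, embedded $n$-dimensional submanifold without boundary. For every $k\ge 3$ the symmetric tensor $A^k$ (at points of $M$) can be expressed as a polynomial tensor in $\mathrm{B}$ and its covariant derivatives, contracted with the scalar product of $\mathbb{R}^{n+m}$. The maximum order of differentiation of $\mathrm{B}$ which appears in $A^k$ is $k-3$. Precisely, the only tensors among the $p^{k,s}$ containing such highest derivative are the $p^{k,k-1}_{j_1}$, given by $$p^{k,k-1}_{j_1}=\nabla^{k-3}\mathrm{B}^{j_1}+\mathrm{LOT},$$ where $\mathrm{LOT}$ (lower order terms) denotes a polynomial term containing only derivatives of $\mathrm{B}$ up to the order $k-4$.
   Context: $e_1,\dots,e_{n+m}$ is the canonical basis of $\mathbb{R}^{n+m}$ with scalar product $\langle\cdot,\cdot\rangle$. $T_xM,N_xM$ are the tangent and normal spaces of $M$ at $x\in M$; for $V\in\mathbb{R}^{n+m}$, $V^M$ and $V^\perp$ are its projections on them. $\nabla$ is the Levi-Civita covariant derivative of the induced metric on $M$ (differentiation index first). Let $d^M(x)=\inf_{y\in M}|x-y|$ and $A^M(x)=\frac{|x|^2-[d^M(x)]^2}{2}$, smooth in an open neighbourhood of $M$. For $x\in M$ and $X_i=X_i^je_j\in\mathbb{R}^{n+m}$, $A^k(x)(X_1,\dots,X_k)=\frac{\partial^kA^M(x)}{\partial x_{i_1}\cdots\partial x_{i_k}}X_1^{i_1}\cdots X_k^{i_k}$. The second fundamental form is $\mathrm{B}(X,Y)=\left(\frac{\partial Y}{\partial X}\right)^\perp$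 for $X,Y\in T_xM$ (extended to local tangent fields), extended to $V,W\in\mathbb{R}^{n+m}$ by $\mathrm{B}(V,W)=\mathrm{B}(V^M,W^M)$; $\mathrm{B}^k=\langle\mathrm{B},e_k\rangle$, $\mathrm{B}^k_{ij}=\langle\mathrm{B}(e_i,e_j),e_k\rangle$. Covariant derivatives of $\mathrm{B}$ mean covariant derivatives of the bilinear forms $\mathrm{B}^j$ on $M$, $j$ fixed. The tensors $p^{k,s}_{j_1\dots j_{k-s}}$ ($k\ge2$, $0\le s\le k$, $j_l\in\{1,\dots,n+m\}$) are $s$-linear forms on tangent vectors with components $p^{k,s}_{j_1\dots j_{k-s},\,i_1\dots i_s}$ in the coordinates of $\mathbb{R}^{n+m}$ (the $i$-indices being contracted with tangent vectors; repeated indices summed from $1$ to $n+m$), defined recursively by: $p^{2,0}_{j_1j_2}=p^{2,1}_{j_1,i_1}=0$, $p^{2,2}_{i_1i_2}=\delta_{i_1i_2}$; $p^{k,0}=p^{k,1}=0$ for every $k\ge2$; for $2\le s<k+1$, $$\begin{aligned}p^{k+1,s}_{j_1\dots j_{k-s+1},\,i_0i_1\dots i_{s-1}}={}&(\nabla p^{k,s-1}_{j_1\dots j_{k-s+1}})_{i_0i_1\dots i_{s-1}}-\sum_{h=1}^{k-s+1}p^{k,s-1}_{j_1\dots j_{h-1}rj_{h+1}\dots j_{k-s+1},\,i_1\dots i_{s-1}}\mathrm{B}^{j_h}_{ri_0}\\&-\sum_{h=1}^{s-1}p^{k,s-2}_{rj_1\dots j_{k-s+1},\,i_1\dots i_{h-1}i_{h+1}\dots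 i_{s-1}}\mathrm{B}^{r}_{i_0i_h}+\sum_{h=1}^{k-s+1}p^{k,s}_{j_1\dots j_{h-1}j_{h+1}\dots j_{k-s+1},\,i_1\dots i_{s-1}r}\mathrm{B}^{j_h}_{ri_0};\end{aligned}$$ and $p^{k+1,k+1}_{i_0i_1\dots i_k}=(\nabla p^{k,k})_{i_0i_1\dots i_k}-\sum_{h=1}^{k}p^{k,k-1}_{r,\,i_1\dots i_{h-1}i_{h+1}\dots i_k}\mathrm{B}^{r}_{i_0i_h}$. Here $\nabla p$ is the covariant derivative on $M$ for fixed $j$-indices. They satisfy $A^k(X_1,\dots,X_s,N_1,\dots,N_{k-s})=p^{k,s}_{j_1\dots j_{k-s}}(X_1,\dots,X_s)N_1^{j_1}\cdots N_{k-s}^{j_{k-s}}$ for tangent $X_h$ and normal $N_h=N_h^{j}e_{j}$; by symmetry and multilinearity, decomposing vectors into tangent and normal parts, this determines $A^k$. For $k=3$, a term with derivatives of $\mathrm{B}$ up to order $k-4=-1$ is understood to be zero. *)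

(* Defs.v *)
From HB Require Import structures.
From mathcomp Require Import all_boot all_order all_algebra.
From mathcomp Require Import all_classical all_reals all_analysis.

Set Implicit Arguments.
Unset Strict Implicit.
Unset Printing Implicit Defensive.

Import Order.TTheory GRing.Theory Num.Theory.
Import numFieldNormedType.Exports.

Local Open Scope classical_set_scope.
Local Open Scope ring_scope.

Section Smoothness.
Context {R : realType} {U W : normedModType R}.

(* Only used for open D and finite-dimensional U, where it agrees with the
   usual definition through continuous partial derivatives. *)
Fixpoint Ck (k : nat) (D : set U) (f : U -> W) : Prop :=
  if k is k'.+1 then
    (forall x, D x -> differentiable f x) /\ (forall v, Ck k' D ('D_v f))
  else forall x, D x -> {for x, continuous f}.

Definition smooth_on (D : set U) (f : U -> W) : Prop := forall k, Ck k D f.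

End Smoothness.

Section Euclidean.
Context {R : realType} {N : nat}.
Implicit Types u v : 'rV[R]_N.

(* The library norm on 'rV[R]_N is the sup norm; it is used only through the
   topology, all metric notions below are Euclidean. *)
Definition dotv u v : R := \sum_(i < N) u 0 i * v 0 i.

Definition enorm u : R := Num.sqrt (dotv u u).

Definition ebase (i : 'I_N) : 'rV[R]_N := delta_mx 0 i.

End Euclidean.

(* Embedded n-dimensional submanifolds of R^(n+m) without boundary: slice
   charts, phi being a smooth diffeomorphism of U onto V with inverse psi. *)
Definition smooth_submanifold {R : realType} (n m : nat)
    (M : set 'rV[R]_(n + m)) : Prop :=
  forall x, M x ->
  exists (U V : set 'rV[R]_(n + m)) (phi psi : 'rV[R]_(n + m) -> 'rV[R]_(n + m)),
    [/\ open U /\ U x, open V,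
        smooth_on U phi /\ smooth_on V psi,
        (forall y, U y -> V (phi y) /\ psi (phi y) = y) /\
        (forall z, V z -> U (psi z) /\ phi (psi z) = z)
      & forall y, U y -> (M y <-> rsubmx (phi y) = 0)].

Section Geometry.
Context {R : realType} {N : nat} (M : set 'rV[R]_N).
Local Notation E := 'rV[R]_N.

(* Smooth curves in M through x with velocity X at time 0. *)
Definition curve_at (x X : E) (c : R -> E) : Prop :=
  [/\ exists2 e : R, 0 < e &
        smooth_on [set t : R | `|t| < e] c /\ (forall t, `|t| < e -> M (c t)),
      c 0 = x
    & is_derive (0 : R) (1 : R) c X].

Definition tangent (x : E) : set E := [set X | exists c, curve_at x X c].

Definition normal (x : E) : set E :=
  [set V | forall X, tangent x X -> dotv X V = 0].

(* V^M and V^\perp *)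
Definition tproj (x V : E) : E :=
  xget 0 [set W | tangent x W /\ normal x (V - W)].

Definition nproj (x V : E) : E := V - tproj x V.

(* Derivative at x, in the tangent direction X, of a function f of which only
   the values on M matter. *)
Definition tder {W : normedModType R} (x X : E) (f : E -> W) : W :=
  xget 0 [set l | forall c, curve_at x X c ->
                    is_derive (0 : R) (1 : R) (f \o c) l].

(* Levi-Civita connection of the induced metric (Gauss formula), for a tangent
   vector X at x and a tangent vector field Y. *)
Definition nabla (x X : E) (Y : E -> E) : E := tproj x (tder x X Y).

(* The tangent field by which a tangent vector X is extended around x. *)
Definition text (X : E) : E -> E := fun y => tproj y X.

Definition sff (x V W : E) : E :=
  nproj x (tder x (tproj x V) (text (tproj x W))).

(* A field of covariant tensors on M: T x [:: X_1; ...; X_s]. *)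
Definition tensor := E -> seq E -> R.

(* Covariant derivative by the Leibniz rule
     (nabla T)(X_0, ..., X_s)
       = X_0 (T(X_1, ..., X_s)) - sum_h T(..., nabla_{X_0} X_h, ...),
   extended to ambient vectors through their tangential projections. *)
Definition covd (T : tensor) : tensor := fun x Vs =>
  if [seq tproj x V | V <- Vs] is X0 :: Xs then
    tder x X0 (fun y => T y [seq text X y | X <- Xs])
    - \sum_(h < size Xs)
        T x (set_nth 0 Xs h (nabla x X0 (text (nth 0 Xs h))))
  else 0.

Definition Bform (k : 'I_N) : tensor := fun x Vs =>
  dotv (sff x (nth 0 Vs 0) (nth 0 Vs 1)) (ebase k).

(* The last derivative taken occupies the first slot. *)
Definition nablaB (l : nat) (k : 'I_N) : tensor := iter l covd (Bform k).

Definition dist (x : E) : R := inf [set enorm (x - y) | y in M].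

Definition AM (x : E) : R := (enorm x ^+ 2 - dist x ^+ 2) / 2.

Definition partials (s : seq 'I_N) (f : E -> R) : E -> R :=
  foldr (fun i g => 'D_(ebase i) g) f s.

Definition Ak (k : nat) (x : E) (X : k.-tuple E) : R :=
  \sum_(i : k.-tuple 'I_N)
    partials i AM x * \prod_(h < k) (tnth X h) 0 (tnth i h).

Definition del_nth {T : Type} (h : nat) (s : seq T) : seq T :=
  take h s ++ drop h.+1 s.

(* p^{d+2,s}_{j}.  In the successor case the order is k+1 with k = d+2; for
   s = k+1 the j-list is empty, so that the sums over j-positions vanish and
   the same formula covers p^{k+1,k+1}. *)
Fixpoint ptensor_rec (d s : nat) (j : seq 'I_N) : tensor := fun x X =>
  if d is d'.+1 then
    let k := d'.+2 in
    if (s < 2)%N then 0 else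
    if X is X0 :: Xs then
      covd (ptensor_rec d' s.-1 j) x X
      - \sum_(h < k.+1 - s) \sum_(r < N)
          ptensor_rec d' s.-1 (set_nth r j h r) x Xs
          * Bform (nth r j h) x [:: ebase r; X0]
      - \sum_(h < s.-1) \sum_(r < N)
          ptensor_rec d' (s - 2) (r :: j) x (del_nth h Xs)
          * Bform r x [:: X0; nth 0 Xs h]
      + \sum_(h < k.+1 - s) \sum_(r < N)
          ptensor_rec d' s (del_nth h j) x (rcons Xs (ebase r))
          * Bform (nth r j h) x [:: ebase r; X0]
    else 0
  else if s == 2%N then dotv (nth 0 X 0) (nth 0 X 1) else 0.

(* p^{k,s}_{j_1 ... j_{k-s}}, meaningful for k >= 2 *)
Definition ptensor (k s : nat) (j : seq 'I_N) : tensor :=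
  ptensor_rec (k - 2) s j.

End Geometry.

(* Formal polynomial tensors in B and its covariant derivatives.
   Factor l a [:: i_1; ...; i_{l+2}] stands for
   (nabla^l B^a)_{i_1 ... i_{l+2}}, where a, i_1, ... are index names. *)
Record factor := Factor { ford : nat; fup : nat; flow : seq nat }.

Definition findices (f : factor) : seq nat := fup f :: flow f.

(* A coefficient times a product of factors, with mdum contracted indices. *)
Record monomial := Monomial { mcoef : int; mdum : nat; mfac : seq factor }.

Definition tpoly := seq monomial.

(* With rank f, the names 0, ..., f-1 are free indices, each occurring exactly
   once, and f, ..., f+mdum-1 are repeated indices, each occurring exactly
   twice. *)
Definition wf_monomial (f : nat) (a : monomial) : bool :=
  all (fun b => size (flow b) == (ford b).+2) (mfac a) &&
  perm_eq (flatten [seq findices b | b <- mfac a])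
          (iota 0 f ++ iota f (mdum a) ++ iota f (mdum a)).

Definition wf_tpoly (f : nat) (P : tpoly) : bool := all (wf_monomial f) P.

(* Orders of all the derivatives of B that occur in P. *)
Definition orders (P : tpoly) : seq nat :=
  flatten [seq [seq ford b | b <- mfac a] | a <- P].

Section Evaluation.
Context {R : realType} {N : nat} (M : set 'rV[R]_N) (x : 'rV[R]_N).
Local Notation E := 'rV[R]_N.

Definition eval_factor (env : seq E) (b : factor) : R :=
  \sum_(k < N) (nth 0 env (fup b)) 0 k
               * nablaB M (ford b) k x [seq nth 0 env i | i <- flow b].

(* The free indices are contracted with the vectors in args, the repeated ones
   are summed over the canonical basis. *)
Definition eval_monomial (args : seq E) (a : monomial) : R :=
  (mcoef a)%:~R *
  \sum_(r : (mdum a).-tuple 'I_N)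
    \prod_(b <- mfac a) eval_factor (args ++ [seq ebase i | i <- r]) b.

Definition eval_tpoly (P : tpoly) (args : seq E) : R :=
  \sum_(a <- P) eval_monomial args a.

End Evaluation.

(* nabla^{k-3} B^{j_1}_{i_1 ... i_{k-1}}: index 0 is j_1, index h is i_h. *)
Definition leading (k : nat) : monomial :=
  Monomial 1 0 [:: Factor (k - 3) 0 (iota 1 k.-1)].

(* Main.v *)
Require Import Defs.
From HB Require Import structures.
From mathcomp Require Import all_boot all_order all_algebra.
From mathcomp Require Import all_classical all_reals all_analysis.
From mathcomp Require Import ring lra zify.

Import Order.TTheory GRing.Theory Num.Theory.
Import numFieldNormedType.Exports.

Local Open Scope classical_set_scope.
Local Open Scope ring_scope.

Set Implicit Arguments.
Unset Strict Implicit.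

(** Let q map a point to a nearest point of M. Since M is compact, q exists, and
    A(y) = <y, q(y)> - |q(y)|^2 / 2. Near M the map q is smooth: in a slice chart
    with inverse psi, the point q = q(y) solves the n equations
    <y - q, D_i psi> = 0 and the m equations that put it on M. The derivative of
    this system with respect to q is injective at q = y (a vector that it kills is
    both tangent and normal), so a continuity estimate and a linearization show
    that any choice of solutions is smooth ([implicit_smooth],
    [nearest_smooth_chart]).

    The first order conditions at a minimum give D_V A (y) = <V, q(y)>, hence
    D^2 A (V, W) = <D_V q, W>, and at points of M the map Dq is the orthogonal
    projection P on the tangent space. Uniqueness of the solution of the system
    shows that q is constant along the normal directions near M, so a derivative
    of A at M in which at most one argument is tangent and the others are normal
    vanishes: this is p^{k,0} = p^{k,1} = 0. These facts form the predicate [tube];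
    everything afterwards uses only them.

    On M, D^3 A (X, Z, W) with X tangent is the derivative of <P Z, W> along X.
    Differentiating P P = P gives P (D_X P) P = 0, so that <B(X, Y), e_k> is
    D^3 A (X, Y, e_k) on tangent vectors, and the field y |-> P(y) V has derivative
    B(X, V) for V tangent at the point and the shape operator S_V X for V normal.
    These facts drive the recursion. If A^k(X_1, ..., X_s, N_1, ...) is the value
    of p^{k,s} on tangent and normal vectors, extend the X's by the fields P X_h and
    the N's by N_h - P N_h, and differentiate along a tangent X_0: the derivative
    of the form A^k gives A^{k+1}(X_0, ...), the derivatives of the fields give the
    terms of the recursion that contain B ([DA_evP]). The recursion that defines the
    p^{k,s} is met in the same way, its covariant derivative being a derivative of
    values on the fields P X_h ([ptr_evP]).

    It remains to follow the recursion on formal polynomials. The derivative of a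
    product of factors nabla^l B, evaluated at constant ambient vectors, is the sum
    of the products in which one order l is raised and of those in which a slot is
    contracted with a further factor B ([tdr_nbv], [tdr_evP]); this yields
    polynomials with integer coefficients ([pks_poly], [poly_rec]). Orders of
    differentiation are raised only by the first kind of products, that is by the
    term nabla p^{k,s-1} of p^{k+1,s}. Hence nabla^{k-3} B^{j_1} in p^{k,k-1} gives
    exactly nabla^{k-2} B^{j_1} in p^{k+1,k}, and everything else in the new
    polynomials has smaller order ([low_ord], [formal_cov_lead]). *)

(** * Calculus of C^k maps *)

Section Calculus.
Context {R : realType}.
Implicit Types (U W : normedModType R).

(** Differentiability and its linear part with explicit error bounds; the form in
    which derivatives of implicitly defined maps are found. *)
Lemma diff_epsP U W (f : U -> W) (x : U) (L : {linear U -> W}) :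
  continuous L ->
  (forall e : R, 0 < e ->
     \forall h \near (0 : U), `|f (h + x) - f x - L h| <= e * `|h|) ->
  differentiable f x /\ 'd f x = L :> (U -> W).
Proof.
move=> Lc H.
have E : f \o shift x = cst (f x) + L +o_ 0 id.
  apply/eqaddoP => e e0; near=> h.
  rewrite /= !fctE /= opprD addrA; near: h; exact: H.
have D := diff_unique Lc E.
split=> //; apply/diff_locallyP; rewrite D; split => //.
Unshelve. all: by end_near. Qed.

Lemma diff_eps U W (f : U -> W) (x : U) : differentiable f x ->
  forall e : R, 0 < e ->
     \forall h \near (0 : U), `|f (h + x) - f x - 'd f x h| <= e * `|h|.
Proof.
move=> /diff_locally /eqaddoP E e e0.
have := E e e0; apply: filterS => h.
by rewrite /= !fctE /= opprD addrA.
Qed.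

Lemma near_translate U (P : set U) (y : U) :
  (\forall z \near y, P z) -> \forall v \near (0 : U), P (v + y).
Proof.
by rewrite (near_shift 0) /=; apply: filterS => h; rewrite /= subr0.
Qed.

Lemma near_eq_differentiable U W (f g : U -> W) (x : U) :
  (\forall y \near x, f y = g y) -> differentiable f x -> differentiable g x.
Proof.
move=> fg df.
suff [] : differentiable g x /\ 'd g x = 'd f x :> (U -> W) by [].
apply: diff_epsP; first exact: diff_continuous.
move=> e e0; have := diff_eps df e0.
have fgx : f x = g x by exact: nbhs_singleton fg.
have fg0 : \forall h \near (0:U), f (h + x) = g (h + x).
  exact: near_translate fg.
by apply: filterS2 fg0 => h ->; rewrite fgx.
Qed.

Lemma nbhs_open U (D : set U) (x : U) : open D -> D x -> \forall y \near x, D y.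
Proof. by move=> Do Dx; exact: open_nbhs_nbhs. Qed.

Lemma near_cont_translate U W (f : U -> W) (y : U) (P : set W) :
  {for y, continuous f} -> (\forall w \near f y, P w) ->
  \forall v \near (0 : U), P (f (v + y)).
Proof. by move=> fc Pf; apply: (near_translate (P := P \o f)); exact: fc. Qed.

Lemma near_cont_increment U W (f : U -> W) (y : U) (P : set W) :
  {for y, continuous f} -> (\forall w \near (0 : W), P w) ->
  \forall v \near (0 : U), P (f (v + y) - f y).
Proof.
move=> fc P0; apply: (near_cont_translate (P := fun w => P (w - f y))) => //.
move: P0; rewrite (near_shift (f y)) /=.
by apply: filterS => w; rewrite /= sub0r.
Qed.

Lemma Ck_eq U W (D : set U) (k : nat) (f g : U -> W) : open D ->
  (forall x, D x -> f x = g x) -> Ck k D f -> Ck k D g.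
Proof.
move=> Do; elim: k f g => [|k IH] f g fg /=.
  move=> fc x Dx.
  have fgn : {near x, f =1 g} by apply: filterS (nbhs_open Do Dx) => y /fg.
  rewrite /prop_for /continuous_at -(fg x Dx).
  exact: cvg_trans (near_eq_cvg fgn) (fc x Dx).
move=> [df dv]; split.
  move=> x Dx; apply: near_eq_differentiable (df x Dx).
  by apply: filterS (nbhs_open Do Dx) => y /fg.
move=> v; apply: IH (dv v) => x Dx.
apply: near_eq_derive.
by apply: filterS (nbhs_open Do Dx) => y /fg.
Qed.

Lemma Ck_W U W (D : set U) (k : nat) (f : U -> W) : Ck k.+1 D f -> Ck k D f.
Proof.
elim: k f => [|k IH] f /= [df dv].
  by move=> x Dx; apply: differentiable_continuous; exact: df.
split=> // v; apply: IH; exact: dv.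
Qed.

Lemma Ck_bigcup U W (I : Type) (A : set I) (D : I -> set U) k (f : U -> W) :
  (forall i, A i -> Ck k (D i) f) -> Ck k (\bigcup_(i in A) D i) f.
Proof.
elim: k f => [|k IH] f H.
  by move=> x [i Ai Dx]; exact: (H i Ai).
split; first by move=> x [i Ai Dx]; exact: (H i Ai).1.
by move=> v; apply: IH => i Ai; exact: (H i Ai).2.
Qed.

Lemma Ck_cst U W (D : set U) k (c : W) : Ck k D (fun _ : U => c).
Proof.
elim: k c => [|k IH] c /=; first by move=> x _; exact: cvg_cst.
split=> [x _|v]; first exact: differentiable_cst.
rewrite (_ : 'D_v _ = fun=> 0); first exact: IH.
by apply: funext => x; rewrite derive_cst.
Qed.

Lemma CkD U W (D : set U) k (f g : U -> W) : open D ->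
  Ck k D f -> Ck k D g -> Ck k D (fun x => f x + g x).
Proof.
move=> Do; elim: k f g => [|k IH] f g.
  by move=> fc gc x Dx; apply: cvgD; [exact: fc|exact: gc].
move=> [df fv] [dg gv]; split=> [x Dx|v].
  by apply: differentiableD; [exact: df|exact: dg].
apply: Ck_eq (IH _ _ (fv v) (gv v)) => // x Dx.
by rewrite -deriveD //; apply: diff_derivable; [exact: df|exact: dg].
Qed.

Lemma CkM U (D : set U) k (f g : U -> R) : open D ->
  Ck k D f -> Ck k D g -> Ck k D (fun x => f x * g x).
Proof.
move=> Do; elim: k f g => [|k IH] f g.
  by move=> fc gc x Dx; apply: cvgM; [exact: fc|exact: gc].
move=> fk gk; have [df fv] := fk; have [dg gv] := gk; split=> [x Dx|v].
  by apply: differentiableM; [exact: df|exact: dg].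
have := CkD Do (IH _ _ (Ck_W fk) (gv v))
  (IH _ _ (Ck_W gk) (fv v)).
apply: Ck_eq => // x Dx.
by rewrite deriveM //; apply: diff_derivable; [exact: df|exact: dg].
Qed.

Lemma Ck_big U W (I : Type) (r : seq I) (P : pred I) (D : set U) k (F : I -> U -> W)
    (op : W -> W -> W) (idx : W) :
  (forall f g, Ck k D f -> Ck k D g -> Ck k D (fun x => op (f x) (g x))) ->
  (forall i, P i -> Ck k D (F i)) -> Ck k D (fun x => \big[op/idx]_(i <- r | P i) F i x).
Proof.
move=> opk H; elim: r => [|i r IH].
  by under eq_fun do rewrite big_nil; exact: Ck_cst.
under eq_fun do rewrite big_cons; case: (boolP (P i)) => // Pi.
by apply: opk => //; exact: H.
Qed.

Lemma Ck_sum U W (I : Type) (r : seq I) (P : pred I) (D : set U) k (F : I -> U -> W) :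
  open D -> (forall i, P i -> Ck k D (F i)) ->
  Ck k D (fun x => \sum_(i <- r | P i) F i x).
Proof. by move=> Do; apply: Ck_big => f g; exact: CkD. Qed.

Lemma Ck_prod U (I : Type) (r : seq I) (P : pred I) (D : set U) k (F : I -> U -> R) :
  open D -> (forall i, P i -> Ck k D (F i)) ->
  Ck k D (fun x => \prod_(i <- r | P i) F i x).
Proof. by move=> Do; apply: Ck_big => f g; exact: CkM. Qed.

Lemma CkN U (D : set U) k (f : U -> R) : open D ->
  Ck k D f -> Ck k D (fun x => - f x).
Proof.
move=> Do fk; rewrite (_ : (fun x => _) = fun x => (-1) * f x).
  by apply: CkM => //; exact: Ck_cst.
by apply: funext => x; rewrite mulN1r.
Qed.

Lemma CkV U (D : set U) k (f : U -> R) : open D -> (forall x, D x -> f x != 0) ->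
  Ck k D f -> Ck k D (fun x => (f x)^-1).
Proof.
move=> Do f0; elim: k f f0 => [|k IH] f f0 fk.
  by move=> x Dx; apply: cvgV; [exact: f0|exact: fk].
have [df fv] := fk; split=> [x Dx|v].
  by apply: differentiableV; [exact: df|exact: f0].
have Vk := IH f f0 (Ck_W fk).
have := CkN Do (CkM Do (CkM Do Vk Vk) (fv v)).
apply: Ck_eq => // x Dx; rewrite deriveV //; last 2 first.
- exact: f0.
- by apply: diff_derivable; exact: df.
by rewrite /GRing.scale /= -exprVn expr2 mulNr.
Qed.

Lemma differentiable_row U (n : nat) (f : U -> 'rV[R]_n) (x : U) :
  (forall i, differentiable (fun y => f y 0 i) x) -> differentiable f x.
Proof.
move=> H.
have -> : f = \sum_(i < n) (fun y => f y 0 i *: (delta_mx 0 i : 'rV[R]_n)).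
  by apply: funext => y; rewrite fct_sumE [LHS]row_sum_delta.
by apply: differentiable_sum => i; apply: differentiableZl.
Qed.

Lemma differentiable_comp_coord U n (f : U -> 'rV[R]_n) x i :
  differentiable f x -> differentiable (fun y => f y 0 i) x.
Proof.
move=> df; apply: (differentiable_comp (f := f) (g := fun M : 'rV[R]_n => M 0 i)) => //.
exact: differentiable_coord.
Qed.

(** In finite dimension regularity is decided on coordinates, hence reduces to the
    scalar rules above. *)
Lemma Ck_row U (n : nat) (D : set U) k (f : U -> 'rV[R]_n) : open D ->
  (forall i, Ck k D (fun y => f y 0 i)) -> Ck k D f.
Proof.
move=> Do; elim: k f => [|k IH] f H.
  have -> : f = (fun y => \sum_(i < n) f y 0 i *: (delta_mx 0 i : 'rV[R]_n)).
    by apply: funext => y; rewrite [LHS]row_sum_delta.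
  apply: Ck_sum => // i _ x Dx; apply: cvgZr_tmp; exact: H.
split=> [x Dx|v].
  by apply: differentiable_row => i; exact: (H i).1.
apply: IH => i; have [di dvi] := H i.
apply: Ck_eq (dvi v) => // x Dx.
rewrite [in RHS]derive_mx ?mxE //.
apply: diff_derivable; apply: differentiable_row => j; exact: (H j).1.
Qed.

Lemma Ck_coord U (n : nat) (D : set U) k (f : U -> 'rV[R]_n) i : open D ->
  Ck k D f -> Ck k D (fun y => f y 0 i).
Proof.
move=> Do; elim: k f => [|k IH] f.
  move=> H x Dx; apply: (continuous_comp (f := f) (g := fun M : 'rV[R]_n => M 0 i)).
    exact: H.
  exact: coord_continuous.
move=> [df dv]; split => [x Dx|v].
  by apply: differentiable_comp_coord; exact: df.
have := IH _ (dv v); apply: Ck_eq => // x Dx.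
rewrite derive_mx ?mxE //; apply: diff_derivable; exact: df.
Qed.

Lemma derive_chain U W n (f : U -> 'rV[R]_n) (g : 'rV[R]_n -> W) (x v : U) :
  differentiable f x -> differentiable g (f x) ->
  'D_v (g \o f) x = \sum_(i < n) ('D_v f x) 0 i *: 'D_(ebase i) g (f x).
Proof.
move=> df dg.
rewrite deriveE; last exact: differentiable_comp.
rewrite diff_comp // /= -(deriveE _ df).
rewrite [in LHS](row_sum_delta ('D_v f x)) linear_sum; apply: eq_bigr => i _.
by rewrite linearZ /= -deriveE.
Qed.

Lemma derive_basis W n (g : 'rV[R]_n -> W) (x v : 'rV[R]_n) :
  differentiable g x ->
  'D_v g x = \sum_(i < n) v 0 i *: 'D_(ebase i) g x.
Proof.
move=> dg; rewrite deriveE // [in LHS](row_sum_delta v) linear_sum.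
by apply: eq_bigr => i _; rewrite linearZ /= -deriveE.
Qed.

(** Induction on k: by the chain rule the derivative of g o f is a sum of products of
    coordinates of Df with partial derivatives of g composed with f. *)
Lemma Ck_comp U n (D : set U) (D' : set 'rV[R]_n) k
    (f : U -> 'rV[R]_n) (g : 'rV[R]_n -> R) : open D ->
  (forall x, D x -> D' (f x)) ->
  Ck k D f -> Ck k D' g -> Ck k D (g \o f).
Proof.
move=> Do fD; elim: k g => [|k IH] g fk gk.
  move=> x Dx; have fc := fk _ Dx; have gc := gk _ (fD _ Dx).
  exact: (continuous_comp fc gc).
have [df fv] := fk; have [dg gv] := gk; split=> [x Dx|v].
  by apply: differentiable_comp; [exact: df|apply: dg; exact: fD].
have fk' := Ck_W fk.
apply: (@Ck_eq _ _ _ k (fun x => \sum_(i < n) ('D_v f x) 0 i * 'D_(ebase i) g (f x))) => //.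
  by move=> x Dx; rewrite derive_chain //; [exact: df|apply: dg; exact: fD].
apply: Ck_sum => // i _; apply: CkM => //; first exact: (Ck_coord i Do (fv v)).
exact: IH _ fk' (gv _).
Qed.

Lemma Ck_id U (D : set U) k : Ck k D (fun x : U => x).
Proof.
case: k => [|k]; first by move=> x _; exact: cvg_id.
split=> [x _|v]; first by [].
rewrite (_ : 'D_v _ = fun=> v); first exact: Ck_cst.
by apply: funext => x; rewrite derive_id.
Qed.

End Calculus.

(** * Derivatives along lines and symmetry of second derivatives *)

Section Curves.
Context {R : realType}.
Implicit Types (U W : normedModType R).

Lemma is_derive_along U W (c : R -> U) (f : U -> W) (t : R) (c' : U) :
  is_derive t 1 c c' -> differentiable f (c t) ->
  is_derive t 1 (f \o c) ('D_c' f (c t)).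
Proof.
move=> [dc cE] df.
have dc' : differentiable c t by apply/derivable1_diffP.
have dfc : differentiable (f \o c) t by exact: differentiable_comp.
apply: DeriveDef; first exact/derivable1_diffP.
by rewrite deriveE // diff_comp //= -(deriveE _ dc') cE -deriveE.
Qed.

Lemma is_derive_line U (x u : U) (t : R) :
  is_derive t 1 (fun s : R => x + s *: u) u.
Proof.
have -> : (fun s : R => x + s *: u) = cst x + ( *:%R^~ u) by [].
rewrite -[X in is_derive _ _ _ X]add0r.
apply: is_deriveD; apply: DeriveDef; first by apply/derivable1_diffP.
by rewrite deriveE // diff_val scale1r.
Qed.

Lemma deriveZdir U W (f : U -> W) (x v : U) (a : R) : differentiable f x ->
  'D_(a *: v) f x = a *: 'D_v f x.
Proof. by move=> df; rewrite !deriveE // linearZ. Qed.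

Lemma Ck_line U (D : set R) k (x u : U) : Ck k D (fun s : R => x + s *: u).
Proof.
case: k => [|k].
  by move=> t _; have [dl _] := is_derive_line x u t;
     exact/differentiable_continuous/derivable1_diffP.
have L (t v : R) : 'D_v (fun s : R => x + s *: u) t = v *: u.
  have [dl E] := is_derive_line x u t.
  by rewrite -{1}(mulr1 v) -[v * 1]/(v *: (1 : R)) deriveZdir ?E //; exact/derivable1_diffP.
split=> [t _|v]; first by have [dl _] := is_derive_line x u t; exact/derivable1_diffP.
rewrite (_ : 'D_v _ = fun=> v *: u); first exact: Ck_cst.
by apply: funext => t; rewrite L.
Qed.

Lemma near_line U (D : set U) (x u : U) : open D -> D x ->
  \forall h \near (0 : R), D (h *: u + x).
Proof.
move=> Do Dx; have c := @Ck_line U setT 0 x u 0 I.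
have H : \forall h \near (0 : R), D (x + (h + 0) *: u).
  apply: (near_cont_translate c); rewrite scale0r addr0; exact: nbhs_open.
by apply: filterS H => h; rewrite addr0 addrC.
Qed.

Lemma mvt_line U (f : U -> R) (x u : U) :
  (forall t : R, 0 <= t <= 1 -> differentiable f (x + t *: u)) ->
  exists2 t : R, 0 <= t <= 1 & f (x + u) - f x = 'D_u f (x + t *: u).
Proof.
move=> df.
pose g (t : R) := f (x + t *: u).
have dg (t : R) : 0 <= t <= 1 -> is_derive t 1 g ('D_u f (x + t *: u)).
  move=> t01.
  exact: (is_derive_along (f := f) (is_derive_line x u t) (df _ t01)).
have gc : {within `[0, 1], continuous g}.
  apply: continuous_in_subspaceT => t; rewrite inE /= in_itv /= => t01.
  have [dgt _] := dg t t01.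
  exact/differentiable_continuous/derivable1_diffP.
have [] := @MVT R g (fun t => 'D_u f (x + t *: u)) 0 1 ltr01 _ gc.
  by move=> t; rewrite in_itv /= => /andP[t0 t1]; apply: dg; rewrite !ltW.
move=> t; rewrite in_itv /= => /andP[t0 t1]; rewrite /g scale1r scale0r addr0.
by rewrite subr0 mulr1 => E; exists t => //; rewrite !ltW.
Qed.

Lemma deriveDdir U W (f : U -> W) (x u v : U) : differentiable f x ->
  'D_(u + v) f x = 'D_u f x + 'D_v f x.
Proof. by move=> df; rewrite !deriveE // linearD. Qed.

Lemma derive_shifted U W (f : U -> W) (x u w : U) :
  'D_u (f \o shift w) x = 'D_u f (x + w).
Proof.
rewrite /derive.
have -> // : (fun h : R => h^-1 *: (((f \o shift w) \o shift x) (h *: u) - (f \o shift w) x))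
  = (fun h : R => h^-1 *: ((f \o shift (x + w)) (h *: u) - f (x + w))).
by apply: funext => h /=; rewrite addrA.
Qed.

Let second_diff U (f : U -> R) (x u v : U) (h : R) : R :=
  f (x + h *: u + h *: v) - f (x + h *: u) - f (x + h *: v) + f x.

(** The mean value theorem in the direction u, applied to y |-> f (y + h v) - f y,
    turns the second difference into a difference of values of D_u f, which the
    differentiability of D_u f at x alone controls. *)
Lemma second_diff_approx U (f : U -> R) (x u v : U) (e : R) : 0 < e ->
  (\forall y \near x, differentiable f y) ->
  differentiable ('D_u f) x ->
  \forall h \near (0 : R), 
     `|second_diff f x u v h - h ^+ 2 * 'D_v ('D_u f) x| <= e * h ^+ 2.
Proof.
move=> e0 df ddf.
(* All points that occur are within |h| C of x. *)
pose C := `|u| + `|v| + 1.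
have C0 : 0 < C by rewrite /C; have := normr_ge0 u; have := normr_ge0 v; lra.
have e'0 : 0 < e / (C + C) by rewrite divr_gt0 // addr_gt0.
have /nbhs_ballP [r1 /= r10 H1] := diff_eps ddf e'0.
have /nbhs_ballP [r2 /= r20 H2] := df.
pose r := Order.min r1 r2.
have r0 : 0 < r by rewrite lt_min r10 r20.
have rC0 : 0 < r / C by rewrite divr_gt0.
near=> h.
have hr : `|h| * C < r.
  by rewrite -ltr_pdivlMr //; near: h; exact: nbhs0_lt.
have small (k : U) : `|k| <= `|h| * C ->
   differentiable f (x + k) /\
   `|'D_u f (k + x) - 'D_u f x - 'd ('D_u f) x k| <= e / (C + C) * (`|h| * C).
  move=> kh; have kr := le_lt_trans kh hr; split.
    apply: H2; rewrite -ball_normE /= opprD addNKr normrN.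
    by apply: lt_le_trans kr _; rewrite ge_min lexx orbT.
  apply: (@le_trans _ _ (e / (C + C) * `|k|)); last first.
    by rewrite ler_pM2l.
  apply: H1; rewrite -ball_normE /= sub0r normrN.
  by apply: lt_le_trans kr _; rewrite ge_min lexx.
have tb (t : R) : 0 <= t <= 1 -> `|t *: (h *: u)| <= `|h| * `|u|.
  move=> /andP[t0 t1]; rewrite !normrZ (ger0_norm t0).
  by rewrite ler_piMl // mulr_ge0.
have b1 (t : R) : 0 <= t <= 1 -> `|t *: (h *: u)| <= `|h| * C.
  move=> /tb tu; apply: le_trans tu _; rewrite ler_wpM2l //.
  by rewrite /C; have := normr_ge0 v; lra.
have b2 (t : R) : 0 <= t <= 1 -> `|t *: (h *: u) + h *: v| <= `|h| * C.
  move=> t01; apply: le_trans (ler_normD _ _) _.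
  apply: (@le_trans _ _ (`|h| * `|u| + `|h| * `|v|)).
    by apply: lerD; [exact: tb | rewrite normrZ].
  by rewrite -mulrDr ler_wpM2l // /C; lra.
pose g y := f (y + h *: v) - f y.
have [t t01] : exists2 t : R, 0 <= t <= 1 &
    g (x + h *: u) - g x = 'D_(h *: u) g (x + t *: (h *: u)).
  apply: mvt_line => t t01.
  have [D1 _] := small _ (b1 _ t01); have [D2 _] := small _ (b2 _ t01).
  apply: differentiableB => //.
  apply: (differentiable_comp (f := shift (h *: v)) (g := f)).
    by apply: differentiableD.
  by rewrite /= -addrA.
have [D1 E1] := small _ (b1 _ t01); have [D2 E2] := small _ (b2 _ t01).
have -> : 'D_(h *: u) g (x + t *: (h *: u)) =
   h * ('D_u f (t *: (h *: u) + h *: v + x) - 'D_u f (t *: (h *: u) + x)).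
  have Df : differentiable (f \o shift (h *: v)) (x + t *: (h *: u)).
    apply: differentiable_comp; first by apply: differentiableD.
    by rewrite /= -addrA.
  rewrite deriveZdir; last by apply: differentiableB.
  rewrite (_ : g = (f \o shift (h *: v)) - f) // deriveB; last 2 first.
  - exact: diff_derivable.
  - exact: diff_derivable.
  rewrite derive_shifted -addrA [x + (_ + _)]addrC [x + t *: _]addrC.
  by [].
have -> : second_diff f x u v h = g (x + h *: u) - g x.
  by rewrite /second_diff /g; ring.
move=> ->; rewrite [in X in _ - X]deriveE //.
have L : 'd ('D_u f) x (t *: (h *: u) + h *: v) = 'd ('D_u f) x (t *: (h *: u)) + h * 'd ('D_u f) x v.
  by rewrite linearD; congr (_ + _); rewrite linearZ.
rewrite L in E2.
have h2 : `|h| * `|h| = h ^+ 2 by rewrite -normrM -expr2 ger0_norm // sqr_ge0.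
set a := 'D_u f (_ + h *: v + x) in E2 *.
set b := 'D_u f (_ + x) in E1 *.
set c := 'd _ _ v in E2 *.
set d := 'd _ _ _ in E1 E2; set w := 'D_u f x in E1 E2.
rewrite (_ : _ - _ = h * ((a - w - (d + h * c)) - (b - w - d))); last by ring.
rewrite normrM; apply: (@le_trans _ _ (`|h| * (e / (C + C) * (`|h| * C) + e / (C + C) * (`|h| * C)))).
  by rewrite ler_wpM2l //; apply: le_trans (ler_normB _ _) _; exact: lerD.
rewrite -h2 le_eqVlt; apply/orP; left; apply/eqP; field.
by rewrite gt_eqF //= ; lra.
Unshelve. all: by end_near. Qed.

(** The second difference is symmetric in u and v, so both mixed derivatives
    are its limit after division by h^2. *)
Lemma derive_sym U (f : U -> R) (x u v : U) :
  (\forall y \near x, differentiable f y) ->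
  differentiable ('D_u f) x -> differentiable ('D_v f) x ->
  'D_v ('D_u f) x = 'D_u ('D_v f) x.
Proof.
move=> df du dv; apply/eqP; rewrite -subr_eq0 -normr_le0.
apply/ler_addgt0Pl => e e0; rewrite addr0.
have e2 : 0 < e / 2 by rewrite divr_gt0.
have NA := nbhs_dnbhs (second_diff_approx v e2 df du).
have NB := nbhs_dnbhs (second_diff_approx u e2 df dv).
have [h [[]]] := filter_ex (filterI (filterI NA NB) (nbhs_dnbhs_neq (0 : R))).
have -> : second_diff f x v u h = second_diff f x u v h.
  by rewrite /second_diff (addrAC x (h *: v)); ring.
move: ('D_v _ _) ('D_u ('D_v _) _) (second_diff _ _ _ _ _) => a b s A B h0.
have h2 : 0 < h ^+ 2 by rewrite exprn_even_gt0.
rewrite -(ler_pM2r h2) -{1}(ger0_norm (ltW h2)) -normrM.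
have -> : (a - b) * h ^+ 2 = (s - h ^+ 2 * b) - (s - h ^+ 2 * a) by ring.
apply: le_trans (ler_normB _ _) _; apply: le_trans (lerD B A) _.
by rewrite -mulrDl -splitr.
Qed.

End Curves.

(** * Smoothness and perturbation of inverse matrices *)

Section MatrixSmooth.
Context {R : realType}.
Implicit Types (U : normedModType R).

Lemma Ck_det U n (D : set U) k (A : U -> 'M[R]_n) : open D ->
  (forall i j, Ck k D (fun x => A x i j)) -> Ck k D (fun x => \det (A x)).
Proof.
move=> Do H; apply: Ck_sum => // s _; apply: CkM => //; first exact: Ck_cst.
exact: Ck_prod.
Qed.

(** Cramer's rule. *)
Lemma Ck_invmx U n (D : set U) k (A : U -> 'M[R]_n) i j : open D ->
  (forall i j, Ck k D (fun x => A x i j)) -> (forall x, D x -> A x \in unitmx) ->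
  Ck k D (fun x => invmx (A x) i j).
Proof.
move=> Do H Hu.
apply: (@Ck_eq _ _ _ D k (fun x => (\det (A x))^-1 * cofactor (A x) j i)) => //.
  by move=> x Dx; rewrite /invmx Hu // !mxE.
apply: CkM => //.
  apply: CkV => //; last exact: Ck_det.
  by move=> x Dx; have := Hu x Dx; rewrite unitmxE unitfE.
apply: CkM => //; first exact: Ck_cst.
apply: Ck_det => // a b.
apply: Ck_eq (H (lift j a) (lift i b)) => // x _; by rewrite !mxE.
Qed.

Lemma coord_le n (v : 'rV[R]_n) i : `|v 0 i| <= `|v|.
Proof.
rewrite [leRHS]/Num.Def.normr /= mx_normrE.
exact: (le_bigmax _ (fun ij => `|v ij.1 ij.2|) (0, i)).
Qed.

Lemma norm_le n (v : 'rV[R]_n) (C : R) : 0 <= C ->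
  (forall i, `|v 0 i| <= C) -> `|v| <= C.
Proof.
move=> C0 H; rewrite [leLHS]/Num.Def.normr /= mx_normrE.
by rewrite (bigmax_le _ C0) //= => -[a i] _ /=; rewrite ord1.
Qed.

Definition entry_sum m n (A : 'M[R]_(m, n)) := \sum_i \sum_j `|A i j|.

Lemma entry_sum_ge0 m n (A : 'M[R]_(m, n)) : 0 <= entry_sum A.
Proof. by apply: sumr_ge0 => i _; apply: sumr_ge0. Qed.

Lemma norm_mulmx m n (w : 'rV[R]_m) (A : 'M[R]_(m, n)) :
  `|w *m A| <= `|w| * entry_sum A.
Proof.
apply: norm_le; first by rewrite mulr_ge0 ?entry_sum_ge0.
move=> j; rewrite mxE; apply: le_trans (ler_norm_sum _ _ _) _.
rewrite /entry_sum mulr_sumr; apply: ler_sum => i _.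
rewrite normrM; apply: ler_pM => //; first exact: coord_le.
by rewrite (bigD1 j) //= lerDl sumr_ge0.
Qed.

(** The injectivity constant K is uniform: it serves below for matrices whose
    columns are taken at different points of a segment. *)
Lemma unit_perturb n (A : 'M[R]_n) : A \in unitmx ->
  exists2 K : R, 0 < K & exists2 e : R, 0 < e &
    forall B : 'M[R]_n, (forall i j, `|B i j - A i j| <= e) ->
      forall v : 'rV_n, `|v| <= K * `|v *m B|.
Proof.
move=> Au; pose K0 := entry_sum (invmx A) + 1.
have K00 : 0 < K0 by rewrite /K0 ltr_wpDl ?entry_sum_ge0.
pose e : R := (2 * K0 * (n%:R * n%:R + 1))^-1.
have n0 : 0 < (n%:R * n%:R + 1 : R) by rewrite ltr_wpDl // mulr_ge0.
have e0 : 0 < e by rewrite invr_gt0 !mulr_gt0.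
exists (2 * K0); first by rewrite mulr_gt0.
exists e => // B HB v.
have E1 : `|v| <= K0 * `|v *m A|.
  rewrite -{1}(mulmxK Au v); apply: le_trans (norm_mulmx _ _) _.
  by rewrite mulrC ler_wpM2r // /K0 lerDl.
have E2 : entry_sum (A - B) <= n%:R * n%:R * e.
  apply: (@le_trans _ _ (\sum_(i < n) \sum_(j < n) e)).
    by apply: ler_sum => i _; apply: ler_sum => j _; rewrite !mxE distrC.
  rewrite !sumr_const !card_ord -mulrnA -[leLHS]mulr_natl natrM.
  by [].
have E3 : `|v *m A| <= `|v *m B| + `|v| * (n%:R * n%:R * e).
  have -> : v *m A = v *m B + v *m (A - B) by rewrite -mulmxDr addrC subrK.
  apply: le_trans (ler_normD _ _) _; rewrite lerD2l.
  by apply: le_trans (norm_mulmx _ _) _; rewrite ler_wpM2l.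
have E4 : K0 * (`|v| * (n%:R * n%:R * e)) <= `|v| / 2.
  have -> : K0 * (`|v| * (n%:R * n%:R * e)) = `|v| / 2 * ((n%:R * n%:R) / (n%:R * n%:R + 1)).
    by rewrite /e; field; rewrite !gt_eqF.
  rewrite ler_piMr ?divr_ge0 // ler_pdivrMr // mul1r lerDl //.
have E5 : `|v| <= K0 * `|v *m B| + `|v| / 2.
  apply: le_trans E1 _; apply: (@le_trans _ _ (K0 * (`|v *m B| + `|v| * (n%:R * n%:R * e)))).
    by rewrite ler_pM2l.
  by rewrite mulrDr lerD2l.
by move: E5; rewrite -mulrA; set a := K0 * _; lra.
Qed.

Lemma inj_unitmx n (A : 'M[R]_n) : (forall v : 'rV_n, v *m A = 0 -> v = 0) -> A \in unitmx.
Proof.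
move=> H; rewrite -row_free_unit -kermx_eq0; apply/eqP/row_matrixP => i; rewrite row0.
by apply: H; rewrite -row_mul mulmx_ker row0.
Qed.

End MatrixSmooth.

(** * Smoothness of solutions of implicit equations *)

Section Implicit.
Context {R : realType} {N : nat}.
Local Notation E := 'rV[R]_N.
Variables (U0 : set E) (L : 'I_N -> 'I_N -> E -> R) (b : 'I_N -> E -> R) (x0 : E).
Hypothesis U0o : open U0.
Hypothesis U0x : U0 x0.
Hypothesis Ls : forall i j, smooth_on U0 (L i j).
Hypothesis bs : forall i, smooth_on U0 (b i).

(** A system of N equations in q, affine in the parameter y, near a solution at
    y = q = x0. It will be solved by the nearest point, so the matter is regularity
    and uniqueness of a given solution. *)
Definition implicit_eq (i : 'I_N) (y q : E) : R := \sum_j y 0 j * L i j q + b i q.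

(** The row index is the direction of differentiation, so that the derivative along
    a row vector v is v *m Jac y q. *)
Definition Jac (y q : E) : 'M[R]_N :=
  \matrix_(l, i) (\sum_j y 0 j * 'D_(ebase l) (L i j) q + 'D_(ebase l) (b i) q).

Hypothesis Jinj : forall v : E, v *m Jac x0 x0 = 0 -> v = 0.

Lemma implicit_eq_smooth i y : smooth_on U0 (implicit_eq i y).
Proof.
move=> k; apply: CkD => //; last exact: bs.
apply: Ck_sum => // j _; apply: CkM => //; [exact: Ck_cst|exact: Ls].
Qed.

Lemma Jac_derive i y q v : U0 q -> 'D_v (implicit_eq i y) q = (v *m Jac y q) 0 i.
Proof.
move=> Uq; have dL j : differentiable (L i j) q by exact: (Ls i j 1%N).1.
have db : differentiable (b i) q by exact: (bs i 1%N).1.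
rewrite derive_basis; last exact: (implicit_eq_smooth i y 1%N).1.
rewrite mxE; apply: eq_bigr => l _; rewrite /GRing.scale /= mxE; congr (_ * _).
have -> : implicit_eq i y = (\sum_j (fun q => y 0 j * L i j q)) + b i.
  by apply: funext => z; rewrite /implicit_eq !fctE fct_sumE.
have dj j : derivable (fun q => y 0 j * L i j q) q (ebase l).
  apply: (derivableM (f := cst (y 0 j)) (g := L i j)).
    exact: derivable_cst.
  exact: diff_derivable.
rewrite deriveD; last 2 first.
- exact: derivable_sum.
- exact: diff_derivable.
rewrite derive_sum //; congr (_ + _); apply: eq_bigr => j _.
rewrite (deriveM (f := cst (y 0 j)) (g := L i j)).
- by rewrite derive_cst scaler0 addr0.
- exact: derivable_cst.
- exact: diff_derivable.
Qed.

Lemma near_L q (e : R) : U0 q -> 0 < e ->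
  \forall z \near q, forall t : 'I_N * 'I_N, `|L t.1 t.2 z - L t.1 t.2 q| <= e.
Proof.
move=> Uq e0; apply: (@filter_forall _ ('I_N * 'I_N)%type
  (fun t z => `|L t.1 t.2 z - L t.1 t.2 q| <= e) _ (nbhs_filter q)) => -[i j] /=.
have := @cvgr_dist_le _ _ _ (nbhs q) (nbhs_filter q) (L i j) _ (Ls i j 0%N q Uq) _ e0.
by apply: filterS => z; rewrite distrC.
Qed.

Lemma Jac_cont (e : R) : 0 < e ->
  exists2 r : R, 0 < r & forall y q, ball x0 r y -> ball x0 r q ->
    forall l i, `|Jac y q l i - Jac x0 x0 l i| <= e.
Proof.
move=> e0.
suff /nbhs_ballP[r /= r0 H] : \forall p \near (x0, x0), forall t : 'I_N * 'I_N,
    `|Jac x0 x0 t.1 t.2 - Jac p.1 p.2 t.1 t.2| <= e.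
  by exists r => // y q yr qr l i; rewrite distrC; exact: (H (y, q) (conj yr qr) (l, i)).
apply: (@filter_forall _ ('I_N * 'I_N)%type
  (fun t p => `|Jac x0 x0 t.1 t.2 - Jac p.1 p.2 t.1 t.2| <= e) _ (nbhs_filter (x0, x0))).
move=> -[l i] /=.
have c2 (g : E -> R) : {for x0, continuous g} -> (fun p : E * E => g p.2) @ (x0, x0) --> g x0.
  by move=> gc; apply: (@cvg_comp _ _ _ snd g (nbhs (x0, x0)) (nbhs x0)) => //; exact: cvg_snd.
have C : (fun p : E * E => Jac p.1 p.2 l i) @ (x0, x0) --> Jac x0 x0 l i.
  under eq_fun do rewrite mxE; rewrite mxE.
  apply: cvgD; last exact: (c2 _ ((bs i 1%N).2 _ x0 U0x)).
  apply: cvg_big => [|j _]; first exact: add_continuous.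
  apply: cvgM; last exact: (c2 _ ((Ls i j 1%N).2 _ x0 U0x)).
  apply: (@cvg_comp _ _ _ fst (fun y : E => y 0 j) (nbhs (x0, x0)) (nbhs x0)); first exact: cvg_fst.
  exact: coord_continuous.
exact: (@cvgr_dist_le _ _ _ (nbhs (x0, x0)) (nbhs_filter (x0, x0)) (fun p : E * E => Jac p.1 p.2 l i) _ C _ e0).
Qed.

(** The mean value theorem, applied to each equation on the segment from q to q',
    expresses the increment of the system as (q' - q) *m B, where the columns of B
    are columns of Jac at different points. All of them are close to Jac x0 x0, so
    B is injective with a uniform constant. *)
Lemma implicit_eq_uniform : exists r K C : R, [/\ [/\ 0 < r, 0 < K & 0 < C],
   ball x0 r `<=` U0,
   (forall y q, ball x0 r y -> ball x0 r q -> forall v : E, `|v| <= K * `|v *m Jac y q|),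
   (forall y q q' e, 0 <= e -> ball x0 r y -> ball x0 r q -> ball x0 r q' ->
     (forall i, `|implicit_eq i y q' - implicit_eq i y q| <= e) -> `|q' - q| <= K * e)
   & (forall i j q, ball x0 r q -> `|L i j q| <= C)].
Proof.
have [K K0 [e e0 HB]] := unit_perturb (inj_unitmx Jinj).
have [r1 r10 H1] := Jac_cont e0.
have [r2 /= r20 H2] : exists2 r : R, 0 < r & ball x0 r `<=` U0.
  apply/nbhs_ballP; exact: (nbhs_open U0o U0x).
have /nbhs_ballP[r3 /= r30 H3] := near_L U0x (@ltr01 R).
pose C := \sum_i \sum_j `|L i j x0| + 1.
have C0 : 0 < C.
  by rewrite ltr_wpDl // sumr_ge0 // => i _; rewrite sumr_ge0.
pose r := Order.min r1 (Order.min r2 r3).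
have r0 : 0 < r by rewrite !lt_min r10 r20.
have rr1 : r <= r1 by rewrite ge_min lexx.
have rr2 : r <= r2 by rewrite !ge_min lexx orbT.
have rr3 : r <= r3 by rewrite !ge_min lexx !orbT.
exists r, K, C; split => //.
- by move=> q /(le_ball rr2) /H2.
- move=> y q yr qr v; apply: HB => l i; apply: H1; exact: le_ball rr1 _ _.
- move=> y q q' d d0 yr qr qr' Hd.
  have seg (t : R) : 0 <= t <= 1 -> ball x0 r (q + t *: (q' - q)).
    move=> /andP[t0 t1]; move: qr qr'; rewrite -ball_normE /= => qr qr'.
    have -> : x0 - (q + t *: (q' - q)) = (1 - t) *: (x0 - q) + t *: (x0 - q').
      by apply/rowP => k; rewrite !mxE; ring.
    apply: le_lt_trans (ler_normD _ _) _; rewrite !normrZ.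
    rewrite (ger0_norm t0) ger0_norm ?subr_ge0 //.
    move: qr qr'; move: `|_ - _| `|x0 - q'| => a c ar cr.
    have [->|tn0] := eqVneq t 0; first by rewrite subr0 mul1r mul0r addr0.
    have tp : 0 < t by rewrite lt_def tn0.
    apply: (@lt_le_trans _ _ ((1 - t) * r + t * r)); last by rewrite -mulrDl subrK mul1r.
    apply: ler_ltD; last by rewrite ltr_pM2l.
    by rewrite ler_wpM2l ?subr_ge0 // ltW.
  have H i : exists2 t : R, 0 <= t <= 1 &
      implicit_eq i y q' - implicit_eq i y q = ((q' - q) *m Jac y (q + t *: (q' - q))) 0 i.
    have [t t01] : exists2 t : R, 0 <= t <= 1 & 
       implicit_eq i y (q + (q' - q)) - implicit_eq i y q = 'D_(q' - q) (implicit_eq i y) (q + t *: (q' - q)).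
      apply: mvt_line => t t01; apply: (implicit_eq_smooth i y 1%N).1.
      by apply: H2; apply: le_ball (seg _ t01).
    rewrite [q + (q' - q)]addrC subrK => ->; exists t => //; rewrite Jac_derive //.
    by apply: H2; apply: le_ball (seg _ t01).
  pose t i := s2val (cid2 (H i)).
  (* Each equation has its own intermediate point t i. *)
  pose B := \matrix_(l, i) Jac y (q + t i *: (q' - q)) l i.
  have BE i : ((q' - q) *m B) 0 i = implicit_eq i y q' - implicit_eq i y q.
    rewrite (s2valP' (cid2 (H i))) !mxE; apply: eq_bigr => l _.
    by rewrite -/(t i) [B l i]mxE.
  apply: le_trans (HB B _ _) _.
    move=> l i; rewrite [B l i]mxE; apply: H1; apply: le_ball rr1 _ _ => //.
    by apply: seg; exact: (s2valP (cid2 (H i))).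
  rewrite ler_pM2l //; apply: norm_le => // i; rewrite BE; exact: Hd.
- move=> i j q qr; have /= H := H3 q (le_ball rr3 qr) (i, j).
  have -> : L i j q = L i j x0 + (L i j q - L i j x0) by rewrite addrC subrK.
  apply: le_trans (ler_normD _ _) _; apply: lerD => //.
  rewrite (bigD1 i) //= (bigD1 j) //= -addrA lerDl addr_ge0 ?sumr_ge0 // => k _.
  by rewrite sumr_ge0.
Qed.

(** The system is affine in y with this linear part, which makes its dependence on
    the parameter explicit. *)
Definition Lmat (q : E) : 'M[R]_N := \matrix_(j, i) L i j q.

Lemma implicit_eqB i y z q : implicit_eq i y q - implicit_eq i z q = ((y - z) *m Lmat q) 0 i.
Proof.
rewrite /implicit_eq opprD addrACA subrr addr0 -sumrB mxE; apply: eq_bigr => j _.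
by rewrite !mxE mulrBl.
Qed.

Section Solution.
Variables (r K C : R) (O : set E) (f : E -> E).
Hypothesis (K0 : 0 < K) (C0 : 0 < C).
Hypothesis rU : ball x0 r `<=` U0.
Hypothesis Jbd : forall y q, ball x0 r y -> ball x0 r q ->
  forall v : E, `|v| <= K * `|v *m Jac y q|.
Hypothesis einj : forall y q q' e, 0 <= e ->
  ball x0 r y -> ball x0 r q -> ball x0 r q' ->
  (forall i, `|implicit_eq i y q' - implicit_eq i y q| <= e) -> `|q' - q| <= K * e.
Hypothesis Lbd : forall i j q, ball x0 r q -> `|L i j q| <= C.
Hypothesis Oo : open O.
Hypothesis Or : O `<=` ball x0 r.
Hypothesis fr : forall y, O y -> ball x0 r (f y).
Hypothesis feq : forall y, O y -> forall i, implicit_eq i y (f y) = 0.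

(** At f y the equation with parameter y' has a residue that is linear in y' - y;
    the injectivity estimate turns it into a bound on f y' - f y. *)
Lemma sol_lip y y' : O y -> O y' -> `|f y' - f y| <= K * (`|y' - y| * (N%:R * C)).
Proof.
move=> Oy Oy'; apply: (einj (y := y)); [|exact: Or|exact: fr|exact: fr|].
  by rewrite !mulr_ge0 // ltW.
move=> i; rewrite (feq Oy) subr0 -[implicit_eq _ _ _]subr0 -(feq Oy' i) implicit_eqB.
rewrite mxE; apply: le_trans (ler_norm_sum _ _ _) _.
apply: (@le_trans _ _ (\sum_(j < N) `|y' - y| * C)); last first.
  by rewrite sumr_const card_ord -[leLHS]mulr_natl mulrCA.
apply: ler_sum => j _; rewrite normrM; apply: ler_pM => //.
  by rewrite [leRHS]distrC; exact: coord_le.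
by rewrite mxE; apply: Lbd; exact: fr.
Qed.

Lemma sol_cont y : O y -> {for y, continuous f}.
Proof.
move=> Oy; apply/(@cvgrPdist_le _ E _ (nbhs y)) => e e0.
pose c := K * (N%:R * C) + 1.
have c0 : 0 < c by rewrite ltr_wpDl // !mulr_ge0 // ltW.
near=> z.
have Oz : O z by near: z; exact: (nbhs_open Oo Oy).
rewrite distrC; apply: le_trans (sol_lip Oy Oz) _.
apply: (@le_trans _ _ (c * `|z - y|)).
  rewrite mulrCA [c * _]mulrC ler_wpM2l // /c lerDl //.
rewrite -ler_pdivlMl // distrC; near: z.
apply: cvgr_dist_le; first exact: cvg_id.
by rewrite mulr_gt0 // invr_gt0.
Unshelve. all: by end_near. Qed.

Lemma Jac_unit y : O y -> Jac y (f y) \in unitmx.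
Proof.
move=> Oy; apply: inj_unitmx => v Jv; apply/eqP; rewrite -normr_le0.
by apply: le_trans (Jbd (Or Oy) (fr Oy) v) _; rewrite Jv normr0 mulr0.
Qed.

(** Implicit differentiation: Df Jac + v Lmat = 0. *)
Definition dsol (y v : E) : E := - (v *m Lmat (f y)) *m invmx (Jac y (f y)).

Lemma dsol_linear y : linear (dsol y).
Proof.
move=> a u v; rewrite /dsol mulmxDl -scalemxAl opprD -scalerN mulmxDl.
by rewrite -scalemxAl.
Qed.

(** With w = f (v + y) - f y, both w *m Jac and - v *m Lmat are equal to the increment
    of the system up to an error o(|v|), by the Lipschitz bound on w; Jac is
    invertible. *)
Lemma sol_diff y : O y -> differentiable f y /\ forall v, 'D_v f y = dsol y v.
Proof.
move=> Oy.
pose T := GRing.isLinear.Build R E E _ (dsol y) (dsol_linear y).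
pose D : {linear E -> E} := HB.pack (dsol y) T.
have Dc : continuous D.
  move=> v; apply: differentiable_continuous.
  apply: differentiable_row => i.
  have -> : (fun v => D v 0 i) = \sum_l ((fun v : E => v 0 l) * cst (D (ebase l) 0 i)).
    apply: funext => w; rewrite fct_sumE.
    transitivity (D (\sum_l w 0 l *: ebase l) 0 i); first by rewrite -row_sum_delta.
    by rewrite linear_sum summxE; apply: eq_bigr => l _; rewrite linearZ mxE.
  apply: differentiable_sum => l; apply: differentiableM => //.
  exact: differentiable_coord.
suff [df dE] : differentiable f y /\ 'd f y = D :> (E -> E).
  by split => // v; rewrite deriveE // dE.
apply: diff_epsP => // e e0.
have rfy := fr Oy; have ry := Or Oy.
pose c := K * (N%:R * C) + 1.
have c0 : 0 < c by rewrite ltr_wpDl // !mulr_ge0 // ltW.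
pose e1 := e / (K * (N%:R + c)).
have Nc : 0 < N%:R + c by rewrite ltr_wpDl.
have e10 : 0 < e1 by rewrite divr_gt0 // mulr_gt0.
have S1 := near_L (rU rfy) e10.
have S2 : \forall w \near (0 : E), forall i,
   `|implicit_eq i y (w + f y) - implicit_eq i y (f y) - (w *m Jac y (f y)) 0 i| <= e1 * `|w|.
  apply: (@filter_forall _ 'I_N (fun i w => `|implicit_eq i y (w + f y) - implicit_eq i y (f y) - (w *m Jac y (f y)) 0 i| <= e1 * `|w|) _ (nbhs_filter (0 : E))) => i.
  have de := (implicit_eq_smooth i y 1%N).1 _ (rU rfy).
  have := diff_eps de e10; apply: filterS => w.
  by rewrite -Jac_derive ?(deriveE _ de) //; exact: rU.
have fc := sol_cont Oy.
have S1' := near_cont_translate fc S1.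
have S2' := near_cont_increment fc S2.
have SO := near_translate (nbhs_open Oo Oy).
near=> v.
have Ov : O (v + y) by near: v; exact: SO.
pose w := f (v + y) - f y.
have L1 : forall t : 'I_N * 'I_N, `|L t.1 t.2 (f (v + y)) - L t.1 t.2 (f y)| <= e1.
  by near: v; exact: S1'.
have L2 : forall i, `|implicit_eq i y (w + f y) - implicit_eq i y (f y) - (w *m Jac y (f y)) 0 i| <= e1 * `|w|.
  by rewrite /w; near: v; exact: S2'.
have wb : `|w| <= c * `|v|.
  apply: le_trans (sol_lip Oy Ov) _; rewrite addrK mulrCA [c * _]mulrC.
  by rewrite ler_wpM2l // /c lerDl.
rewrite -/w -[D v]/(dsol y v).
apply: le_trans (Jbd ry rfy _) _.
rewrite mulmxBl /dsol mulmxKV ?Jac_unit // opprK.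
have -> : e * `|v| = K * (e1 * (N%:R + c) * `|v|).
  by rewrite /e1; field; rewrite !gt_eqF.
rewrite ler_pM2l //; apply: norm_le; first by apply: mulr_ge0 => //; apply: mulr_ge0; exact: ltW.
move=> i.
have E : (w *m Jac y (f y) + v *m Lmat (f y)) 0 i =
  - (implicit_eq i y (w + f y) - implicit_eq i y (f y) - (w *m Jac y (f y)) 0 i)
  - (v *m (Lmat (f (v + y)) - Lmat (f y))) 0 i.
  have aE (A B : E) : (A + B) 0 i = A 0 i + B 0 i by rewrite mxE.
  have nE (A : E) : (- A) 0 i = - A 0 i by rewrite mxE.
  have := implicit_eqB i (v + y) y (f (v + y)); rewrite addrK (feq Ov) => X.
  by rewrite mulmxBr !(aE, nE) -X /w subrK (feq Oy); ring.
rewrite E; apply: le_trans (ler_normB _ _) _; rewrite normrN.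
apply: (@le_trans _ _ (e1 * (c * `|v|) + `|v| * (N%:R * e1))).
  apply: lerD.
    apply: le_trans (L2 i) _; rewrite ler_pM2l //.
  rewrite mxE; apply: le_trans (ler_norm_sum _ _ _) _.
  apply: (@le_trans _ _ (\sum_(j < N) `|v| * e1)); last first.
    by rewrite sumr_const card_ord -[leLHS]mulr_natl mulrCA.
  apply: ler_sum => j _; rewrite normrM; apply: ler_pM => //; first exact: coord_le.
  by rewrite !mxE; exact: (L1 (i, j)).
by rewrite le_eqVlt; apply/orP; left; apply/eqP; ring.
Unshelve. all: by end_near. Qed.

(** Bootstrap: the formula for Df involves f only through smooth functions, so if
    f is of class C^k then so is Df. *)
Lemma sol_smooth : smooth_on O f.
Proof.
elim=> [|k IH]; first by move=> y; exact: sol_cont.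
split=> [y Oy|v]; first exact: (sol_diff Oy).1.
apply: (@Ck_eq _ _ _ _ _ (dsol ^~ v)) => //.
  by move=> y Oy; rewrite (sol_diff Oy).2.
have fU y : O y -> U0 (f y) by move=> /fr /rU.
apply: Ck_row => // i.
apply: (@Ck_eq _ _ _ _ _ (fun y => \sum_l - (\sum_j v 0 j * L l j (f y)) * invmx (Jac y (f y)) l i)) => //.
  move=> y Oy; rewrite /dsol mxE; apply: eq_bigr => l _; congr (_ * _).
  by rewrite !mxE; congr (- _); apply: eq_bigr => j _; rewrite mxE.
apply: Ck_sum => // l _; apply: CkM => //.
  apply: CkN => //; apply: Ck_sum => // j _; apply: CkM => //; first exact: Ck_cst.
  exact: (Ck_comp Oo fU IH (Ls l j k)).
apply: Ck_invmx => //; last exact: Jac_unit.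
move=> a c.
apply: (@Ck_eq _ _ _ _ _ (fun y : E => \sum_j y 0 j * 'D_(ebase a) (L c j) (f y) + 'D_(ebase a) (b c) (f y))) => //.
  by move=> y Oy; rewrite mxE.
apply: CkD => //; last exact: (Ck_comp Oo fU IH ((bs c k.+1).2 _)).
apply: Ck_sum => // j _; apply: CkM => //; last exact: (Ck_comp Oo fU IH ((Ls c j k.+1).2 _)).
apply: Ck_coord => //; exact: Ck_id.
Qed.

End Solution.

(** Any map that solves the system near x0 is smooth, and solutions are unique
    there. Both facts are used: the first for the nearest point map, the second to see
    that it is constant along normal directions. *)
Lemma implicit_smooth : exists r : R, [/\ 0 < r, ball x0 r `<=` U0,
   (forall y q q', ball x0 r y -> ball x0 r q -> ball x0 r q' ->
      (forall i, implicit_eq i y q = 0) -> (forall i, implicit_eq i y q' = 0) -> q' = q)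
   & forall (O : set E) (f : E -> E), open O -> O `<=` ball x0 r ->
      (forall y, O y -> ball x0 r (f y)) ->
      (forall y, O y -> forall i, implicit_eq i y (f y) = 0) -> smooth_on O f].
Proof.
have [r [K [C [[r0 K0 C0] rU Jbd einj Lbd]]]] := implicit_eq_uniform.
exists r; split => //.
  move=> y q q' yr qr qr' H H'; apply/eqP; rewrite -subr_eq0 -normr_le0.
  rewrite -(mulr0 K); apply: (einj y) => // i.
  by rewrite H H' subrr normr0.
move=> O f Oo Or fr feq; exact: (sol_smooth K0 C0 rU Jbd einj Lbd Oo Or fr feq).
Qed.

End Implicit.

(** * The Euclidean scalar product *)

Section Dot.
Context {R : realType} {N : nat}.
Local Notation E := 'rV[R]_N.
Implicit Types u v w : E.

Lemma dotvC u v : dotv u v = dotv v u.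
Proof. by apply: eq_bigr => i _; rewrite mulrC. Qed.

Lemma dotvDl u v w : dotv (u + v) w = dotv u w + dotv v w.
Proof. by rewrite -big_split; apply: eq_bigr => i _; rewrite mxE mulrDl. Qed.

Lemma dotvZl a u w : dotv (a *: u) w = a * dotv u w.
Proof. by rewrite mulr_sumr; apply: eq_bigr => i _; rewrite mxE mulrA. Qed.

Lemma dotvNl u w : dotv (- u) w = - dotv u w.
Proof. by rewrite -scaleN1r dotvZl mulN1r. Qed.

Lemma dotvBl u v w : dotv (u - v) w = dotv u w - dotv v w.
Proof. by rewrite dotvDl dotvNl. Qed.

Lemma dotvDr u v w : dotv w (u + v) = dotv w u + dotv w v.
Proof. by rewrite dotvC dotvDl !(dotvC w). Qed.

Lemma dotvZr a u w : dotv w (a *: u) = a * dotv w u.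
Proof. by rewrite dotvC dotvZl (dotvC w). Qed.

Lemma dotvBr u v w : dotv w (u - v) = dotv w u - dotv w v.
Proof. by rewrite dotvC dotvBl !(dotvC w). Qed.

Lemma dot0v w : dotv 0 w = 0.
Proof. by rewrite -(scale0r 0) dotvZl mul0r. Qed.

Lemma dotv0 w : dotv w 0 = 0.
Proof. by rewrite dotvC dot0v. Qed.

Lemma dotv_suml (I : Type) (r : seq I) (P : pred I) (F : I -> E) w :
  dotv (\sum_(i <- r | P i) F i) w = \sum_(i <- r | P i) dotv (F i) w.
Proof.
by elim/big_ind2: _ => [|u a v b <- <-|//]; [rewrite dot0v|rewrite dotvDl].
Qed.

Lemma dotv_basis u i : dotv u (ebase i) = u 0 i.
Proof.
rewrite /dotv (bigD1 i) //= big1 ?addr0; first by rewrite mxE !eqxx mulr1.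
by move=> j ji; rewrite mxE eqxx (negbTE ji) mulr0.
Qed.

Lemma dotv_ge0 u : 0 <= dotv u u.
Proof. by apply: sumr_ge0 => i _; rewrite -expr2 sqr_ge0. Qed.

Lemma dotv_eq0 u : dotv u u = 0 -> u = 0.
Proof.
move=> /eqP; rewrite psumr_eq0 => [/allP H|i _]; last by rewrite -expr2 sqr_ge0.
apply/rowP => i; rewrite mxE; apply/eqP.
by have := H i; rewrite mem_index_enum -expr2 sqrf_eq0; apply.
Qed.

Lemma normr_dotv u : `|u| ^+ 2 <= dotv u u.
Proof.
rewrite -ler_sqrt ?dotv_ge0 // sqrtr_sqr ger0_norm //.
apply: norm_le; first exact: sqrtr_ge0.
move=> i; rewrite -sqrtr_sqr ler_sqrt ?dotv_ge0 //.
by rewrite /dotv (bigD1 i) //= -expr2 lerDl sumr_ge0 // => j _; rewrite -expr2 sqr_ge0.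
Qed.

Lemma dotv_normr u : dotv u u <= N%:R * `|u| ^+ 2.
Proof.
apply: (@le_trans _ _ (\sum_(i < N) `|u| ^+ 2)).
  apply: ler_sum => i _; rewrite -expr2 -[leLHS]real_normK ?num_real //.
  by rewrite lerXn2r ?nnegrE // coord_le.
by rewrite sumr_const card_ord -[leLHS]mulr_natl.
Qed.

Lemma Ck_dotv (U : normedModType R) (D : set U) k (f g : U -> E) : open D ->
  Ck k D f -> Ck k D g -> Ck k D (fun x => dotv (f x) (g x)).
Proof. by move=> Do fk gk; apply: Ck_sum => // i _; apply: CkM => //; exact: Ck_coord. Qed.

Lemma is_derive_coord (U : normedModType R) (f : U -> E) (x v : U) f' i :
  is_derive x v f f' -> is_derive x v (fun y => f y 0 i) (f' 0 i).
Proof.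
move=> [df <-]; apply: DeriveDef; first by move/derivable_mxP: df; apply.
by rewrite derive_mx // mxE.
Qed.

Lemma is_derive_dotv (U : normedModType R) (f g : U -> E) (x v : U) f' g' :
  is_derive x v f f' -> is_derive x v g g' ->
  is_derive x v (fun y => dotv (f y) (g y)) (dotv f' (g x) + dotv (f x) g').
Proof.
move=> df dg.
have -> : (fun y => dotv (f y) (g y)) = \sum_(i < N) (fun y => f y 0 i * g y 0 i).
  by apply: funext => y; rewrite fct_sumE.
have -> : dotv f' (g x) + dotv (f x) g' = \sum_(i < N) (f x 0 i *: g' 0 i + g x 0 i *: f' 0 i).
  rewrite /dotv -big_split; apply: eq_bigr => i _ /=.
  by rewrite /GRing.scale /= addrC [g x 0 i * _]mulrC.
apply: is_derive_sum => i.
exact: (is_deriveM (is_derive_coord i df) (is_derive_coord i dg)).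
Qed.

Lemma is_derive_unique (U W : normedModType R) (f : U -> W) (x v : U) a b :
  is_derive x v f a -> is_derive x v f b -> a = b.
Proof. by move=> [_ <-] [_ <-]. Qed.

Lemma Ck_vcomp (U : normedModType R) (m : nat) (D : set U) (D' : set E) k (f : U -> E)
    (g : E -> 'rV[R]_m) : open D -> open D' ->
  (forall x, D x -> D' (f x)) -> Ck k D f -> Ck k D' g -> Ck k D (g \o f).
Proof.
move=> Do Do' fD fk gk; apply: Ck_row => // i.
exact: (Ck_comp (g := fun y => g y 0 i) Do fD fk (Ck_coord i Do' gk)).
Qed.

Lemma derive_near_cst (U W : normedModType R) (f : U -> W) (y v : U) :
  (\forall h \near (0 : R), f (h *: v + y) = f y) -> 'D_v f y = 0.
Proof.
move=> H; rewrite /derive; apply: cvg_lim => //.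
have : (fun=> 0 : W) @ (0 : R)^' --> (0 : W) by exact: cvg_cst.
apply: cvg_trans; apply: near_eq_cvg; apply: nbhs_dnbhs.
by apply: filterS H => h /= ->; rewrite subrr scaler0.
Qed.

End Dot.

(** * Nearest points *)

Section Nearest.
Context {R : realType} {N : nat} (M : set 'rV[R]_N).
Local Notation E := 'rV[R]_N.

(** A choice of nearest points; far from M there may be several. *)
Definition nearest (q : E -> E) := forall y, M (q y) /\
  forall z, M z -> dotv (y - q y) (y - q y) <= dotv (y - z) (y - z).

Lemma dotv_smooth_at (y : E) : smooth_on setT (fun z : E => dotv (y - z) (y - z)).
Proof.
have H : smooth_on setT (fun z : E => y - z).
  move=> k; apply: CkD; [exact: openT|exact: Ck_cst|].
  apply: Ck_row => [|i]; first exact: openT.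
  apply: (@Ck_eq _ _ _ _ _ (fun z : E => - z 0 i)); first exact: openT.
    by move=> z _; rewrite mxE.
  by apply: CkN; [exact: openT|apply: Ck_coord; [exact: openT|exact: Ck_id]].
by move=> k; apply: Ck_dotv => //; exact: openT.
Qed.

Lemma nearest_ex : compact M -> M !=set0 -> exists q, nearest q.
Proof.
move=> Mc M0.
have H y : {z | M z /\ forall z', M z' -> dotv (y - z) (y - z) <= dotv (y - z') (y - z')}.
  apply: cid.
  have c : {within M, continuous (fun z : E => dotv (y - z) (y - z))}.
    apply: continuous_subspaceT => z.
    exact: (dotv_smooth_at y 0%N z I).
  have [z zM Hz] := EVT_min_rV M0 Mc c.
  exists z; split; first by rewrite inE in zM.
  by move=> z' Mz'; apply: Hz; rewrite inE.
by exists (fun y => sval (H y)) => y; exact: (svalP (H y)).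
Qed.

Variable q : E -> E.
Hypothesis qn : nearest q.

(** Expand |y - q y|^2 in the definition of A. *)
Lemma AM_nearest y : AM M y = dotv y (q y) - dotv (q y) (q y) / 2.
Proof.
have [Mq qmin] := qn y.
have -> : AM M y = (dotv y y - dotv (y - q y) (y - q y)) / 2.
  rewrite /AM /dist.
  have -> : inf [set enorm (y - z) | z in M] = enorm (y - q y).
    apply/eqP; rewrite eq_le; apply/andP; split.
      apply: ge_inf; last by exists (q y).
      by exists 0 => _ [z _ <-]; exact: sqrtr_ge0.
    apply: lb_le_inf; first by exists (enorm (y - q y)); exists (q y).
    by move=> _ [z Mz <-]; rewrite ler_sqrt ?dotv_ge0 //; exact: qmin.
  by rewrite /enorm !sqr_sqrtr ?dotv_ge0.
by rewrite !dotvBl !dotvBr (dotvC (q y) y); lra.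
Qed.

Lemma nearest_fix x : M x -> q x = x.
Proof.
move=> Mx; have [_ /(_ _ Mx)] := qn x; rewrite subrr dot0v => H.
have : dotv (x - q x) (x - q x) = 0 by apply/le_anti; rewrite H dotv_ge0.
by move=> /dotv_eq0 /subr0_eq.
Qed.

(** The function |y - c t|^2 of the time of a curve c in M is minimal at 0. *)
Lemma first_order y z X : M z ->
  (forall z', M z' -> dotv (y - z) (y - z) <= dotv (y - z') (y - z')) ->
  tangent M z X -> dotv (y - z) X = 0.
Proof.
move=> Mz zmin [c [[e e0 [cs cM]] c0 dc]].
have co t : `|t| < e -> differentiable c t by move=> te; exact: (cs 1%N).1.
have dd (t : R) c' : is_derive t 1 c c' ->
    is_derive t 1 (fun t => dotv (y - c t) (y - c t)) (- (dotv (y - c t) c' + dotv (y - c t) c')).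
  move=> dct.
  have d1 : is_derive t 1 (fun t => y - c t) (- c').
    rewrite -[X in is_derive _ _ _ X]add0r.
    exact: (is_deriveB (f := cst y)).
  have := is_derive_dotv d1 d1.
  by rewrite dotvC -[X in dotv _ X]scaleN1r dotvZr mulN1r -opprD.
have e1 : -e <= e by rewrite ge0_cp // ltW.
have in0 : (0 : R) \in `]- e, e[ by rewrite in_itv /= oppr_lt0 e0.
have D0 := dd 0 X dc; rewrite c0 in D0.
have D1 : is_derive (0 : R) 1 (fun t => dotv (y - c t) (y - c t)) 0.
  apply: (@derive1_at_min R _ (- e) e) => //.
    move=> t; rewrite in_itv /= => te.
    have dct : derivable c t 1 by apply/derivable1_diffP; apply: co; rewrite ltr_norml.
    have [] := dd t _ (derivableP dct).
    by [].
  move=> t; rewrite in_itv /= => te; rewrite c0; apply: zmin; apply: cM.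
  by rewrite ltr_norml.
have := is_derive_unique D0 D1 => /eqP; rewrite oppr_eq0 -mulr2n mulrn_eq0 /=.
by move/eqP.
Qed.

(** The norm of the space is the sup norm, whence the factor that depends on the
    dimension; |y - q y| <= |y - x| holds for the Euclidean norm. *)
Lemma nearest_close x y : M x -> `|y - q y| <= (N%:R + 1) * `|y - x|.
Proof.
move=> Mx; have [_ /(_ _ Mx) H] := qn y.
have N0 : 0 <= N%:R + 1 :> R by rewrite addr_ge0.
rewrite -(ler_pXn2r (n := 2)) ?nnegrE ?mulr_ge0 //.
apply: le_trans (normr_dotv _) _; apply: le_trans H _.
apply: le_trans (dotv_normr _) _; rewrite exprMn ler_wpM2r ?exprn_ge0 //.
rewrite expr2 mulrDl mul1r mulrDr mulr1.
have : 0 <= N%:R * N%:R :> R by rewrite mulr_ge0.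
have : 0 <= N%:R :> R by [].
lra.
Qed.

End Nearest.

(** * The nearest point map in a slice chart *)

Section Chart.
Context {R : realType} {n m : nat}.
Local Notation E := 'rV[R]_(n + m).
Variables (M : set E) (q : E -> E).
Hypothesis qn : nearest M q.
Variables (x0 : E) (U V : set E) (phi psi : E -> E).
Hypotheses (Mx0 : M x0) (Uo : open U) (Ux : U x0) (Vo : open V).
Hypotheses (phis : smooth_on U phi) (psis : smooth_on V psi).
Hypotheses (phiV : forall y, U y -> V (phi y)) (phiK : forall y, U y -> psi (phi y) = y).
Hypotheses (psiU : forall z, V z -> U (psi z)) (psiK : forall z, V z -> phi (psi z) = z).
Hypothesis MU : forall y, U y -> (M y <-> rsubmx (phi y) = 0).

(* For i < n the vector T i z is tangent to the level set of the chart through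
   z, and the i-th equation says that y - z is orthogonal to it; for i >= n the
   equation is one of the equations of M. *)
Let T (i : 'I_(n + m)) (z : E) : E := 'D_(ebase i) psi (phi z).
Let L (i j : 'I_(n + m)) (z : E) : R := if (i < n)%N then T i z 0 j else 0.
Let b (i : 'I_(n + m)) (z : E) : R :=
  if (i < n)%N then - dotv z (T i z) else phi z 0 i.

Let T_smooth i : smooth_on U (T i).
Proof. by move=> k; exact: (Ck_vcomp Uo Vo phiV (phis k) ((psis k.+1).2 (ebase i))). Qed.

Let L_smooth i j : smooth_on U (L i j).
Proof.
move=> k; rewrite /L; case: (i < n)%N; last exact: Ck_cst.
exact: (Ck_coord j Uo (T_smooth i k)).
Qed.

Let b_smooth i : smooth_on U (b i).
Proof.
move=> k; rewrite /b; case: (i < n)%N; last exact: (Ck_coord i Uo (phis k)).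
apply: CkN => //; apply: Ck_dotv => //; [exact: Ck_id|exact: T_smooth].
Qed.

Let chart_eqE i y z : implicit_eq L b i y z = if (i < n)%N then dotv (y - z) (T i z) else phi z 0 i.
Proof.
rewrite /implicit_eq /L /b; case: (i < n)%N; first by rewrite dotvBl.
by rewrite big1 ?add0r // => j _; rewrite mulr0.
Qed.

Let M_coord y (i : 'I_(n + m)) : U y -> M y -> (n <= i)%N -> phi y 0 i = 0.
Proof.
move=> Uy /(MU Uy) H ni.
have im : (i - n < m)%N by rewrite ltn_subLR.
have -> : i = rshift n (Ordinal im) by apply: val_inj; rewrite /= subnKC.
by have := congr1 (fun A : 'rV_m => A 0 (Ordinal im)) H; rewrite !mxE.
Qed.

Let T_tangent (i : 'I_(n + m)) y : U y -> M y -> (i < n)%N -> tangent M y (T i y).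
Proof.
move=> Uy My ni.
have /nbhs_ballP [e /= e0 He] := nbhs_open Vo (phiV Uy).
have inV (t : R) : `|t| < e -> V (phi y + t *: ebase i).
  move=> te; apply: He; rewrite -ball_normE /= opprD addNKr normrN.
  apply: le_lt_trans te; rewrite normrZ ler_piMr //.
  by apply: norm_le => // j; rewrite mxE eqxx /=; case: eqP; rewrite ?normr1 ?normr0.
exists (fun t => psi (phi y + t *: ebase i)); split.
- exists e => //; split.
    move=> k; apply: (Ck_vcomp (D' := V) _ Vo _ _ (psis k)) => //.
      have -> : [set t : R | `|t| < e] = ball (0 : R) e.
        by apply/seteqP; split => t; rewrite -ball_normE /= sub0r normrN.
      exact: ball_open.
    exact: Ck_line.
  move=> t te; have Vt := inV t te; apply/MU; first exact: psiU.
  rewrite psiK //; apply/rowP => j; rewrite !mxE /= M_coord ?leq_addr // add0r.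
  case: eqP => [/(congr1 val) /= E|_]; last by rewrite mulr0.
  by move: ni; rewrite -E ltnNge leq_addr.
- by rewrite scale0r addr0 phiK.
- have D := is_derive_line (phi y) (ebase i) 0.
  have := is_derive_along (f := psi) D.
  rewrite scale0r addr0; apply.
  exact: ((psis 1%N).1 _ (phiV Uy)).
Qed.

(* A vector killed by the Jacobian at x0 has, from the last m equations, no
   components in the normal coordinates of the chart, so it is a combination of
   the T i; the first n equations make it orthogonal to them. *)
Let J_inj (v : E) : v *m Jac L b x0 x0 = 0 -> v = 0.
Proof.
move=> Jv.
have H i : 'D_v (implicit_eq L b i x0) x0 = 0.
  by rewrite (Jac_derive Uo L_smooth b_smooth) // Jv mxE.
pose w := 'D_v phi x0.
have dphi : differentiable phi x0 by exact: ((phis 1%N).1 _ Ux).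
have dpsi : differentiable psi (phi x0) by exact: ((psis 1%N).1 _ (phiV Ux)).
have vE : v = \sum_i w 0 i *: T i x0.
  rewrite -[RHS](derive_chain v dphi dpsi) -[LHS](derive_id x0 v).
  apply: near_eq_derive; apply: filterS (nbhs_open Uo Ux) => y Uy.
  by rewrite /= phiK.
have w0 (i : 'I_(n + m)) : (n <= i)%N -> w 0 i = 0.
  move=> ni; have := H i; rewrite /w derive_mx ?mxE; last exact: diff_derivable.
  move=> <-; apply: near_eq_derive; apply: filterE => y.
  by rewrite chart_eqE ltnNge ni.
have vT (i : 'I_(n + m)) : (i < n)%N -> dotv v (T i x0) = 0.
  move=> ni; have := H i.
  have dT : differentiable (T i) x0 by exact: ((T_smooth i 1%N).1 _ Ux).
  have dd : is_derive x0 v (fun z => x0 - z) (- v).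
    rewrite -[X in is_derive _ _ _ X]add0r.
    exact: (is_deriveB (f := cst x0)).
  have [_ E] := is_derive_dotv dd (derivableP (diff_derivable dT)).
  rewrite subrr dot0v addr0 dotvNl in E.
  have -> : implicit_eq L b i x0 = (fun z => dotv (x0 - z) (T i z)).
    by apply: funext => z; rewrite chart_eqE ni.
  by rewrite E => /eqP; rewrite oppr_eq0 => /eqP.
apply: dotv_eq0; rewrite {2}vE dotvC dotv_suml big1 // => i _.
rewrite dotvZl; case: (ltnP i n) => ni; last by rewrite w0 ?mul0r.
by rewrite dotvC vT // mulr0.
Qed.

(** Nearest points solve the equations of the chart; so does x0 itself for the
    parameter x0 + v with v normal, which gives the last claim by uniqueness. *)
Lemma nearest_smooth_chart : exists2 r : R, 0 < r & smooth_on (ball x0 r) q /\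
  forall v, normal M x0 v -> ball x0 r (x0 + v) -> q (x0 + v) = x0.
Proof.
have [r [r0 rU runiq rsmooth]] := implicit_smooth Uo Ux L_smooth b_smooth J_inj.
(* By nearest_close, q y stays in the ball of radius r around x0 as soon as y
   is in that of radius r / C. *)
pose C : R := (n + m)%:R + 2.
have C1 : 1 <= C by rewrite /C; have := ler0n R (n + m); lra.
have C0 : 0 < C by exact: lt_le_trans C1.
exists (r / C); first by rewrite divr_gt0.
have sub : ball x0 (r / C) `<=` ball x0 r.
  by apply: le_ball; rewrite ler_pdivrMr // ler_peMr // ltW.
have qb y : ball x0 (r / C) y -> ball x0 r (q y).
  rewrite -!ball_normE /= => H.
  have -> : x0 - q y = (x0 - y) + (y - q y) by rewrite addrA subrK.
  apply: le_lt_trans (ler_normD _ _) _.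
  apply: (@le_lt_trans _ _ (C * `|x0 - y|)); last by rewrite mulrC -ltr_pdivlMr.
  have := nearest_close qn y Mx0; rewrite (distrC y x0) /C.
  by move: `|x0 - y| `|y - q y| => a d H'; rewrite mulrDl in H'; rewrite mulrDl; lra.
have qeq y : ball x0 (r / C) y -> forall i, implicit_eq L b i y (q y) = 0.
  move=> yb i; have Uq := rU _ (qb _ yb); have [Mq qmin] := qn y.
  rewrite chart_eqE; case: ltnP => ni; last exact: M_coord.
  by apply: (first_order Mq qmin); exact: T_tangent.
split; first by apply: rsmooth => //; exact: ball_open.
move=> v nv vb.
have x0b : ball x0 (r / C) x0 by apply: ballxx; rewrite divr_gt0.
apply: (runiq (x0 + v)) => //; first exact: sub.
- exact: sub.
- exact: qb.
- move=> i; rewrite chart_eqE; case: ltnP => ni; last exact: M_coord.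
  by rewrite addrC addKr dotvC; apply: nv; exact: T_tangent.
- exact: qeq.
Qed.

End Chart.

(** * The tubular neighbourhood *)

#[local] Opaque derive.

(** Iterated derivatives and the choice-based operators of the geometry unfold to
    limits and choices. Sealed copies of them are compared by their arguments
    only. *)
Lemma seal (T : Type) (x : T) : {y | y = x}.
Proof. by exists x. Qed.

Definition sealed (T : Type) (x : T) : T := sval (seal x).

Lemma sealedE (T : Type) (x : T) : sealed x = x.
Proof. exact: svalP (seal x). Qed.

Section DA.
Context {R : realType} {N : nat}.
Local Notation E := 'rV[R]_N.

(** The iterated derivative of A along constant vectors; the first vector of the
    list is the direction of the last derivative. *)
Definition DA : set E -> seq E -> E -> R :=
  sealed (fun M Vs => foldr (fun V g => 'D_V g) (AM M) Vs).

Definition prj : set E -> E -> E -> E := sealed (@tproj R N).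

Variable M : set E.

Lemma DA_nil : DA M [::] = AM M.
Proof. by rewrite /DA sealedE. Qed.

Lemma DA_cons V Vs : DA M (V :: Vs) = 'D_V (DA M Vs).
Proof. by rewrite /DA sealedE. Qed.

Lemma prjE : prj = @tproj R N.
Proof. exact: sealedE. Qed.

(** What the geometry of the nearest point provides: A is smooth near M; on M its
    Hessian is the tangential projection, whose range is the tangent space and
    whose kernel is the normal space; a derivative with normal vectors in all
    slots but the innermost one vanishes on M. *)
Definition tube (Om : set E) : Prop :=
  [/\ [/\ open Om, M `<=` Om & smooth_on Om (AM M)],
      (forall x V W, M x -> dotv (prj M x V) W = DA M [:: V; W] x),
      (forall x V, M x -> tangent M x (prj M x V)) /\
      (forall x X, M x -> tangent M x X -> prj M x X = X),
      (forall x V, M x -> (normal M x V <-> prj M x V = 0))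
    & (forall x Ns V, M x -> Ns != [::] -> (forall v, v \in Ns -> normal M x v) ->
         DA M (rcons Ns V) x = 0)].

End DA.

Section Tube.
Context {R : realType} {n m : nat}.
Local Notation E := 'rV[R]_(n + m).
Variables (M : set E) (q : E -> E).
Hypothesis Msub : smooth_submanifold M.
Hypothesis qn : nearest M q.

Definition good_ball (x : E) (r : R) : Prop := [/\ 0 < r, smooth_on (ball x r) q &
  forall v, normal M x v -> ball x r (x + v) -> q (x + v) = x].

Lemma good_ball_ex x : M x -> exists r, good_ball x r.
Proof.
move=> Mx; have [U [V [phi [psi [[Uo Ux] Vo [phis psis] [phiP psiP] MU]]]]] := Msub Mx.
have [||||r r0 [qs qN]] :=
   nearest_smooth_chart qn Mx Uo Ux Vo phis psis _ _ _ _ MU.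
- by move=> y /phiP[].
- by move=> y /phiP[].
- by move=> y /psiP[].
- by move=> y /psiP[].
by exists r.
Qed.

Definition Om : set E :=
  \bigcup_(p in [set p : E * R | M p.1 /\ good_ball p.1 p.2]) ball p.1 p.2.

Lemma Om_open : open Om.
Proof. by apply: bigcup_open => -[y r] [/= _ [r0 _ _]]; exact: ball_open. Qed.

Lemma M_Om : M `<=` Om.
Proof.
move=> x Mx; have [r gr] := good_ball_ex Mx; exists (x, r) => //=.
by apply: ballxx; case: gr.
Qed.

Lemma q_smooth : smooth_on Om q.
Proof. by move=> k; apply: Ck_bigcup => -[x r] [_ []]. Qed.

Lemma q_diff y : Om y -> differentiable q y.
Proof. exact: ((q_smooth 1%N).1). Qed.

(** The image of a line under q is a curve in M; its velocity is thus tangent, which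
    makes Dq take tangent values. *)
Lemma curve_in_M y V : Om y -> curve_at M (q y) ('D_V q y) (fun t => q (y + t *: V)).
Proof.
move=> Oy; have /nbhs_ballP [e /= e0 He] := nbhs_open Om_open Oy.
pose d := e / (`|V| + 1).
have V1 : 0 < `|V| + 1 by rewrite ltr_wpDl.
have d0 : 0 < d by rewrite divr_gt0.
have inO (t : R) : `|t| < d -> Om (y + t *: V).
  move=> td; apply: He; rewrite -ball_normE /= opprD addNKr normrN normrZ.
  apply: (@le_lt_trans _ _ (`|t| * (`|V| + 1))); last by rewrite -ltr_pdivlMr.
  by rewrite ler_wpM2l // lerDl.
have od : open [set t : R | `|t| < d].
  have -> : [set t : R | `|t| < d] = ball (0 : R) d.
    by apply/seteqP; split => t; rewrite -ball_normE /= sub0r normrN.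
  exact: ball_open.
split.
- exists d => //; split=> [k|t _]; last by have [] := qn (y + t *: V).
  exact: (Ck_vcomp od Om_open inO (@Ck_line _ _ _ k y V) (q_smooth k)).
- by rewrite scale0r addr0.
- have := is_derive_along (f := q) (is_derive_line y V 0).
  by rewrite scale0r addr0; apply; exact: q_diff.
Qed.

Lemma Dq_tangent y V : Om y -> tangent M (q y) ('D_V q y).
Proof. by move=> Oy; eexists; exact: curve_in_M. Qed.

(** In the derivative of <y, q> - |q|^2 / 2 the terms with Dq add up to <y - q, D_V q>,
    which is zero because D_V q is tangent at the nearest point. *)
Lemma D_AM y V : Om y -> 'D_V (AM M) y = dotv V (q y).
Proof.
move=> Oy; have -> : AM M = (fun y => dotv y (q y)) - (2^-1 \*: (fun y => dotv (q y) (q y))).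
  by apply: funext => z; rewrite (AM_nearest qn) !fctE /= [_ / 2]mulrC.
have dq : is_derive y V q ('D_V q y) by apply/derivableP/diff_derivable/q_diff.
have d1 := is_derive_dotv (is_derive_id y V) dq.
have d2 := is_deriveZ (2^-1) (is_derive_dotv dq dq).
have [_ ->] := is_deriveB d1 d2.
have [Mq qmin] := qn y.
have H : dotv (y - q y) ('D_V q y) = 0 by apply: (first_order Mq qmin); exact: Dq_tangent.
rewrite /GRing.scale /= (dotvC ('D_V q y) (q y)).
move: H; rewrite dotvBl; move: (dotv _ ('D_V q y)) (dotv (q y) _) (dotv V _) => a b c; lra.
Qed.

Lemma AM_smooth : smooth_on Om (AM M).
Proof.
move=> k; apply: (@Ck_eq _ _ _ _ _ (fun y => dotv y (q y) + - (dotv (q y) (q y) * (2^-1)))).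
- exact: Om_open.
- by move=> y _; rewrite (AM_nearest qn).
- apply: CkD; first exact: Om_open.
    apply: Ck_dotv; [exact: Om_open|exact: Ck_id|exact: q_smooth].
  apply: CkN; first exact: Om_open.
  apply: CkM; [exact: Om_open| |exact: Ck_cst].
  apply: Ck_dotv; [exact: Om_open|exact: q_smooth|exact: q_smooth].
Qed.

Lemma DDA y V W : Om y -> DA M [:: V; W] y = dotv ('D_V q y) W.
Proof.
move=> Oy; rewrite !DA_cons DA_nil.
have dq : is_derive y V q ('D_V q y) by apply/derivableP/diff_derivable/q_diff.
have [_ E] := is_derive_dotv (is_derive_cst W y V) dq.
rewrite dot0v add0r in E; rewrite dotvC -E.
apply: near_eq_derive; apply: filterS (nbhs_open Om_open Oy) => z; exact: D_AM.
Qed.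

Lemma Dq_sym y V W : Om y -> dotv ('D_V q y) W = dotv ('D_W q y) V.
Proof.
move=> Oy; rewrite -(DDA V W Oy) -(DDA W V Oy) !DA_cons DA_nil.
have H1 : \forall z \near y, differentiable (AM M) z.
  by apply: filterS (nbhs_open Om_open Oy) => z; exact: (AM_smooth 1%N).1.
have H2 := (((AM_smooth 2%N).2 W).1 _ Oy).
have H3 := (((AM_smooth 2%N).2 V).1 _ Oy).
exact: (derive_sym H1 H2 H3).
Qed.

Lemma tangent_fix x X : M x -> tangent M x X -> 'D_X q x = X.
Proof.
move=> Mx [c [[e e0 [cs cM]] c0 dc]].
have Ox : Om (c 0) by rewrite c0; exact: M_Om.
have D := is_derive_along dc (q_diff Ox); rewrite c0 in D.
apply: is_derive_unique D _.
apply: near_eq_is_derive dc.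
apply: filterS (@nbhs0_lt _ _ _ e0) => t te /=.
by rewrite (nearest_fix qn) //; exact: cM.
Qed.

(** Dq is symmetric (it is the Hessian of A) and the identity on tangent vectors
    (q is the identity on M), with tangent values: hence the orthogonal projection. *)
Lemma tproj_D x V : M x -> tproj M x V = 'D_V q x.
Proof.
move=> Mx; have Ox := M_Om Mx; have qx := nearest_fix qn Mx.
have dq := q_diff Ox.
have t1 W : tangent M x ('D_W q x) by rewrite -{1}qx; exact: Dq_tangent.
rewrite /tproj; apply: xget_unique.
  split => // X tX; rewrite dotvBr.
  have <- : dotv ('D_X q x) V = dotv X ('D_V q x) by rewrite Dq_sym // dotvC.
  by rewrite tangent_fix // subrr.
move=> W [tW nW]; apply/eqP; rewrite -subr_eq0; apply/eqP/dotv_eq0.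
have tD : tangent M x (W - 'D_V q x).
  have -> : W - 'D_V q x = 'D_(W - V) q x.
    by rewrite [RHS](deriveE _ dq) linearB -!(deriveE _ dq) (tangent_fix Mx tW).
  exact: t1.
have H1 := nW _ tD.
have H2 : dotv (W - 'D_V q x) (V - 'D_V q x) = 0.
  rewrite dotvBr; have <- : dotv ('D_(W - 'D_V q x) q x) V = dotv (W - 'D_V q x) ('D_V q x).
    by rewrite Dq_sym // dotvC.
  by rewrite (tangent_fix Mx tD) subrr.
have -> : dotv (W - 'D_V q x) (W - 'D_V q x) =
  dotv (W - 'D_V q x) (V - 'D_V q x) - dotv (W - 'D_V q x) (V - W).
  by rewrite !dotvBr; move: (dotv _ _) (dotv _ _) (dotv _ _) => a b c; lra.
by rewrite H1 H2 subrr.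
Qed.

(** On the normal slice x + v, q is constant, so D_V A = <V, q> is constant there;
    the remaining normal derivatives are taken inside the slice. *)
Lemma DA_normal x Ns V : M x -> Ns != [::] ->
  (forall v, v \in Ns -> normal M x v) -> DA M (rcons Ns V) x = 0.
Proof.
move=> Mx Ns0 nNs.
have [r [r0 rs rq]] := good_ball_ex Mx.
have bO : ball x r `<=` Om.
  by move=> z zb; exists (x, r) => //; split.
suff H v : normal M x v -> ball x r (x + v) -> DA M (rcons Ns V) (x + v) = 0.
  rewrite -[x]addr0; apply: H; last by rewrite addr0; exact: ballxx.
  by move=> X _; rewrite dotv0.
have nD u w (h : R) : normal M x u -> normal M x w -> normal M x (h *: u + w).
  by move=> nu nw X tX; rewrite dotvDr dotvZr nu // nw // mulr0 addr0.
elim: Ns Ns0 nNs v => // N0 [|N1 Ns] IH _ nNs v nv bv.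
  rewrite DA_cons; apply: derive_near_cst.
  have bo := near_line N0 (ball_open x r) bv.
  apply: filterS bo => h bh.
  rewrite /= DA_cons DA_nil !D_AM; [|exact: bO|exact: bO].
  have E : h *: N0 + (x + v) = x + (h *: N0 + v) by rewrite addrCA.
  rewrite E in bh *; rewrite !rq //.
  by apply: nD => //; apply: nNs; rewrite mem_head.
rewrite rcons_cons DA_cons; apply: derive_near_cst.
have nNs' w : w \in N1 :: Ns -> normal M x w by move=> H; apply: nNs; rewrite inE H orbT.
have bo := near_line N0 (ball_open x r) bv.
apply: filterS bo => h bh.
have E : h *: N0 + (x + v) = x + (h *: N0 + v) by rewrite addrCA.
rewrite E in bh *.
have nN0v : normal M x (h *: N0 + v) by apply: nD => //; apply: nNs; rewrite mem_head.
by rewrite (IH isT nNs' _ nN0v bh) (IH isT nNs' _ nv bv).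
Qed.

Lemma tube_nearest : tube M Om.
Proof.
split.
- by split; [exact: Om_open|exact: M_Om|exact: AM_smooth].
- by move=> x V W Mx; rewrite prjE tproj_D // DDA //; exact: M_Om.
- split=> [x V Mx|x X Mx tX]; last by rewrite prjE tproj_D // tangent_fix.
  by rewrite prjE tproj_D // -{1}(nearest_fix qn Mx); apply: Dq_tangent; exact: M_Om.
- move=> x V Mx; rewrite prjE tproj_D //; have Ox := M_Om Mx; split => [nV|H X tX].
    apply: dotv_eq0; rewrite Dq_sym // dotvC.
    have tt : tangent M x ('D_V q x) by rewrite -{1}(nearest_fix qn Mx); exact: Dq_tangent.
    by rewrite tangent_fix // dotvC; exact: nV.
  by rewrite -(tangent_fix Mx tX) Dq_sym // H dot0v.
- exact: DA_normal.
Qed.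

End Tube.

Lemma tube_ex {R : realType} (n m : nat) (M : set 'rV[R]_(n + m)) :
  smooth_submanifold M -> compact M -> M !=set0 -> exists O, tube M O.
Proof.
move=> Ms Mc M0; have [q qn] := nearest_ex Mc M0.
by exists (Om M q); exact: tube_nearest.
Qed.

(** * Derivatives along M *)

Definition tderR {R : realType} {N : nat} :
    set 'rV[R]_N -> 'rV[R]_N -> 'rV[R]_N -> ('rV[R]_N -> R) -> R :=
  sealed (fun M x X f => tder M x X (f : 'rV[R]_N -> (R : normedModType R))).

Section OnM.
Context {R : realType} {N : nat} (M Om : set 'rV[R]_N).
Local Notation E := 'rV[R]_N.
Hypothesis tM : tube M Om.
Local Notation DA := (DA M).
Local Notation tproj := (tproj M).
Local Notation tder := (tder M).
Local Notation tdr := (tderR M).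
Local Notation tangent := (tangent M).

Let Om_open : open Om. Proof. by case: tM => -[]. Qed.
Let M_Om : M `<=` Om. Proof. by case: tM => -[]. Qed.
Let AM_smooth : smooth_on Om (AM M). Proof. by case: tM => -[]. Qed.

Lemma smooth_derive (f : E -> R) V : smooth_on Om f -> smooth_on Om ('D_V f).
Proof. by move=> fs k; exact: ((fs k.+1).2 V). Qed.

Lemma smooth_diff (f : E -> R) y : smooth_on Om f -> Om y -> differentiable f y.
Proof. by move=> fs; exact: ((fs 1%N).1 y). Qed.

Lemma DA_smooth Vs : smooth_on Om (DA Vs).
Proof.
elim: Vs => [|V Vs IH]; first by rewrite DA_nil; exact: AM_smooth.
by rewrite DA_cons; exact: smooth_derive.
Qed.

Lemma DA_diff Vs y : Om y -> differentiable (DA Vs) y.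
Proof. by apply: smooth_diff; exact: DA_smooth. Qed.

Lemma derive_eq_on (f g : E -> R) V y : Om y -> (forall z, Om z -> f z = g z) ->
  'D_V f y = 'D_V g y.
Proof.
by move=> Oy fg; apply: near_eq_derive; apply: filterS (nbhs_open Om_open Oy) => z; exact: fg.
Qed.

Lemma DA_lin pre a u v post y : Om y ->
  DA (pre ++ (a *: u + v) :: post) y = a * DA (pre ++ u :: post) y + DA (pre ++ v :: post) y.
Proof.
elim: pre y => [|w pre IH] y Oy.
  rewrite /= !DA_cons deriveDdir; last exact: DA_diff.
  by rewrite deriveZdir //; exact: DA_diff.
rewrite /= !DA_cons (derive_eq_on w Oy IH).
have -> : (fun z : E => a * DA (pre ++ u :: post) z + DA (pre ++ v :: post) z) =
  (a \*: DA (pre ++ u :: post)) + DA (pre ++ v :: post) by [].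
have d s : derivable (DA s) y w by apply: diff_derivable; exact: DA_diff.
by rewrite deriveD ?deriveZ //; exact: derivableZ.
Qed.

Lemma DA_swap u v post y : Om y -> DA [:: u, v & post] y = DA [:: v, u & post] y.
Proof.
move=> Oy; rewrite !DA_cons.
have H1 : \forall z \near y, differentiable (DA post) z.
  by apply: filterS (nbhs_open Om_open Oy) => z; exact: DA_diff.
have H2 := DA_diff (v :: post) Oy; have H3 := DA_diff (u :: post) Oy.
by rewrite !DA_cons in H2 H3; exact: (derive_sym H1 H2 H3).
Qed.

Lemma DA_cons_eq s t u y : Om y -> (forall z, Om z -> DA s z = DA t z) ->
  DA (u :: s) y = DA (u :: t) y.
Proof. by move=> Oy H; rewrite !DA_cons; exact: derive_eq_on. Qed.

(** Adjacent arguments commute by the symmetry of second derivatives, at all points of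
    the open set and not only on M, so that one may differentiate again. *)
Lemma DA_perm s t y : perm_eq s t -> Om y -> DA s y = DA t y.
Proof.
elim: s t y => [|x s IH] t y; first by move=> /perm_size /esym /size0nil ->.
move=> st Oy.
have xt : x \in t by rewrite -(perm_mem st) mem_head.
case/splitPr: xt st => t1 t2 st.
have front : forall y, Om y -> DA (t1 ++ x :: t2) y = DA (x :: t1 ++ t2) y.
  elim: t1 {IH st Oy} => [//|z t1 IH1] w Ow.
  by rewrite (DA_cons_eq _ Ow IH1) DA_swap.
rewrite front //; apply: DA_cons_eq => // z; apply: IH.
rewrite -(perm_cons x); apply: perm_trans st _.
by rewrite -cat1s perm_catCA cat1s.
Qed.

(** Only values on M matter for derivatives along M; a smooth extension makes the
    usual rules of calculus available. *)
Definition smM (f : E -> R) : Prop :=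
  exists F, smooth_on Om F /\ forall y, M y -> f y = F y.

Lemma smM_eq f g : (forall y, M y -> f y = g y) -> smM f -> smM g.
Proof. by move=> fg [F [Fs FE]]; exists F; split => // y My; rewrite -fg // FE. Qed.

Lemma smM_cst c : smM (fun=> c).
Proof. by exists (fun=> c); split => // k; exact: Ck_cst. Qed.

Lemma smMD f g : smM f -> smM g -> smM (fun y => f y + g y).
Proof.
move=> [F [Fs FE]] [G [Gs GE]]; exists (fun y => F y + G y); split => [k|y My].
  exact: CkD.
by rewrite FE // GE.
Qed.

Lemma smMM f g : smM f -> smM g -> smM (fun y => f y * g y).
Proof.
move=> [F [Fs FE]] [G [Gs GE]]; exists (fun y => F y * G y); split => [k|y My].
  exact: CkM.
by rewrite FE // GE.
Qed.

Lemma smM_sum (I : Type) (r : seq I) (P : pred I) (F : I -> E -> R) :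
  (forall i, smM (F i)) -> smM (fun y => \sum_(i <- r | P i) F i y).
Proof.
move=> Fs; elim: r => [|i r IH].
  by apply: smM_eq (smM_cst 0) => y _; rewrite big_nil.
case: (boolP (P i)) => Pi.
  by apply: smM_eq (smMD (Fs i) IH) => y _; rewrite big_cons Pi.
by apply: smM_eq IH => y _; rewrite big_cons (negbTE Pi).
Qed.

Lemma smM_DA Vs : smM (DA Vs).
Proof. by exists (DA Vs); split => //; exact: DA_smooth. Qed.

(** Derivative along M with the velocity X for all curves at once, so that sums and
    products of such derivatives can be formed before the choice made in [tder] is
    known to be determined. *)
Definition tdiff {W : normedModType R} (x X : E) (f : E -> W) (l : W) : Prop :=
  forall c, curve_at M x X c -> is_derive (0 : R) (1 : R) (f \o c) l.

Lemma tderE {W : normedModType R} x X (f : E -> W) l : tangent x X ->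
  tdiff x X f l -> tder x X f = l.
Proof.
move=> [c cX] fl; apply: xget_unique; first exact: fl.
by move=> l' /(_ _ cX) d'; exact: is_derive_unique d' (fl _ cX).
Qed.

Lemma tdiff_eq {W : normedModType R} x X (f g : E -> W) l :
  (forall y, M y -> f y = g y) -> tdiff x X f l -> tdiff x X g l.
Proof.
move=> fg fl c cX; apply: near_eq_is_derive (fl c cX).
have [[e e0 [_ cM]] _ _] := cX.
by apply: filterS (@nbhs0_lt _ _ _ e0) => t te /=; apply: fg; exact: cM.
Qed.

Lemma tder_eq {W : normedModType R} x X (f g : E -> W) :
  (forall y, M y -> f y = g y) -> tder x X f = tder x X g.
Proof.
move=> fg; rewrite /Defs.tder; congr xget; apply/seteqP; split => l /=.
  exact: (tdiff_eq fg).
exact: (tdiff_eq (fun y My => esym (fg y My))).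
Qed.

Lemma tdrE x X (f : E -> R) : tdr x X f = tder x X f.
Proof. by rewrite /tderR sealedE. Qed.

Lemma tdr_eq x X (f g : E -> R) :
  (forall y, M y -> f y = g y) -> tdr x X f = tdr x X g.
Proof. by move=> fg; rewrite !tdrE; exact: tder_eq. Qed.

Lemma smooth_tdiff x X (F : E -> R) : M x -> smooth_on Om F ->
  tdiff x X F ('D_X F x).
Proof.
move=> Mx Fs c [_ c0 dc]; rewrite -c0; apply: is_derive_along => //.
by rewrite c0; apply: smooth_diff => //; exact: M_Om.
Qed.

Lemma smM_tdiff x X f : M x -> tangent x X -> smM f -> tdiff x X f (tdr x X f).
Proof.
move=> Mx tX [F [Fs FE]].
have H : tdiff x X f ('D_X F x).
  by have := tdiff_eq (fun y My => esym (FE y My)) (smooth_tdiff (X := X) Mx Fs).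
by rewrite tdrE (tderE tX H).
Qed.

Lemma tdr_smooth x X (F : E -> R) : M x -> tangent x X -> smooth_on Om F ->
  tdr x X F = 'D_X F x.
Proof. by move=> Mx tX Fs; rewrite tdrE; apply: tderE => //; exact: smooth_tdiff. Qed.

Lemma tdr_DA x X Vs : M x -> tangent x X -> tdr x X (DA Vs) = DA (X :: Vs) x.
Proof. by move=> Mx tX; rewrite DA_cons; apply: tdr_smooth => //; exact: DA_smooth. Qed.

Lemma tdr_cst x X (c : R) : tangent x X -> tdr x X (fun=> c) = 0.
Proof. by move=> tX; rewrite tdrE; apply: tderE => // g _; exact: is_derive_cst. Qed.

Lemma tdrD x X f g : M x -> tangent x X -> smM f -> smM g ->
  tdr x X (fun y => f y + g y) = tdr x X f + tdr x X g.
Proof.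
move=> Mx tX fs gs; rewrite tdrE; apply: tderE => // c cX.
exact: (is_deriveD (smM_tdiff Mx tX fs cX) (smM_tdiff Mx tX gs cX)).
Qed.

Lemma tdrM x X f g : M x -> tangent x X -> smM f -> smM g ->
  tdr x X (fun y => f y * g y) = tdr x X f * g x + f x * tdr x X g.
Proof.
move=> Mx tX fs gs; rewrite tdrE; apply: tderE => // c cX.
have [_ c0 _] := cX.
have := is_deriveM (smM_tdiff Mx tX fs cX) (smM_tdiff Mx tX gs cX).
by rewrite /= c0 /GRing.scale /= addrC [g x * _]mulrC.
Qed.

Lemma tdrZ x X a f : M x -> tangent x X -> smM f ->
  tdr x X (fun y => a * f y) = a * tdr x X f.
Proof.
by move=> Mx tX fs; rewrite (tdrM Mx tX (smM_cst a) fs) tdr_cst // mul0r add0r.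
Qed.

Lemma tdr_sum (I : Type) (r : seq I) (P : pred I) (F : I -> E -> R) x X :
  M x -> tangent x X -> (forall i, smM (F i)) ->
  tdr x X (fun y => \sum_(i <- r | P i) F i y) = \sum_(i <- r | P i) tdr x X (F i).
Proof.
move=> Mx tX Fs; elim: r => [|i r IH].
  rewrite big_nil -[RHS](tdr_cst (x := x) 0 tX); apply: tdr_eq => y _; by rewrite big_nil.
rewrite big_cons -IH; case: (boolP (P i)) => Pi.
  rewrite -tdrD //; last exact: smM_sum.
  by apply: tdr_eq => y _; rewrite big_cons Pi.
by apply: tdr_eq => y _; rewrite big_cons (negbTE Pi).
Qed.

Lemma tdrDX x X Y a f : M x -> tangent x X -> tangent x Y -> tangent x (a *: X + Y) ->
  smM f -> tdr x (a *: X + Y) f = a * tdr x X f + tdr x Y f.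
Proof.
move=> Mx tX tY tXY [F [Fs FE]].
have dF : differentiable F x by apply: smooth_diff Fs _; exact: M_Om.
rewrite !(tdr_eq _ _ FE) (tdr_smooth Mx tXY Fs) (tdr_smooth Mx tX Fs).
by rewrite (tdr_smooth Mx tY Fs) (deriveDdir _ _ dF) (deriveZdir _ _ dF).
Qed.

Lemma tder_vec x X (f : E -> E) : M x -> tangent x X ->
  (forall i, smM (fun y => f y 0 i)) ->
  tder x X f = \row_i tdr x X (fun y => f y 0 i).
Proof.
move=> Mx tX fs; apply: tderE => // c cX.
have d i : is_derive (0 : R) 1 (fun t => f (c t) 0 i) (tdr x X (fun y => f y 0 i)).
  exact: (smM_tdiff Mx tX (fs i) cX).
have D : derivable (f \o c) 0 1.
  by apply/derivable_mxP => i j; rewrite ord1; have [] := d j.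
apply: DeriveDef => //; rewrite derive_mx //; apply/rowP => j; rewrite !mxE.
by have [_] := d j.
Qed.

End OnM.

(** * Multilinear forms *)

Section Multilinear.
Context {R : realType} {N : nat}.
Local Notation E := 'rV[R]_N.

(** Forms take lists of vectors. Their values on lists of other lengths are
    arbitrary. *)
Definition multilin (s : nat) (T : seq E -> R) : Prop :=
  forall pre a u v post, (size pre + (size post).+1)%N = s ->
    T (pre ++ (a *: u + v) :: post) = a * T (pre ++ u :: post) + T (pre ++ v :: post).

Lemma multilin0 s T pre post : multilin s T -> (size pre + (size post).+1)%N = s ->
  T (pre ++ 0 :: post) = 0.
Proof.
move=> H sz; have := H pre (-1) 0 0 post sz.
by rewrite scaler0 addr0 mulN1r addNr.
Qed.

Lemma multilin_sum s T pre post n (a : 'I_n -> R) (F : 'I_n -> E) :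
  multilin s T -> (size pre + (size post).+1)%N = s ->
  T (pre ++ (\sum_i a i *: F i) :: post) = \sum_i a i * T (pre ++ F i :: post).
Proof.
move=> H sz; elim: n a F => [|n IH] a F; first by rewrite !big_ord0 (multilin0 H).
by rewrite !big_ord_recl H // IH.
Qed.

Lemma multilin_basis s T pre v post : multilin s T -> (size pre + (size post).+1)%N = s ->
  T (pre ++ v :: post) = \sum_i v 0 i * T (pre ++ ebase i :: post).
Proof. by move=> H sz; rewrite {1}(row_sum_delta v) (multilin_sum _ _ H). Qed.

Lemma set_nth_cat (s : seq E) h v : (h < size s)%N ->
  set_nth 0 s h v = take h s ++ v :: drop h.+1 s.
Proof. by move=> hs; rewrite set_nthE hs. Qed.

Lemma multilin_set_nth s T pre Vs h v : multilin s T -> (size pre + size Vs)%N = s ->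
  (h < size Vs)%N ->
  T (pre ++ set_nth 0 Vs h v) = \sum_i v 0 i * T (pre ++ set_nth 0 Vs h (ebase i)).
Proof.
move=> H sz hs; rewrite set_nth_cat // catA (multilin_basis _ H).
  by apply: eq_bigr => i _; rewrite set_nth_cat // catA.
rewrite size_cat size_takel ?(ltnW hs) // size_drop -subSn // -addnA subSS.
by rewrite subnKC // ltnW.
Qed.

End Multilinear.

(** * The tangential projection and the third derivative of A *)

Lemma perm_two (T : eqType) (a b : T) : perm_eq [:: a; b] [:: b; a].
Proof. by rewrite (perm_catC [:: a] [:: b]). Qed.

Section OnM.
Context {R : realType} {N : nat} (M Om : set 'rV[R]_N).
Local Notation E := 'rV[R]_N.
Hypothesis tM : tube M Om.
Local Notation DA := (DA M).
Local Notation prj := (prj M).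
Local Notation tder := (tder M).
Local Notation tdr := (tderR M).
Local Notation tangent := (tangent M).
Local Notation smM := (smM M Om).

Let M_Om : M `<=` Om. Proof. by case: tM => -[]. Qed.

Lemma prj_tangent x V : M x -> tangent x (prj x V).
Proof. by case: tM => _ _ [H _] _ _; exact: H. Qed.

Lemma prj_id x V : M x -> tangent x V -> prj x V = V.
Proof. by case: tM => _ _ [_ H] _ _; exact: H. Qed.

Lemma prjK x V : M x -> prj x (prj x V) = prj x V.
Proof. by move=> Mx; rewrite prj_id //; exact: prj_tangent. Qed.

Lemma prj_DA x V W : M x -> dotv (prj x V) W = DA [:: V; W] x.
Proof. by case: tM => _ H _ _ _; exact: H. Qed.

Lemma prj_coord x V i : M x -> prj x V 0 i = DA [:: V; ebase i] x.
Proof. by move=> Mx; rewrite -prj_DA // dotv_basis. Qed.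

Lemma prj_lin x a u v : M x -> prj x (a *: u + v) = a *: prj x u + prj x v.
Proof.
move=> Mx; apply/rowP => i; rewrite !mxE !prj_coord //.
exact: (DA_lin tM [::] a u v [:: ebase i] (M_Om Mx)).
Qed.

Lemma prj_sym x V W : M x -> dotv (prj x V) W = dotv V (prj x W).
Proof.
move=> Mx; rewrite [RHS]dotvC (prj_DA V W Mx) (prj_DA W V Mx).
exact: (DA_perm tM (perm_two V W) (M_Om Mx)).
Qed.

Lemma tangent_lin x a u v : M x -> tangent x u -> tangent x v -> tangent x (a *: u + v).
Proof.
move=> Mx tu tv; rewrite -(prj_id Mx tu) -(prj_id Mx tv) -prj_lin //.
exact: prj_tangent.
Qed.

Lemma smM_prj V i : smM (fun y => prj y V 0 i).
Proof. by apply: smM_eq (smM_DA tM [:: V; ebase i]) => y My; rewrite prj_coord. Qed.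

Lemma DA_multilin s y : Om y -> multilin s (fun Vs => DA Vs y).
Proof. by move=> Oy pre a u v post _; exact: (DA_lin tM). Qed.

Lemma tder_text x X V : M x -> tangent x X ->
  tder x X (text M V) = \row_i DA [:: X; V; ebase i] x.
Proof.
have tE y i : text M V y 0 i = prj y V 0 i by rewrite prjE.
move=> Mx tX; rewrite (tder_vec tM) //; last first.
  by move=> i; apply: smM_eq (smM_prj V i) => y _; rewrite tE.
apply/rowP => i; rewrite !mxE -(tdr_DA tM _ Mx tX); apply: tdr_eq => y My.
by rewrite tE prj_coord.
Qed.

Lemma dotv_row (a : 'I_N -> R) W : dotv (\row_i a i) W = \sum_i a i * W 0 i.
Proof. by apply: eq_bigr => i _; rewrite mxE. Qed.

Lemma DA_basis x pre V post : M x ->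
  DA (pre ++ V :: post) x = \sum_i V 0 i * DA (pre ++ ebase i :: post) x.
Proof.
move=> Mx.
have H := DA_multilin (s := (size pre + (size post).+1)%N) (M_Om Mx).
exact: (multilin_basis V H erefl).
Qed.

Lemma dotv_tder_text x X V W : M x -> tangent x X ->
  dotv (tder x X (text M V)) W = DA [:: X; V; W] x.
Proof.
move=> Mx tX; rewrite tder_text // dotv_row.
rewrite (DA_basis [:: X; V] W [::] Mx).
by apply: eq_bigr => i _; rewrite mulrC.
Qed.

(** The derivative of P P = P along M: D_X P = (D_X P) P + P (D_X P). *)
Lemma DA_projection x X Z W : M x -> tangent x X ->
  DA [:: X; Z; prj x W] x + DA [:: X; prj x Z; W] x = DA [:: X; Z; W] x.
Proof.
move=> Mx tX.
have E1 y : M y -> DA [:: Z; W] y = \sum_i DA [:: Z; ebase i] y * DA [:: ebase i; W] y.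
  move=> My; rewrite -prj_DA // -(prjK _ My) prj_DA //.
  rewrite (DA_basis [::] _ _ My); apply: eq_bigr => i _.
  by rewrite prj_coord.
rewrite -(tdr_DA tM [:: Z; W] Mx tX) (tdr_eq x X E1) (tdr_sum tM _ _ Mx tX); last first.
  by move=> i; apply: smMM; [case: tM => -[] | exact: smM_DA|exact: smM_DA].
transitivity (\sum_i (DA [:: X; Z; ebase i] x * DA [:: ebase i; W] x +
   DA [:: Z; ebase i] x * DA [:: X; ebase i; W] x)); last first.
  apply: eq_bigr => i _.
  rewrite (tdrM tM Mx tX (smM_DA tM [:: Z; ebase i]) (smM_DA tM [:: ebase i; W])).
  by rewrite !(tdr_DA tM _ Mx tX).
rewrite big_split /=; congr (_ + _).
  rewrite (DA_basis [:: X; Z] (prj x W) [::] Mx); apply: eq_bigr => i _.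
  rewrite mulrC (prj_coord W i Mx); congr (_ * _).
  exact: (DA_perm tM (perm_two _ _) (M_Om Mx)).
rewrite (DA_basis [:: X] (prj x Z) [:: W] Mx); apply: eq_bigr => i _.
by rewrite (prj_coord Z i Mx).
Qed.

(** P (D_X P) P = 0, from the previous identity multiplied by P on both sides. *)
Lemma DA_tangent3 x X Z W : M x -> tangent x X -> tangent x Z -> tangent x W ->
  DA [:: X; Z; W] x = 0.
Proof.
move=> Mx tX tZ tW; have := DA_projection Z W Mx tX.
by rewrite !prj_id // => /eqP; rewrite -subr_eq0 addrK => /eqP.
Qed.

End OnM.

(** * The second fundamental form and its covariant derivatives *)

Section Sealed.
Context {R : realType} {N : nat}.

Definition bform : set 'rV[R]_N -> 'I_N -> tensor := sealed (@Bform R N).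

Definition cov : set 'rV[R]_N -> tensor -> tensor := sealed (@covd R N).

Lemma bformE : bform = @Bform R N. Proof. exact: sealedE. Qed.

Lemma covE : cov = @covd R N. Proof. exact: sealedE. Qed.

Definition nb (M : set 'rV[R]_N) (l : nat) (k : 'I_N) : tensor :=
  iter l (cov M) (bform M k).

Lemma nbE M l k : nb M l k = nablaB M l k.
Proof. by rewrite /nb /nablaB covE bformE. Qed.

End Sealed.

Section OnM.
Context {R : realType} {N : nat} (M Om : set 'rV[R]_N).
Local Notation E := 'rV[R]_N.
Hypothesis tM : tube M Om.
Local Notation DA := (DA M).
Local Notation prj := (prj M).
Local Notation tdr := (tderR M).
Local Notation tangent := (tangent M).
Local Notation smM := (smM M Om).
Local Notation vals gs x := [seq g x | g : E -> E <- gs].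

Let M_Om : M `<=` Om. Proof. by case: tM => -[]. Qed.

Definition vsm (g : E -> E) : Prop := forall i, smM (fun y => g y 0 i).

Definition dvec (x X : E) (g : E -> E) : E := \row_i tdr x X (fun y => g y 0 i).

Lemma vsm_cst V : vsm (fun=> V).
Proof. by move=> i; exact: smM_cst. Qed.

Lemma vsm_prj V : vsm (fun y => prj y V).
Proof. by move=> i; exact: (smM_prj tM). Qed.

(** The Leibniz rule for T y (g_1 y, g_2 y, ...): freeze the fields at x and
    differentiate T, then differentiate one field at a time. The prefix carries the
    slots that the induction has replaced by basis vectors. *)
Lemma tdr_multilin s (T : E -> seq E -> R) gs pre x X :
  M x -> tangent x X ->
  (forall y, M y -> multilin s (T y)) ->
  (forall Vs, size Vs = s -> smM (fun y => T y Vs)) ->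
  (forall h, vsm (nth (fun=> 0) gs h)) ->
  (size pre + size gs)%N = s ->
  smM (fun y => T y (pre ++ vals gs y)) /\
  tdr x X (fun y => T y (pre ++ vals gs y)) =
    tdr x X (fun y => T y (pre ++ vals gs x)) +
    \sum_(h < size gs) T x (pre ++
       set_nth 0 (vals gs x) h (dvec x X (nth (fun=> 0) gs h))).
Proof.
move=> Mx tX Tl Ts; elim: gs pre => [|g gs IH] pre gsm sz.
  by rewrite big_ord0 addr0; split => //; apply: (Ts (pre ++ [::])); rewrite -sz cats0 addn0.
have gsm0 : vsm g := gsm 0%N.
have gsmS h : vsm (nth (fun=> 0) gs h) := gsm h.+1.
have szr a : (size (rcons pre a) + size gs)%N = s by rewrite size_rcons addSnnS.
have szm y : (size pre + (size (vals gs y)).+1)%N = s by rewrite size_map.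
have E1 y : M y -> T y (pre ++ vals (g :: gs) y) =
    \sum_i g y 0 i * T y (rcons pre (ebase i) ++ vals gs y).
  move=> My; rewrite /= (multilin_basis _ (Tl y My)) //.
  by apply: eq_bigr => i _; rewrite cat_rcons.
have IHs i := (IH (rcons pre (ebase i)) gsmS (szr _)).1.
have IHd i := (IH (rcons pre (ebase i)) gsmS (szr _)).2.
split.
  apply: (smM_eq (f := fun y => \sum_i g y 0 i * T y (rcons pre (ebase i) ++ vals gs y))).
    by move=> y My; rewrite E1.
  by apply: (smM_sum tM) => i; apply: (smMM tM).
rewrite (tdr_eq x X E1) (tdr_sum tM _ _ Mx tX); last by move=> i; apply: (smMM tM).
transitivity (\sum_i (tdr x X (fun y => g y 0 i) * T x (rcons pre (ebase i) ++ vals gs x)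
   + g x 0 i * (tdr x X (fun y => T y (rcons pre (ebase i) ++ vals gs x))
    + \sum_(h < size gs) T x (rcons pre (ebase i) ++
       set_nth 0 (vals gs x) h (dvec x X (nth (fun=> 0) gs h)))))).
  by apply: eq_bigr => i _; rewrite (tdrM tM Mx tX (gsm0 i) (IHs i)) IHd.
rewrite big_split /= addrC; under eq_bigr do rewrite mulrDr.
rewrite big_split /= -addrA; congr (_ + _).
  have E2 y : M y -> T y (pre ++ g x :: vals gs x) =
      \sum_i g x 0 i * T y (rcons pre (ebase i) ++ vals gs x).
    move=> My; rewrite /= (multilin_basis _ (Tl y My)) //.
    by apply: eq_bigr => i _; rewrite cat_rcons.
  have s3 i : smM (fun y => T y (rcons pre (ebase i) ++ vals gs x)).
    by apply: Ts; rewrite size_cat size_map.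
  rewrite (tdr_eq x X E2) (tdr_sum tM _ _ Mx tX).
    by apply: eq_bigr => i _; rewrite (tdrZ tM _ Mx tX (s3 i)).
  by move=> i; apply: (smMM tM); [exact: smM_cst|exact: s3].
rewrite big_ord_recl /= addrC; congr (_ + _).
  rewrite (multilin_basis _ (Tl x Mx)) //.
  by apply: eq_bigr => i _; rewrite mxE cat_rcons.
under eq_bigr do rewrite mulr_sumr.
rewrite exchange_big /=; apply: eq_bigr => h _.
rewrite (multilin_basis (s := s) _ (Tl x Mx)) //.
  by apply: eq_bigr => i _; rewrite cat_rcons.
rewrite size_set_nth size_map; have /maxn_idPr -> : (h.+1 <= size gs)%N by [].
exact: sz.
Qed.

Lemma dvec_prj x X V : M x -> tangent x X ->
  dvec x X (fun y => prj y V) = \row_i DA [:: X; V; ebase i] x.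
Proof.
move=> Mx tX; apply/rowP => i; rewrite !mxE -(tdr_DA tM _ Mx tX).
by apply: tdr_eq => y My; rewrite (prj_coord tM).
Qed.

Lemma tder_text_dvec x X V : M x -> tangent x X ->
  tder M x X (text M V) = dvec x X (fun y => prj y V).
Proof. by move=> Mx tX; rewrite dvec_prj // (tder_text tM). Qed.

(** B(V, W) is the normal part of the derivative of y |-> P(y) P(x) W along P V, and this
    derivative is D^3 A (P V, P W, .). Its tangential part is zero by
    [DA_tangent3], so the normal projection can be dropped. *)
Lemma bform_DA k x V W : M x ->
  bform M k x [:: V; W] = DA [:: prj x V; prj x W; ebase k] x.
Proof.
move=> Mx; rewrite bformE /Bform /= /sff /nproj -!prjE.
have tV := prj_tangent tM V Mx; have tW := prj_tangent tM W Mx.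
set Z := tder _ _ _ _.
have DZ U : dotv Z U = DA [:: prj x V; prj x W; U] x by exact: (dotv_tder_text tM).
have tk := prj_tangent tM (ebase k) Mx.
by rewrite dotvBl DZ (prj_sym tM) // DZ (DA_tangent3 tM Mx tV tW tk) subr0.
Qed.

(** The vector with <shapev x X V, W> = <B(X, W), V>: the shape operator of V
    applied to X. *)
Definition shapev (x X V : E) : E := \row_q \sum_a V 0 a * bform M a x [:: X; ebase q].

(** The vector B(X, V). *)
Definition sffv (x X V : E) : E := \row_i bform M i x [:: X; V].

Lemma shapev_coord x X V q : M x -> shapev x X V 0 q = DA [:: prj x X; prj x (ebase q); V] x.
Proof.
move=> Mx; rewrite mxE (DA_basis tM [:: prj x X; prj x (ebase q)] V [::] Mx).
by apply: eq_bigr => a _; rewrite bform_DA.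
Qed.

Lemma DA3_swap x X V W : M x -> DA [:: X; V; W] x = DA [:: X; W; V] x.
Proof.
move=> Mx; apply: (DA_perm tM); last exact: M_Om.
by rewrite perm_cons; exact: perm_two.
Qed.

Lemma dotv_dvec_prj x X V U : M x -> tangent x X ->
  dotv (dvec x X (fun y => prj y V)) U = DA [:: X; V; U] x.
Proof. by move=> Mx tX; rewrite -tder_text_dvec // (dotv_tder_text tM). Qed.

(** The tangential part of the derivative of the field y |-> P(y) V depends only on the
    normal part of V, through the shape operator. *)
Lemma prj_dvec x X V : M x -> tangent x X ->
  prj x (dvec x X (fun y => prj y V)) = shapev x X V.
Proof.
move=> Mx tX; apply/rowP => q; rewrite shapev_coord // -dotv_basis (prj_sym tM) //.
by rewrite dotv_dvec_prj // DA3_swap // (prj_id tM Mx tX).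
Qed.

Lemma shapev_eq0 x X V : M x -> tangent x V -> shapev x X V = 0.
Proof.
move=> Mx tV; apply/rowP => q; rewrite shapev_coord // mxE.
by apply: (DA_tangent3 tM) => //; exact: (prj_tangent tM).
Qed.

(** Gauss: by [DA_tangent3] the derivative of a field P V with V tangent at x is
    normal. *)
Lemma dvec_tangent x X V : M x -> tangent x X -> tangent x V ->
  dvec x X (fun y => prj y V) = sffv x X V.
Proof.
move=> Mx tX tV; apply/rowP => i.
by rewrite dvec_prj // !mxE bform_DA // !(prj_id tM).
Qed.

(** Weingarten: for V normal at x, (D_X P) V = P (D_X P) V is tangent. *)
Lemma dvec_normal x X V : M x -> tangent x X -> prj x V = 0 ->
  dvec x X (fun y => prj y V) = shapev x X V.
Proof.
move=> Mx tX nV; apply/rowP => i; rewrite dvec_prj // shapev_coord // mxE.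
rewrite -(DA_projection tM V (ebase i) Mx tX) nV.
rewrite (multilin0 (pre := [:: X]) (post := [:: ebase i]) (DA_multilin tM (s := 3) (M_Om Mx))) //.
by rewrite addr0 DA3_swap // (prj_id tM Mx tX).
Qed.

Lemma dvec_nprj x X V : M x -> tangent x X ->
  dvec x X (fun y => V - prj y V) = - dvec x X (fun y => prj y V).
Proof.
move=> Mx tX; apply/rowP => i; rewrite !mxE.
have H y : M y -> (V - prj y V) 0 i = V 0 i + (-1) * prj y V 0 i.
  by move=> _; rewrite !mxE mulN1r.
rewrite (tdr_eq x X H).
have s1 := vsm_prj V i.
rewrite (tdrD tM Mx tX (smM_cst _ _ _)) ?(tdr_cst _ tX) ?add0r.
  by rewrite (tdrZ tM _ Mx tX s1) mulN1r.
by apply: (smMM tM); [exact: smM_cst|].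
Qed.

Lemma vsm_nprj V : vsm (fun y => V - prj y V).
Proof.
move=> i; apply: (smM_eq (f := fun y => V 0 i + (-1) * prj y V 0 i)).
  by move=> y _; rewrite !mxE mulN1r.
apply: (smMD tM); first exact: smM_cst.
by apply: (smMM tM); [exact: smM_cst|exact: vsm_prj].
Qed.

(** A smooth field of covariant tensors on M, extended to ambient vectors through
    their projections. The last clause is regularity along M for frozen
    arguments. *)
Definition smooth_form (s : nat) (T : tensor (R := R) (N := N)) : Prop :=
  [/\ forall x, M x -> multilin s (T x),
      forall x Vs, M x -> size Vs = s -> T x Vs = T x [seq prj x V | V <- Vs]
    & forall Vs, size Vs = s -> smM (fun y => T y Vs)].

Lemma nabla_text x X V : M x -> tangent x X -> nabla M x X (text M V) = shapev x X V.
Proof. by move=> Mx tX; rewrite /nabla -prjE tder_text_dvec // prj_dvec. Qed.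

(** The fields y |-> P(y) V with V tangent at x have zero covariant derivative at x, so the
    correction terms of the Leibniz rule for nabla T vanish. *)
Lemma cov_tdr s T x V0 Vs : smooth_form s T -> M x -> size Vs = s ->
  cov M T x (V0 :: Vs) = tdr x (prj x V0) (fun y => T y [seq prj x V | V <- Vs]).
Proof.
move=> [Tl Tp Ts] Mx sz; rewrite covE /covd /= -prjE.
have tX := prj_tangent tM V0 Mx.
rewrite big1 ?subr0.
  rewrite -tdrE; apply: tdr_eq => y My; rewrite [RHS]Tp ?size_map //.
  by congr (T y _); rewrite /text -prjE.
move=> [h hs] _ /=; rewrite size_map in hs.
have tn : tangent x (nth 0 [seq prj x V | V <- Vs] h).
  by rewrite (nth_map 0) //; exact: (prj_tangent tM).
rewrite nabla_text // shapev_eq0 // set_nth_cat ?size_map //.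
apply: (multilin0 (Tl x Mx)).
rewrite size_takel ?size_map ?(ltnW hs) // size_drop size_map -subSn //.
by rewrite subSS subnKC // ltnW.
Qed.

Lemma map_prj_set_nth x Vs h V : (h < size Vs)%N ->
  [seq prj x V | V <- set_nth 0 Vs h V] = set_nth 0 [seq prj x V | V <- Vs] h (prj x V).
Proof.
by move=> hs; rewrite !set_nth_cat ?size_map // map_cat /= map_take map_drop.
Qed.

(** With constant ambient arguments V, the form sees the fields P V, whose derivative
    has the shape operator as its tangential part: this is the correction. *)
Lemma tdr_smooth_form s T x X Vs : smooth_form s T -> M x -> tangent x X -> size Vs = s ->
  tdr x X (fun y => T y Vs) =
    cov M T x (X :: Vs) + \sum_(h < s) T x (set_nth 0 Vs h (shapev x X (nth 0 Vs h))).
Proof.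
move=> gT Mx tX sz; have [Tl Tp Ts] := gT.
pose gs := [seq (fun y : E => prj y V) | V <- Vs].
have E1 y : M y -> T y Vs = T y ([::] ++ vals gs y).
  by move=> My; rewrite Tp //= /gs -map_comp.
have gsm h : vsm (nth (fun=> 0) gs h).
  case: (ltnP h (size Vs)) => hs; last by rewrite nth_default ?size_map //; exact: vsm_cst.
  by rewrite (nth_map 0) //; exact: vsm_prj.
have szg : (size ([::] : seq E) + size gs)%N = s by rewrite size_map.
have [_ D] := tdr_multilin Mx tX Tl Ts gsm szg.
rewrite (tdr_eq x X E1) D (cov_tdr _ gT) // (prj_id tM Mx tX) /=.
have mE : vals gs x = [seq prj x V | V <- Vs].
  by rewrite /gs -map_comp.
rewrite mE; congr (_ + _).
rewrite {1}/gs size_map sz; apply: eq_bigr => -[h hs] _ /=.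
rewrite -sz in hs.
have sz1 U : size (set_nth 0 [seq prj x V | V <- Vs] h U) = s.
  by rewrite size_set_nth size_map; move/maxn_idPr: hs => ->.
rewrite Tp // map_prj_set_nth ?size_map //.
rewrite [in RHS]Tp //; last by rewrite size_set_nth; move/maxn_idPr: hs => ->.
rewrite map_prj_set_nth //; congr (T x (set_nth 0 _ h _)).
  by rewrite -map_comp; apply: eq_map => V /=; rewrite (prjK tM).
by rewrite (nth_map 0) // prj_dvec // -prj_dvec // (prjK tM).
Qed.

End OnM.

Lemma size_two (T : Type) (s : seq T) : size s = 2%N -> exists u v, s = [:: u; v].
Proof. by case: s => [|u [|v []]] // _; exists u, v. Qed.

Section OnM.
Context {R : realType} {N : nat} (M Om : set 'rV[R]_N).
Local Notation E := 'rV[R]_N.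
Hypothesis tM : tube M Om.
Local Notation DA := (DA M).
Local Notation prj := (prj M).
Local Notation tdr := (tderR M).
Local Notation tangent := (tangent M).
Local Notation smM := (smM M Om).
Local Notation smooth_form := (smooth_form M Om).

Let M_Om : M `<=` Om. Proof. by case: tM => -[]. Qed.

Lemma smooth_form_bform k : smooth_form 2 (bform M k).
Proof.
split.
- move=> x Mx [|u [|? ?]] a v w [|z [|? ?]]; rewrite ?addSn ?addnS //= => _;
    rewrite !(bform_DA tM) // (prj_lin tM) //.
    exact: (DA_lin tM [::] _ _ _ [:: prj x z; ebase k] (M_Om Mx)).
  exact: (DA_lin tM [:: prj x u] _ _ _ [:: ebase k] (M_Om Mx)).
- move=> x Vs Mx /size_two [u [v ->]] /=.
  by rewrite !(bform_DA tM _ _ _ Mx) !(prjK tM _ Mx).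
- move=> Vs /size_two [u [v ->]].
  apply: (smM_eq (f := fun y => \sum_a prj y u 0 a * \sum_b prj y v 0 b * DA [:: ebase a; ebase b; ebase k] y)).
    move=> y My; rewrite (bform_DA tM) // (DA_basis tM [::] _ _ My).
    apply: eq_bigr => a _; congr (_ * _).
    by rewrite /= (DA_basis tM [:: ebase a] _ _ My).
  apply: (smM_sum tM) => a; apply: (smMM tM); first exact: (smM_prj tM).
  apply: (smM_sum tM) => b; apply: (smMM tM); first exact: (smM_prj tM).
  exact: (smM_DA tM).
Qed.

Lemma bform_sym k x V W : M x -> bform M k x [:: V; W] = bform M k x [:: W; V].
Proof.
move=> Mx; rewrite !(bform_DA tM _ _ _ Mx); apply: (DA_perm tM); last exact: M_Om.
exact: (perm_cat (perm_two (prj x V) (prj x W)) (perm_refl [:: ebase k])).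
Qed.

Lemma bform_prj1 k x V W : M x -> bform M k x [:: prj x V; W] = bform M k x [:: V; W].
Proof. by move=> Mx; rewrite !(bform_DA tM _ _ _ Mx) (prjK tM). Qed.

Lemma bform_prj2 k x V W : M x -> bform M k x [:: V; prj x W] = bform M k x [:: V; W].
Proof. by move=> Mx; rewrite !(bform_DA tM _ _ _ Mx) (prjK tM). Qed.

Lemma shapev_prj x X V : M x -> shapev M x (prj x X) V = shapev M x X V.
Proof.
move=> Mx; apply/rowP => i; rewrite /shape !mxE; apply: eq_bigr => a _.
by rewrite (bform_prj1 a X (ebase i) Mx).
Qed.

Lemma smM_shapev V0 V q : smM (fun y => shapev M y V0 V 0 q).
Proof.
apply: (smM_eq (f := fun y => \sum_a V 0 a * bform M a y [:: V0; ebase q])).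
  by move=> y _; rewrite mxE.
apply: (smM_sum tM) => a; apply: (smMM tM); first exact: smM_cst.
by have [_ _] := smooth_form_bform a; apply.
Qed.

Lemma smM_tdr V0 f : smM f -> smM (fun y => tdr y (prj y V0) f).
Proof.
move=> [F [Fs FE]].
apply: (smM_eq (f := fun y => \sum_i prj y V0 0 i * 'D_(ebase i) F y)).
  move=> y My; have tX := prj_tangent tM V0 My.
  rewrite (tdr_eq y (prj y V0) FE) (tdr_smooth tM My tX Fs).
  rewrite [RHS]derive_basis //; exact: ((Fs 1%N).1 _ (M_Om My)).
apply: (smM_sum tM) => i; apply: (smMM tM); first exact: (smM_prj tM).
by exists ('D_(ebase i) F); split => //; exact: smooth_derive.
Qed.

(** Regularity is read off from the previous identity, which expresses nabla T by
    a derivative of T at constant arguments and values of T. *)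
Lemma smooth_form_cov s T : smooth_form s T -> smooth_form s.+1 (cov M T).
Proof.
move=> gT; have [Tl Tp Ts] := gT.
have cE x V0 Vs : M x -> size Vs = s ->
    cov M T x (V0 :: Vs) = tdr x (prj x V0) (fun y => T y [seq prj x V | V <- Vs]).
  by move=> Mx sz; exact: (cov_tdr tM V0 gT Mx sz).
have sm x Vs : size Vs = s -> smM (fun y => T y [seq prj x V | V <- Vs]).
  by move=> sz; apply: Ts; rewrite size_map.
have cP x Vs : M x -> size Vs = s.+1 -> cov M T x Vs = cov M T x [seq prj x V | V <- Vs].
  case: Vs => // V0 Vs Mx [sz]; rewrite /= !cE ?size_map // (prjK tM) //.
  by congr (tdr _ _ _); apply: funext => y; rewrite -map_comp; congr (T y _);
    apply: eq_map => V /=; rewrite (prjK tM).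
split=> //.
- move=> x Mx [|V0 pre] a u v post /=.
    rewrite add0n => -[sz]; have tu := prj_tangent tM u Mx; have tv := prj_tangent tM v Mx.
    rewrite !cE // (prj_lin tM) // (tdrDX tM Mx tu tv) //; last exact: sm.
    exact: (tangent_lin tM).
  rewrite addSn => -[sz].
  rewrite !cE //; try by rewrite size_cat.
  have tX := prj_tangent tM V0 Mx.
  pose f z y := T y [seq prj x V | V <- pre ++ z :: post].
  have fs z : smM (f z) by apply: sm; rewrite size_cat.
  have E y : M y -> f (a *: u + v) y = a * f u y + f v y.
    by move=> My; rewrite /f !map_cat /= (prj_lin tM) // Tl // !size_map.
  rewrite (tdr_eq x (prj x V0) E) (tdrD tM Mx tX) ?(tdrZ tM _ Mx tX) //.
  by apply: (smMM tM) => //; exact: smM_cst.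
- move=> [//|V0 Vs] [sz].
  apply: (smM_eq (f := fun y => tdr y (prj y V0) (fun z => T z Vs) +
     (-1) * \sum_(h < s) \sum_i shapev M y V0 (nth 0 Vs h) 0 i * T y (set_nth 0 Vs h (ebase i)))).
    move=> y My; have tX := prj_tangent tM V0 My.
    rewrite (tdr_smooth_form tM gT My tX sz).
    have -> : cov M T y (prj y V0 :: Vs) = cov M T y (V0 :: Vs).
      by rewrite !cE // (prjK tM).
    rewrite -addrA -[RHS]addr0; congr (_ + _).
    apply/eqP; rewrite mulN1r subr_eq0; apply/eqP; apply: eq_bigr => -[h hs] _ /=.
    have hs' : (h < size Vs)%N by rewrite sz.
    have H := multilin_set_nth (pre := [::]) (shapev M y (prj y V0) (nth 0 Vs h)) (Tl y My) sz hs'.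
    by rewrite /= in H; rewrite H (shapev_prj V0 (nth 0 Vs h) My).
  apply: (smMD tM); first by apply: smM_tdr; exact: Ts.
  apply: (smMM tM); first exact: smM_cst.
  apply: (smM_sum tM) => -[h hs]; apply: (smM_sum tM) => i; apply: (smMM tM).
    exact: smM_shapev.
  apply: Ts; rewrite size_set_nth sz; exact/maxn_idPr.
Qed.

Lemma smooth_form_nb l k : smooth_form l.+2 (nb M l k).
Proof. by elim: l => [|l IH]; [exact: smooth_form_bform|exact: smooth_form_cov]. Qed.

(** nabla^l B is a vector valued form; its components are contracted with u, so that
    the upper index is one more slot for vectors. *)
Definition nbv (l : nat) (x u : E) (Vs : seq E) : R := \sum_k u 0 k * nb M l k x Vs.

Lemma nbv_ebase l x j Vs : nbv l x (ebase j) Vs = nb M l j x Vs.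
Proof.
rewrite /nbv (bigD1 j) //= big1 ?addr0; first by rewrite mxE !eqxx mul1r.
by move=> k kj; rewrite mxE (negbTE kj) andbF mul0r.
Qed.

Lemma nbv_linu l x a u v Vs : nbv l x (a *: u + v) Vs = a * nbv l x u Vs + nbv l x v Vs.
Proof.
rewrite /nbv mulr_sumr -big_split /=; apply: eq_bigr => k _.
by rewrite !mxE mulrDl mulrA.
Qed.

Lemma nbv_multilin l x u : M x -> multilin l.+2 (nbv l x u).
Proof.
move=> Mx pre a v w post sz; rewrite /nbv mulr_sumr -big_split /=; apply: eq_bigr => k _.
by have [Tl _ _] := smooth_form_nb l k; rewrite (Tl x Mx) // mulrDr mulrCA.
Qed.

Lemma smM_nbv l u Vs : size Vs = l.+2 -> smM (fun y => nbv l y u Vs).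
Proof.
move=> sz; apply: (smM_sum tM) => k; apply: (smMM tM); first exact: smM_cst.
by have [_ _ Ts] := smooth_form_nb l k; exact: Ts.
Qed.

Lemma shapev_nbv x X V q : shapev M x X V 0 q = nbv 0 x V [:: X; ebase q].
Proof. by rewrite mxE. Qed.

(** The upper index is contracted with a constant vector and needs no correction;
    each lower slot is contracted with a factor B. *)
Lemma tdr_nbv l x X u Vs : M x -> tangent x X -> size Vs = l.+2 ->
  tdr x X (fun y => nbv l y u Vs) = nbv l.+1 x u (X :: Vs) +
    \sum_(h < l.+2) \sum_q nbv 0 x (nth 0 Vs h) [:: X; ebase q] * nbv l x u (set_nth 0 Vs h (ebase q)).
Proof.
move=> Mx tX sz.
have s1 k : smM (fun y => nb M l k y Vs) by have [_ _ Ts] := smooth_form_nb l k; exact: Ts.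
rewrite (tdr_sum tM _ _ Mx tX); last by move=> k; apply: (smMM tM); [exact: smM_cst|exact: s1].
transitivity (\sum_k (u 0 k * nb M l.+1 k x (X :: Vs) +
   u 0 k * \sum_(h < l.+2) nb M l k x (set_nth 0 Vs h (shapev M x X (nth 0 Vs h))))).
  apply: eq_bigr => k _; rewrite (tdrZ tM _ Mx tX (s1 k)) -mulrDr.
  by rewrite (tdr_smooth_form tM (smooth_form_nb l k) Mx tX sz).
rewrite big_split /=; congr (_ + _).
under eq_bigr do rewrite mulr_sumr; rewrite exchange_big /=; apply: eq_bigr => -[h hs] _ /=.
have := multilin_set_nth (pre := [::]) (shapev M x X (nth 0 Vs h)) (nbv_multilin (l := l) u Mx) sz.
rewrite sz => /(_ h hs) /= H; rewrite -/(nbv l x u _) H.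
by apply: eq_bigr => q _; rewrite shapev_nbv.
Qed.

End OnM.

(** * Formal polynomial tensors *)

Ltac count_lia :=
  repeat match goal with |- context [count ?a ?s] => move: (count a s) => ? end;
  repeat match goal with |- context [nat_of_bool ?b] => move: (nat_of_bool b) => ? end;
  clear; lia.

Section Formal.

Definition ren (g : nat -> nat) (b : Defs.factor) : Defs.factor :=
  Factor (ford b) (g (fup b)) (map g (flow b)).

Definition wf_fac (b : Defs.factor) : bool := size (flow b) == (ford b).+2.

Definition names (fs : seq Defs.factor) : seq nat := flatten [seq findices b | b <- fs].

(** The products that arise from a product of factors when one order is raised; nX
    is the name of the new first slot and g makes room for it. *)
Fixpoint cov_prods (g : nat -> nat) (nX : nat) (fs : seq Defs.factor) : seq (seq Defs.factor) :=
  if fs is b :: fs' then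
    (Factor (ford b).+1 (g (fup b)) (nX :: map g (flow b)) :: map (ren g) fs')
      :: map (cons (ren g b)) (cov_prods g nX fs')
  else [::].

(** The products that arise when a lower slot h of a factor, named i, is renamed to
    the new repeated index nq and the product is multiplied by B^i with slots nX
    and nq. *)
Fixpoint slot_prods (g : nat -> nat) (nX nq : nat) (fs : seq Defs.factor) : seq (seq Defs.factor) :=
  if fs is b :: fs' then
    [seq [:: Factor (ford b) (g (fup b)) (set_nth 0%N (map g (flow b)) h nq),
             Factor 0 (g (nth 0%N (flow b) h)) [:: nX; nq] & map (ren g) fs']
       | h <- iota 0 (size (flow b))]
    ++ map (cons (ren g b)) (slot_prods g nX nq fs')
  else [::].

(** The new free index is inserted at position p, which [bump p] leaves vacant. *)
Definition formal_cov (p : nat) (P : tpoly) : tpoly :=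
  flatten [seq [seq Monomial (mcoef a) (mdum a) c | c <- cov_prods (bump p) p (mfac a)] | a <- P].

(** With f free indices before, there are f + 1 after the insertion, so that the new
    repeated index gets the name f + 1 and the old ones are shifted past it. *)
Definition slot_corr (f p : nat) (P : tpoly) : tpoly :=
  flatten [seq [seq Monomial (mcoef a) (mdum a).+1 c
                 | c <- slot_prods (fun i => bump f.+1 (bump p i)) p f.+1 (mfac a)] | a <- P].

(** Free index i < f becomes the name sg_i; repeated ones make room for one more
    free and one more repeated index. *)
Definition subst_name (f : nat) (sg : seq nat) (i : nat) : nat :=
  if (i < f)%N then nth 0%N sg i else i.+2.

(** The product of e B^u_{v w} with P in which the free indices are renamed by sg. The
    result has f + 1 free indices, and f + 1 is a repeated one. *)
Definition mulB (e : int) (f u v w : nat) (sg : seq nat) (P : tpoly) : tpoly :=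
  [seq Monomial (e * mcoef a) (mdum a).+1
     (Factor 0 u [:: v; w] :: map (ren (subst_name f sg)) (mfac a)) | a <- P].

Lemma map_set_nth (T U : Type) (g : T -> U) (x : T) (y : U) s h z : (h < size s)%N ->
  map g (set_nth x s h z) = set_nth y (map g s) h (g z).
Proof.
by move=> hs; rewrite !set_nthE size_map hs map_cat /= map_take map_drop.
Qed.

Lemma perm_set_nth (s : seq nat) h z : (h < size s)%N ->
  perm_eq (nth 0%N s h :: set_nth 0%N s h z) (z :: s).
Proof.
move=> hs; apply/permP => a; have := congr1 (count a) (cat_take_drop h s).
by rewrite set_nthE hs (drop_nth 0%N hs) /= !count_cat /=; count_lia.
Qed.

Lemma perm_del_nth (s : seq nat) h : (h < size s)%N ->
  perm_eq (nth 0%N s h :: del_nth h s) s.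
Proof.
move=> hs; apply/permP => a; have := congr1 (count a) (cat_take_drop h s).
by rewrite /del_nth (drop_nth 0%N hs) /= !count_cat /=; count_lia.
Qed.

Lemma names_ren g fs : names (map (ren g) fs) = map g (names fs).
Proof. by elim: fs => //= b fs IH; rewrite /names /= -/(names _) IH map_cat. Qed.

Lemma names_cons b fs : names (b :: fs) = findices b ++ names fs.
Proof. by []. Qed.

Lemma findices_ren g b : findices (ren g b) = map g (findices b).
Proof. by []. Qed.

Lemma cov_prods_names g nX fs :
  all (fun c => perm_eq (names c) (nX :: map g (names fs))) (cov_prods g nX fs).
Proof.
elim: fs => //= b fs IH; apply/andP; split.
  rewrite !names_cons names_ren map_cat /findices /=.
  by apply/permP => a; rewrite /= !count_cat /=; count_lia.
rewrite all_map; apply: sub_all IH => d /= /permP H.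
rewrite !names_cons -/(names fs) map_cat findices_ren; apply/permP => a; have := H a.
by rewrite /= !count_cat /=; count_lia.
Qed.

Lemma slot_prods_names g nX nq fs :
  all (fun c => perm_eq (names c) [:: nX, nq, nq & map g (names fs)]) (slot_prods g nX nq fs).
Proof.
elim: fs => //= b fs IH; rewrite all_cat; apply/andP; split.
  rewrite all_map; apply/allP => h; rewrite mem_iota add0n => /andP[_ hs] /=.
  rewrite !names_cons names_ren map_cat /findices /=.
  have hs' : (h < size (map g (flow b)))%N by rewrite size_map.
  have /permP := perm_set_nth nq hs'; rewrite (nth_map 0%N) // => H.
  by apply/permP => a; have := H a; rewrite -/(names fs) /= !count_cat /=; count_lia.
rewrite all_map; apply: sub_all IH => d /= /permP H.
rewrite !names_cons -/(names fs) map_cat findices_ren; apply/permP => a; have := H a.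
by rewrite /= !count_cat /=; count_lia.
Qed.

Lemma wf_ren g fs : all wf_fac (map (ren g) fs) = all wf_fac fs.
Proof. by rewrite all_map; apply: eq_all => b; rewrite /wf_fac /= size_map. Qed.

Lemma cov_prods_wf g nX fs : all wf_fac fs -> all (all wf_fac) (cov_prods g nX fs).
Proof.
elim: fs => //= b fs IH /andP[wb wfs]; rewrite wf_ren wfs andbT.
rewrite {1}/wf_fac /= size_map (eqP wb) eqxx /= all_map.
apply: sub_all (IH wfs) => d /= ->; rewrite andbT.
by rewrite /wf_fac /= size_map.
Qed.

Lemma slot_prods_wf g nX nq fs : all wf_fac fs -> all (all wf_fac) (slot_prods g nX nq fs).
Proof.
elim: fs => //= b fs IH /andP[wb wfs]; rewrite all_cat; apply/andP; split.
  rewrite all_map; apply/allP => h; rewrite mem_iota add0n => /andP[_ hs] /=.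
  rewrite wf_ren wfs andbT /wf_fac /= size_set_nth size_map.
  by rewrite -(eqP wb); apply/eqP/maxn_idPr.
rewrite all_map; apply: sub_all (IH wfs) => d /= ->; rewrite andbT.
by rewrite /wf_fac /= size_map.
Qed.

Lemma map_bump_ge p a n : (p <= a)%N -> map (bump p) (iota a n) = iota a.+1 n.
Proof.
by elim: n a => //= n IH a pa; rewrite IH ?leqW // /bump pa.
Qed.

Lemma map_bump_lt p a n : (a + n <= p)%N -> map (bump p) (iota a n) = iota a n.
Proof.
elim: n a => //= n IH a pa; rewrite IH; last by rewrite addSn -addnS.
by rewrite /bump leqNgt (leq_trans _ pa) // addnS ltnS leq_addr.
Qed.

Lemma perm_bump p f : (p <= f)%N -> perm_eq (p :: map (bump p) (iota 0 f)) (iota 0 f.+1).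
Proof.
move=> pf; rewrite -(subnKC pf) iotaD add0n map_cat map_bump_lt // map_bump_ge //.
rewrite -addnS iotaD add0n /=.
by apply/permP => a; rewrite /= !count_cat /=; count_lia.
Qed.

Lemma wf_formal_cov f p P : (p <= f)%N -> wf_tpoly f P -> wf_tpoly f.+1 (formal_cov p P).
Proof.
move=> pf; rewrite /wf_tpoly /formal_cov; elim: P => //= a P IH /andP[/andP[wa pa] wP].
rewrite all_cat IH // andbT all_map.
have := cov_prods_wf (bump p) p wa; have := cov_prods_names (bump p) p (mfac a).
elim: (cov_prods _ _ _) => //= c cs IHc /andP[pc pcs] /andP[wc wcs].
rewrite IHc // andbT /wf_monomial /= wc /=.
apply: perm_trans pc _.
rewrite -/(names _) in pa; have /permP H1 := perm_map (bump p) pa; have /permP H2 := perm_bump pf.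
apply/permP => z; have := H1 z; have := H2 z.
rewrite /= !map_cat !count_cat !(map_bump_ge _ pf) /=; count_lia.
Qed.

Lemma wf_slot_corr f p P : (p <= f)%N -> wf_tpoly f P -> wf_tpoly f.+1 (slot_corr f p P).
Proof.
move=> pf; rewrite /wf_tpoly /slot_corr; elim: P => //= a P IH /andP[/andP[wa pa] wP].
rewrite all_cat IH // andbT all_map.
set g := fun i => bump f.+1 (bump p i).
have := slot_prods_wf g p f.+1 wa; have := slot_prods_names g p f.+1 (mfac a).
elim: (slot_prods _ _ _ _) => //= c cs IHc /andP[pc pcs] /andP[wc wcs].
rewrite IHc // andbT /wf_monomial /= wc /=.
apply: perm_trans pc _.
have gE s : map g s = map (bump f.+1) (map (bump p) s) by rewrite -map_comp.
rewrite -/(names _) in pa; have /permP H1 := perm_map g pa.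
have H2 := perm_map (bump f.+1) (perm_bump pf).
have bp : bump f.+1 p = p by rewrite /bump ltnNge (leq_trans pf).
rewrite map_cons bp [X in perm_eq _ X]map_bump_lt // in H2; move/permP: H2 => H2.
apply/permP => z; have := H1 z; have := H2 z.
rewrite !gE /= !map_cat !count_cat !(map_bump_ge _ pf) !(map_bump_ge _ (leqnn _)) /=.
by rewrite !count_cat /=; count_lia.
Qed.

(** Among u, v, w and the names in sg, each free index must occur once and the new
    repeated index twice. *)
Lemma wf_mulB e f u v w sg P : size sg = f ->
  perm_eq [:: u, v, w & sg] [:: f.+1, f.+1 & iota 0 f.+1] ->
  wf_tpoly f P -> wf_tpoly f.+1 (mulB e f u v w sg P).
Proof.
move=> szs psg; rewrite /wf_tpoly /mulB all_map; apply: sub_all => a /=.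
rewrite /wf_monomial /= => /andP[wa pa]; rewrite wf_ren wa /=.
set g := subst_name f sg.
have E1 : map g (iota 0 f) = sg.
  rewrite -[RHS](mkseq_nth 0%N) szs /mkseq; apply/eq_in_map => i.
  by rewrite mem_iota add0n /g /subst_name => /andP[_ ->].
have E2 n : map g (iota f n) = iota f.+2 n.
  have H k c : (f <= c)%N -> map g (iota c k) = iota c.+2 k.
    elim: k c => //= k IH c fc; rewrite IH ?leqW //.
    by rewrite /g /subst_name ltnNge fc.
  exact: H.
rewrite -/(names _) in pa; have /permP H1 := perm_map g pa; have /permP H2 := psg.
apply/permP => z; have := H1 z; have := H2 z.
rewrite -/(names _) names_ren /= !map_cat !count_cat E1 !E2 /= !count_cat /=.
by count_lia.
Qed.

Lemma wf_tpoly_cat f P Q : wf_tpoly f (P ++ Q) = wf_tpoly f P && wf_tpoly f Q.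
Proof. exact: all_cat. Qed.

Lemma wf_tpoly_flatten f Ps : all (wf_tpoly f) Ps -> wf_tpoly f (flatten Ps).
Proof. by elim: Ps => //= P Ps IH /andP[wP wPs]; rewrite wf_tpoly_cat wP IH. Qed.

(** Strict bounds on the orders: the polynomials without leading term have orders
    less than k - 3, which at k = 3 leaves no factor at all. *)
Definition ord_lt (d : nat) (P : tpoly) : bool := all (fun i => (i < d)%N) (orders P).

Lemma ord_ltE d P : ord_lt d P = all (fun a => all (fun b => (ford b < d)%N) (mfac a)) P.
Proof.
rewrite /ord_lt /orders; elim: P => //= a P IH.
by rewrite all_cat IH all_map.
Qed.

Lemma ord_lt_cat d P Q : ord_lt d (P ++ Q) = ord_lt d P && ord_lt d Q.
Proof. by rewrite !ord_ltE all_cat. Qed.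

Lemma ord_lt_flatten d Ps : all (ord_lt d) Ps -> ord_lt d (flatten Ps).
Proof. by elim: Ps => //= P Ps IH /andP[wP wPs]; rewrite ord_lt_cat wP IH. Qed.

Lemma ord_lt_W d d' P : (d <= d')%N -> ord_lt d P -> ord_lt d' P.
Proof. by move=> dd; apply: sub_all => i id; exact: leq_trans id dd. Qed.

Lemma ford_ren d g fs :
  all (fun b => (ford b < d)%N) (map (ren g) fs) = all (fun b => (ford b < d)%N) fs.
Proof. by rewrite all_map. Qed.

Lemma ord_formal_cov d p P : ord_lt d P -> ord_lt d.+1 (formal_cov p P).
Proof.
rewrite !ord_ltE /formal_cov; elim: P => //= a P IH /andP[oa oP].
rewrite all_cat IH // andbT all_map /=.
elim: (mfac a) oa => //= b fs IHf /andP[ob ofs].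
rewrite /= ltnS ob /= ford_ren.
have ofs' : all (fun b => (ford b < d.+1)%N) fs by apply: sub_all ofs => c /leqW.
rewrite ofs' /= all_map; apply: sub_all (IHf ofs) => c /= ->.
by rewrite andbT leqW.
Qed.

Lemma ord_slot_corr d f p P : (0 < d)%N -> ord_lt d P -> ord_lt d (slot_corr f p P).
Proof.
move=> d0; rewrite !ord_ltE /slot_corr; elim: P => //= a P IH /andP[oa oP].
rewrite all_cat IH // andbT all_map /=.
elim: (mfac a) oa => //= b fs IHf /andP[ob ofs].
rewrite all_cat all_map; apply/andP; split.
  by apply/allP => h _ /=; rewrite ob d0 ford_ren.
by rewrite all_map; apply: sub_all (IHf ofs) => c /= ->; rewrite ob.
Qed.

Lemma ord_mulB d e f u v w sg P : (0 < d)%N -> ord_lt d P -> ord_lt d (mulB e f u v w sg P).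
Proof.
move=> d0; rewrite !ord_ltE /mulB all_map; apply: sub_all => a /= oa.
by rewrite d0 ford_ren.
Qed.

End Formal.

(** * Evaluation of polynomials and the Leibniz rule *)

Lemma nth_bump (T : Type) (x v : T) (s t : seq T) i :
  nth x (s ++ v :: t) (bump (size s) i) = nth x (s ++ t) i.
Proof.
rewrite /bump; case: (leqP (size s) i) => [lei|lti]; last by rewrite add0n !nth_cat lti.
by rewrite add1n !nth_cat !ltnNge leqW // lei /= subSn.
Qed.

Lemma sum_tupleS (R : nmodType) (N m : nat) (F : seq 'I_N -> R) :
  \sum_(r : m.+1.-tuple 'I_N) F r = \sum_q \sum_(r : m.-tuple 'I_N) F (q :: r).
Proof.
rewrite pair_big_dep /=.
rewrite (reindex (fun p : 'I_N * m.-tuple 'I_N => [tuple of p.1 :: p.2])) //=.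
exists (fun r : m.+1.-tuple 'I_N => (thead r, [tuple of behead r])) => [[q r] _|r _] /=.
  by congr (_, _); apply/val_inj.
by rewrite [RHS]tuple_eta; apply: val_inj.
Qed.

Section Eval.
Context {R : realType} {N : nat} (M : set 'rV[R]_N).
Local Notation E := 'rV[R]_N.
Local Notation nbv := (nbv M).

(** Evaluation in terms of the forms [nbv], with an assignment of vectors to all
    names instead of a list. *)
Definition evF (x : E) (rho : nat -> E) (b : Defs.factor) : R :=
  nbv (ford b) x (rho (fup b)) [seq rho i | i <- flow b].

Lemma eval_factorE x env b : eval_factor M x env b = evF x (nth 0 env) b.
Proof. by rewrite /eval_factor /evF /nbv; apply: eq_bigr => k _; rewrite nbE. Qed.

Lemma evF_ren x rho g b : evF x rho (ren g b) = evF x (rho \o g) b.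
Proof. by rewrite /evF /= -map_comp. Qed.

Lemma eq_evF x rho rho' b : rho =1 rho' -> evF x rho b = evF x rho' b.
Proof. by move=> H; rewrite /evF H (eq_map H). Qed.

Lemma prod_evF_ren x rho rho' g fs : rho \o g =1 rho' ->
  \prod_(b <- map (ren g) fs) evF x rho b = \prod_(b <- fs) evF x rho' b.
Proof.
by move=> H; rewrite big_map; apply: eq_bigr => b _; rewrite evF_ren; exact: eq_evF.
Qed.

Definition evM (x : E) (args : seq E) (a : monomial) : R :=
  (mcoef a)%:~R * \sum_(r : (mdum a).-tuple 'I_N)
    \prod_(b <- mfac a) evF x (nth 0 (args ++ [seq ebase i | i <- r])) b.

Definition evP (x : E) (P : tpoly) (args : seq E) : R := \sum_(a <- P) evM x args a.

Lemma eval_tpolyE x P args : eval_tpoly M x P args = evP x P args.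
Proof.
rewrite /eval_tpoly /evP; apply: eq_bigr => a _; rewrite /eval_monomial /evM.
congr (_ * _); apply: eq_bigr => r _; apply: eq_bigr => b _; exact: eval_factorE.
Qed.

Lemma evP_cat x P Q args : evP x (P ++ Q) args = evP x P args + evP x Q args.
Proof. by rewrite /evP big_cat. Qed.

Lemma evP_sum x P args : evP x P args = \sum_(a <- P) evM x args a.
Proof. by []. Qed.

Lemma evP_cons x a P args : evP x (a :: P) args = evM x args a + evP x P args.
Proof. by rewrite /evP big_cons. Qed.

Lemma evP_nil x args : evP x [::] args = 0.
Proof. by rewrite /evP big_nil. Qed.

Lemma evP_flatten (I : Type) (r : seq I) (F : I -> tpoly) x args :
  evP x (flatten [seq F i | i <- r]) args = \sum_(i <- r) evP x (F i) args.
Proof.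
by elim: r => [|i r IH]; rewrite /= ?big_nil ?evP_nil // evP_cat big_cons IH.
Qed.

(** The name f + 1 refers to the first of the repeated indices, here the vector
    e_q that is appended to the arguments. *)
Lemma evP_mulB x e f u v w sg P A : size A = f.+1 -> size sg = f ->
  (u < f.+2)%N -> (v < f.+2)%N -> (w < f.+2)%N -> all (fun i => (i < f.+2)%N) sg ->
  evP x (mulB e f u v w sg P) A = e%:~R * \sum_q
     nbv 0 x (nth 0 (rcons A (ebase q)) u)
       [:: nth 0 (rcons A (ebase q)) v; nth 0 (rcons A (ebase q)) w] *
     evP x P [seq nth 0 (rcons A (ebase q)) i | i <- sg].
Proof.
move=> szA szs u2 v2 w2 sg2.
rewrite /evP /mulB big_map.
under [in RHS]eq_bigr do rewrite mulr_sumr.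
rewrite exchange_big mulr_sumr; apply: eq_bigr => a _.
rewrite /evM /= rmorphM -mulrA; congr (_ * _).
under [in RHS]eq_bigr do rewrite mulrCA.
rewrite -mulr_sumr; congr (_ * _).
have sum_S := @sum_tupleS _ N (mdum a) (fun r : seq 'I_N =>
  \prod_(b <- Factor 0 u [:: v; w] :: map (ren (subst_name f sg)) (mfac a))
     evF x (nth 0 (A ++ [seq ebase i | i <- r])) b).
rewrite sum_S; apply: eq_bigr => q _; rewrite mulr_sumr; apply: eq_bigr => r _.
have nE i : (i < f.+2)%N ->
   nth 0 (A ++ [seq ebase i | i <- q :: r]) i = nth 0 (rcons A (ebase q)) i :> E.
  by move=> lti; rewrite /= -cat_rcons nth_cat size_rcons szA lti.
rewrite big_cons /evF /= !nE //; congr (_ * _).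
apply: prod_evF_ren => i /=; rewrite /subst_name [RHS]nth_cat size_map szs.
case: (ltnP i f) => lti.
  by rewrite nE ?(nth_map 0%N) ?szs //; apply: (allP sg2); rewrite mem_nth ?szs.
by rewrite -cat_rcons nth_cat size_rcons szA ltnNge !ltnS lti /= !subSS.
Qed.

End Eval.

Section Leibniz.
Context {R : realType} {N : nat} (M Om : set 'rV[R]_N).
Local Notation E := 'rV[R]_N.
Hypothesis tM : tube M Om.
Local Notation tdr := (tderR M).
Local Notation tangent := (tangent M).
Local Notation smM := (smM M Om).
Local Notation evF := (evF M).
Local Notation evP := (evP M).
Local Notation nbv := (nbv M).

Lemma smM_evF rho b : wf_fac b -> smM (fun y => evF y rho b).
Proof. by move=> wb; apply: (smM_nbv tM); rewrite size_map; exact/eqP. Qed.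

Lemma smM_prod_evF rho fs : all wf_fac fs -> smM (fun y => \prod_(b <- fs) evF y rho b).
Proof.
elim: fs => [_|b fs IH /= /andP[wb wfs]].
  by apply: smM_eq (smM_cst M Om 1) => y _; rewrite big_nil.
apply: smM_eq (smMM tM (smM_evF rho wb) (IH wfs)) => y _; by rewrite big_cons.
Qed.

Lemma tdr_evF x X rho b : M x -> tangent x X -> wf_fac b ->
  tdr x X (fun y => evF y rho b) =
    nbv (ford b).+1 x (rho (fup b)) (X :: [seq rho i | i <- flow b]) +
    \sum_q \sum_(h <- iota 0 (size (flow b)))
      nbv (ford b) x (rho (fup b)) (set_nth 0 [seq rho i | i <- flow b] h (ebase q)) *
      nbv 0 x (rho (nth 0%N (flow b) h)) [:: X; ebase q].
Proof.
move=> Mx tX wb; have sz : size [seq rho i | i <- flow b] = (ford b).+2.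
  by rewrite size_map; exact/eqP.
rewrite (tdr_nbv tM _ Mx tX sz); congr (_ + _).
rewrite exchange_big /=; apply: eq_bigr => q _.
have -> : iota 0 (size (flow b)) = index_iota 0 (ford b).+2.
  by rewrite /index_iota subn0 (eqP wb).
rewrite big_mkord; apply: eq_bigr => h _.
by rewrite [LHS]mulrC (nth_map 0%N) ?(eqP wb).
Qed.

(** One assignment of vectors to names is not enough: rho1 reads the renamed products
    of the first kind, and rho2 q those of the second kind with e_q for the new
    repeated index. *)
Lemma tdr_prod x X rho g1 rho1 g2 rho2 nX nq fs :
  M x -> tangent x X -> all wf_fac fs ->
  rho1 \o g1 =1 rho -> rho1 nX = X ->
  (forall q, rho2 q \o g2 =1 rho) -> (forall q, rho2 q nX = X) ->
  (forall q, rho2 q nq = ebase q) ->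
  tdr x X (fun y => \prod_(b <- fs) evF y rho b) =
    \sum_(c <- cov_prods g1 nX fs) \prod_(b <- c) evF x rho1 b +
    \sum_q \sum_(c <- slot_prods g2 nX nq fs) \prod_(b <- c) evF x (rho2 q) b.
Proof.
move=> Mx tX + rg1 r1X rg2 r2X r2q.
elim: fs => [_|b fs IH /= /andP[wb wfs]].
  rewrite big_nil big1 ?addr0 //; last by move=> q _; rewrite big_nil.
  rewrite -[RHS](tdr_cst (x := x) (1 : R) tX); apply: tdr_eq => y _.
  by rewrite big_nil.
have E y : M y -> \prod_(b <- b :: fs) evF y rho b = evF y rho b * \prod_(b <- fs) evF y rho b.
  by rewrite big_cons.
rewrite (tdr_eq x X E) (tdrM tM Mx tX (smM_evF rho wb) (smM_prod_evF rho wfs)).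
rewrite (tdr_evF rho Mx tX wb) (IH wfs) big_cons big_map.
have p1 : \prod_(b <- map (ren g1) fs) evF x rho1 b = \prod_(b <- fs) evF x rho b.
  exact: prod_evF_ren.
have p2 q : \prod_(b <- map (ren g2) fs) evF x (rho2 q) b = \prod_(b <- fs) evF x rho b.
  exact: prod_evF_ren.
have -> : \prod_(b0 <- Factor (ford b).+1 (g1 (fup b)) (nX :: map g1 (flow b)) :: map (ren g1) fs) evF x rho1 b0 =
   nbv (ford b).+1 x (rho (fup b)) (X :: [seq rho i | i <- flow b]) * \prod_(b <- fs) evF x rho b.
  rewrite big_cons p1 /evF /= r1X -map_comp -(eq_map rg1) -[rho1 (g1 _)]/((rho1 \o g1) _).
  by rewrite rg1.
have -> : \sum_(c <- cov_prods g1 nX fs) \prod_(b0 <- ren g1 b :: c) evF x rho1 b0 =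
   evF x rho b * \sum_(c <- cov_prods g1 nX fs) \prod_(b <- c) evF x rho1 b.
  rewrite mulr_sumr; apply: eq_bigr => c _; rewrite big_cons evF_ren.
  by rewrite (eq_evF _ x _ rg1).
have -> : \sum_q \sum_(c <- [seq [:: Factor (ford b) (g2 (fup b)) (set_nth 0%N (map g2 (flow b)) h nq),
             Factor 0 (g2 (nth 0%N (flow b) h)) [:: nX; nq] & map (ren g2) fs]
       | h <- iota 0 (size (flow b))] ++ map (cons (ren g2 b)) (slot_prods g2 nX nq fs))
     \prod_(b <- c) evF x (rho2 q) b =
   (\sum_q \sum_(h <- iota 0 (size (flow b)))
      nbv (ford b) x (rho (fup b)) (set_nth 0 [seq rho i | i <- flow b] h (ebase q)) *
      nbv 0 x (rho (nth 0%N (flow b) h)) [:: X; ebase q]) * \prod_(b <- fs) evF x rho b +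
   evF x rho b * \sum_q \sum_(c <- slot_prods g2 nX nq fs) \prod_(b <- c) evF x (rho2 q) b.
  rewrite mulr_suml mulr_sumr -big_split /=; apply: eq_bigr => q _.
  rewrite big_cat !big_map; congr (_ + _).
    rewrite mulr_suml; apply: eq_big_seq => h; rewrite mem_iota add0n => /andP[_ hs].
    rewrite !big_cons p2 mulrA; congr (_ * _ * _); rewrite /evF /=.
      rewrite (map_set_nth _ 0%N 0) ?size_map // r2q -map_comp -(eq_map (rg2 q)).
      by rewrite -[rho2 q (g2 _)]/((rho2 q \o g2) _) rg2.
    by rewrite r2X r2q -[rho2 q (g2 _)]/((rho2 q \o g2) _) rg2.
  rewrite mulr_sumr; apply: eq_bigr => c _; rewrite big_cons evF_ren.
  by rewrite (eq_evF _ x _ (rg2 q)).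
rewrite mulrDl mulrDr; move: (_ * _) (_ * _) (_ * _) (_ * _) => a a' c c'; ring.
Qed.

Lemma smM_evP P A : all (fun a => all wf_fac (mfac a)) P -> smM (fun y => evP y P A).
Proof.
move=> wP; rewrite /evP; elim: P wP => [_|a P IH /= /andP[wa wP]].
  by apply: smM_eq (smM_cst M Om 0) => y _; rewrite big_nil.
have s1 : smM (fun y => evM M y A a).
  apply: (smMM tM); first exact: smM_cst.
  by apply: (smM_sum tM) => r; exact: smM_prod_evF.
apply: smM_eq (smMD tM s1 (IH wP)) => y _; by rewrite big_cons.
Qed.

(** The arguments J fill the first places, so that the direction X of differentiation
    enters as the free index in position size J: the upper indices j of a tensor
    p^{k,s}_j stand before the tangent ones. *)
Lemma tdr_evP x X P J Xs : M x -> tangent x X ->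
  all (fun a => all wf_fac (mfac a)) P ->
  tdr x X (fun y => evP y P (J ++ Xs)) =
    evP x (formal_cov (size J) P) (J ++ X :: Xs) +
    evP x (slot_corr (size (J ++ Xs)) (size J) P) (J ++ X :: Xs).
Proof.
move=> Mx tX; elim: P => [_|a P IH /= /andP[wa wP]].
  rewrite /formal_cov /slot_corr /= !evP_nil addr0 -[RHS](tdr_cst (x := x) (0 : R) tX).
  by apply: tdr_eq => y _; rewrite evP_nil.
have s1 : smM (fun y => evM M y (J ++ Xs) a).
  apply: (smMM tM); first exact: smM_cst.
  by apply: (smM_sum tM) => r; exact: smM_prod_evF.
have s2 := smM_evP (J ++ Xs) wP.
have EE y : M y -> evP y (a :: P) (J ++ Xs) = evM M y (J ++ Xs) a + evP y P (J ++ Xs).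
  by rewrite evP_cons.
rewrite (tdr_eq x X EE) (tdrD tM Mx tX s1 s2) (IH wP).
rewrite /formal_cov /slot_corr /= -!/(formal_cov _ _) -!/(slot_corr _ _ _) !evP_cat.
set U := [seq Monomial _ _ _ | _ <- cov_prods _ _ _]; set V := [seq Monomial _ _ _ | _ <- slot_prods _ _ _ _].
suff -> : tdr x X (fun y => evM M y (J ++ Xs) a) = evP x U (J ++ X :: Xs) + evP x V (J ++ X :: Xs).
  by rewrite addrACA.
pose S (y : E) := \sum_(r : (mdum a).-tuple 'I_N) \prod_(b <- mfac a) evF y (nth 0 ((J ++ Xs) ++ [seq ebase i | i <- r])) b.
have sS r : smM (fun y => \prod_(b <- mfac a) evF y (nth 0 ((J ++ Xs) ++ [seq ebase i | i <- r])) b).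
  exact: smM_prod_evF.
have sS' : smM S by apply: (smM_sum tM) => r; exact: sS.
rewrite (tdrZ tM _ Mx tX sS') (tdr_sum tM _ _ Mx tX) //.
set f := size (J ++ Xs).
pose r1 (r : seq 'I_N) : nat -> E := nth 0 ((J ++ X :: Xs) ++ [seq ebase i | i <- r]).
have szf : size (J ++ X :: Xs) = f.+1 by rewrite /f !size_cat /= addnS.
have H1 r : r1 r \o bump (size J) =1 nth 0 ((J ++ Xs) ++ [seq ebase i | i <- r]).
  by move=> i; rewrite /r1 /= -!catA /= nth_bump.
have H1X r : r1 r (size J) = X by rewrite /r1 -catA nth_cat ltnn subnn.
have H2 r q : r1 (q :: r) \o (fun i => bump f.+1 (bump (size J) i)) =1
    nth 0 ((J ++ Xs) ++ [seq ebase i | i <- r]).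
  by move=> i; rewrite /= -H1 /r1 /= -szf nth_bump.
have H2q r q : r1 (q :: r) f.+1 = ebase q by rewrite /r1 nth_cat szf ltnn subnn.
under eq_bigr => r _ do rewrite (tdr_prod Mx tX wa (H1 r) (H1X r) (H2 r) (fun q => H1X (q :: r)) (H2q r)).
rewrite big_split mulrDr /=; congr (_ + _).
  rewrite evP_sum /U big_map exchange_big /= mulr_sumr.
  by apply: eq_bigr => c _; rewrite /evM.
rewrite evP_sum /V big_map.
transitivity ((mcoef a)%:~R * \sum_(c <- slot_prods (fun i => bump f.+1 (bump (size J) i)) (size J) f.+1 (mfac a))
   \sum_q \sum_(r : (mdum a).-tuple 'I_N) \prod_(b <- c) evF x (r1 (q :: r)) b).
  congr (_ * _); rewrite [LHS]exchange_big [RHS]exchange_big /=.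
  by apply: eq_bigr => q _; exact: exchange_big.
rewrite mulr_sumr; apply: eq_bigr => c _; rewrite /evM /=; congr (_ * _).
by rewrite -(@sum_tupleS _ N (mdum a) (fun r => \prod_(b <- c) evF x (r1 r) b)).
Qed.

End Leibniz.

(** * Multilinearity of evaluations *)

Section EvalMultilinear.
Context {R : realType} {N : nat} (M Om : set 'rV[R]_N).
Local Notation E := 'rV[R]_N.
Hypothesis tM : tube M Om.
Local Notation evF := (evF M).
Local Notation evP := (evP M).

(** Dependence on a single argument is dependence on the vector assigned to a single
    name. *)
Definition upd (rho : nat -> E) (p : nat) (z : E) (i : nat) : E :=
  if i == p then z else rho i.

Lemma map_upd_out rho p z s : p \notin s -> [seq upd rho p z i | i <- s] = [seq rho i | i <- s].
Proof.
move=> ps; apply/eq_in_map => i si; rewrite /upd; case: eqP => // ip.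
by rewrite -ip si in ps.
Qed.

Lemma evF_upd_out x rho p z b : p \notin findices b -> evF x (upd rho p z) b = evF x rho b.
Proof.
rewrite /findices inE negb_or => /andP[pu pl]; rewrite /evF map_upd_out //.
by rewrite /upd eq_sym (negbTE pu).
Qed.

Lemma evF_upd_lin x rho p a u v b : M x -> wf_fac b -> count_mem p (findices b) = 1%N ->
  evF x (upd rho p (a *: u + v)) b = a * evF x (upd rho p u) b + evF x (upd rho p v) b.
Proof.
move=> Mx /eqP wb; rewrite /findices /=; case: (eqVneq (fup b) p) => [up|unp].
  rewrite add1n => -[/count_memPn pl]; rewrite /evF !map_upd_out //.
  by rewrite /upd up eqxx nbv_linu.
rewrite add0n => pl.
have /splitPr pin : p \in flow b by rewrite -has_pred1 has_count pl.
move: wb pl; rewrite /evF; case: pin => l1 l2.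
rewrite size_cat /= count_cat /= eqxx => sz cnt.
have c1 : p \notin l1 by apply/count_memPn; move: cnt; move: (count _ _) (count _ _) => ? ?; lia.
have c2 : p \notin l2 by apply/count_memPn; move: cnt; move: (count _ _) (count _ _) => ? ?; lia.
rewrite !map_cat /= !map_upd_out // /upd eqxx (negbTE unp).
by apply: (nbv_multilin tM) => //; rewrite !size_map.
Qed.

Lemma prod_upd_out x rho p z fs : p \notin names fs ->
  \prod_(b <- fs) evF x (upd rho p z) b = \prod_(b <- fs) evF x rho b.
Proof.
elim: fs => [|b fs IH]; first by rewrite !big_nil.
by rewrite names_cons mem_cat negb_or => /andP[pb pfs]; rewrite !big_cons evF_upd_out // IH.
Qed.

Lemma prod_upd_lin x rho p a u v fs : M x -> all wf_fac fs -> count_mem p (names fs) = 1%N ->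
  \prod_(b <- fs) evF x (upd rho p (a *: u + v)) b =
    a * \prod_(b <- fs) evF x (upd rho p u) b + \prod_(b <- fs) evF x (upd rho p v) b.
Proof.
move=> Mx; elim: fs => // b fs IH; rewrite names_cons count_cat !big_cons => /andP[wb wfs].
have [pb|pb0] := posnP (count_mem p (findices b)).
  have {}pb : p \notin findices b by exact/count_memPn.
  move=> cnt; have pfs : count_mem p (names fs) = 1%N.
    by move: cnt; move/count_memPn: pb => ->; rewrite add0n.
  by rewrite (IH wfs pfs) !(evF_upd_out _ _ _ pb) mulrDr mulrCA.
move=> cnt.
have pb : count_mem p (findices b) = 1%N.
  by move: pb0 cnt; move: (count _ _) (count _ _) => ? ?; lia.
have pfs : p \notin names fs.
  by apply/count_memPn; move: cnt; rewrite pb => -[].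
by rewrite !(prod_upd_out _ _ _ pfs) evF_upd_lin // mulrDl mulrA.
Qed.

Lemma nth_upd (pre post : seq E) (v : E) i :
  nth 0 (pre ++ v :: post) i = upd (nth 0 (pre ++ 0 :: post)) (size pre) v i.
Proof.
rewrite /upd; case: eqP => [->|/eqP ni]; first by rewrite nth_cat ltnn subnn.
rewrite !nth_cat; case: ltnP => // li.
have : (0 < i - size pre)%N by rewrite subn_gt0 ltn_neqAle eq_sym ni.
by case: (i - size pre)%N.
Qed.

(** Each free name occurs exactly once in a well formed monomial, so a single factor
    depends on the given argument. *)
Lemma evM_multilin f x c : M x -> wf_monomial f c -> multilin f (fun A => evM M x A c).
Proof.
move=> Mx /andP[wc pc] pre a u v post sz.
rewrite /evM mulrCA -mulrDr; congr (_ * _).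
rewrite mulr_sumr -big_split /=; apply: eq_bigr => r _.
have ptl : (size pre < f)%N by rewrite -sz addnS ltnS leq_addr.
have cnt : count_mem (size pre) (names (mfac c)) = 1%N.
  move/permP: pc => ->; rewrite !count_cat (count_uniq_mem _ (iota_uniq 0 f)).
  by rewrite !(count_uniq_mem _ (iota_uniq f _)) !mem_iota add0n ptl /= leqNgt ptl.
have eE z : \prod_(b <- mfac c) evF x (nth 0 ((pre ++ z :: post) ++ [seq ebase i | i <- r])) b =
   \prod_(b <- mfac c) evF x (upd (nth 0 ((pre ++ 0 :: post) ++ [seq ebase i | i <- r])) (size pre) z) b.
  apply: eq_bigr => b _; apply: eq_evF => i.
  by rewrite -!catA /= nth_upd.
by rewrite !eE prod_upd_lin.
Qed.

Lemma evP_multilin f x P : M x -> wf_tpoly f P -> multilin f (evP x P).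
Proof.
move=> Mx; elim: P => [_|c P IH /= /andP[wc wP]] pre a u v post sz.
  by rewrite !evP_nil mulr0 addr0.
rewrite !evP_cons (IH wP _ _ _ _ _ sz) (evM_multilin Mx wc _ _ _ sz).
by rewrite mulrDr addrACA.
Qed.

End EvalMultilinear.

(** * The polynomials of the tensors p^{k,s} *)

Section Polynomials.

Definition lead_part (k s : nat) : tpoly := if s == k.-1 then [:: leading k] else [::].

(** The recursion for p^{k+1,s}, apart from its leading term; Q gives the previous
    polynomials without theirs. The free indices are c = k + 1 - s upper ones, the
    direction of differentiation, named c, and s - 1 lower ones. The formal
    derivatives are the derivative of p^{k,s-1} at constant vectors, which the first
    of the four families of products turns into a covariant derivative; the other
    three are the terms with B in the recursion. The leading term of p^{k,s-1} is
    left out under [formal_cov], where it would produce that of p^{k+1,s}. *)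
Definition low_step (d : nat) (Q : nat -> tpoly) (s : nat) : tpoly :=
  let k := d.+3 in
  let c := (k.+1 - s)%N in
  let P t := lead_part k t ++ Q t in
  formal_cov c (Q s.-1) ++ slot_corr k c (P s.-1) ++
  flatten [seq mulB 1 k k.+1 c (c.+1 + h)
               (iota 0 c ++ set_nth 0%N (iota c.+1 s.-1) h k.+1) (P s.-1)
          | h <- iota 0 s.-1] ++
  flatten [seq mulB (-1) k h k.+1 c
               (set_nth 0%N (iota 0 c) h k.+1 ++ iota c.+1 s.-1) (P s.-1)
          | h <- iota 0 c] ++
  flatten [seq mulB (-1) k k.+1 c (c.+1 + h)
               (k.+1 :: iota 0 c ++ del_nth h (iota c.+1 s.-1)) (P (s - 2)%N)
          | h <- iota 0 s.-1] ++
  flatten [seq mulB 1 k h k.+1 c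
               (del_nth h (iota 0 c) ++ rcons (iota c.+1 s.-1) k.+1) (P s)
          | h <- iota 0 c].

(** The part of order less than d of the polynomial for p^{d+3,s}. It is empty for
    d = 0: the only nonzero p^{3,s} is p^{3,2}_j = B^j, a leading term. *)
Fixpoint low (d s : nat) : tpoly :=
  if d is d'.+1 then if (s < 2)%N then [::] else low_step d' (low d') s else [::].

Definition pks_poly (d s : nat) : tpoly := lead_part d.+3 s ++ low d s.

Lemma leading_ord k : orders [:: leading k] = [:: (k - 3)%N].
Proof. by []. Qed.

Lemma wf_leading d : wf_tpoly d.+3 [:: leading d.+3].
Proof.
rewrite /wf_tpoly /= andbT /wf_monomial /= size_iota /findices /= cats0 perm_refl andbT.
by rewrite !subSS subn0 eqxx.
Qed.

(** Except in [formal_cov], the polynomials of the previous stage enter with orders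
    at most d and are multiplied by B without derivatives; under [formal_cov]
    they enter without their leading term. *)
Lemma low_ord d s : ord_lt d (low d s).
Proof.
elim: d s => [|d IH] s //=; case: ltnP => // _; rewrite /low_step.
have Pd t : ord_lt d.+1 (lead_part d.+3 t ++ low d t).
  rewrite ord_lt_cat (ord_lt_W (leqnSn d) (IH _)) andbT /lead_part.
  by case: eqP => // _; rewrite /ord_lt leading_ord /= !subSS subn0 leqnn.
rewrite !ord_lt_cat ord_formal_cov ?IH // ord_slot_corr ?Pd //=.
by rewrite !ord_lt_flatten // all_map; apply/allP => h _ /=; exact: ord_mulB.
Qed.

Lemma size_del_nth (T : Type) (s : seq T) h : (h < size s)%N -> size (del_nth h s) = (size s).-1.
Proof.
by move=> hs; rewrite /del_nth size_cat size_takel ?(ltnW hs) // size_drop; lia.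
Qed.

Lemma size_set_nth_in (T : Type) (x : T) (s : seq T) h z : (h < size s)%N ->
  size (set_nth x s h z) = size s.
Proof. by move=> hs; rewrite size_set_nth; exact/maxn_idPr. Qed.

Lemma low_wf d s : (s <= d.+3)%N -> wf_tpoly d.+3 (low d s).
Proof.
elim: d s => [|d IH] s sk //=; case: ltnP => // s2; rewrite /low_step.
set k := d.+3; set c := (k.+1 - s)%N.
have wP t : (t <= k)%N -> wf_tpoly k (lead_part k t ++ low d t).
  move=> tk; rewrite wf_tpoly_cat IH // andbT /lead_part.
  by case: eqP => // _; exact: wf_leading.
have ck : (c + s.-1 = k)%N by rewrite /c; lia.
have iE : iota 0 k.+1 = iota 0 c ++ c :: iota c.+1 s.-1.
  by rewrite -ck -addnS iotaD.
have nB h : (h < s.-1)%N -> nth 0%N (iota c.+1 s.-1) h = (c.+1 + h)%N by move=> ?; rewrite nth_iota.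
have nA h : (h < c)%N -> nth 0%N (iota 0 c) h = h by move=> ?; rewrite nth_iota.
rewrite !wf_tpoly_cat; apply/and5P; split; [| | | |apply/andP; split].
- by apply: wf_formal_cov; [rewrite /c; lia|apply: IH; rewrite -/k; lia].
- by apply: wf_slot_corr; [rewrite /c; lia|apply: wP; lia].
- apply: wf_tpoly_flatten; rewrite all_map; apply/allP => h.
  rewrite mem_iota add0n => /andP[_ hs] /=; apply: wf_mulB; last by apply: wP; lia.
    by rewrite size_cat size_set_nth_in !size_iota.
  have hs' : (h < size (iota c.+1 s.-1))%N by rewrite size_iota.
  have /permP H := perm_set_nth k.+1 hs'; rewrite nB // in H.
  apply/permP => z; have := H z; rewrite iE /= !count_cat /=; count_lia.
- apply: wf_tpoly_flatten; rewrite all_map; apply/allP => h.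
  rewrite mem_iota add0n => /andP[_ hs] /=; apply: wf_mulB; last by apply: wP; lia.
    by rewrite size_cat size_set_nth_in !size_iota.
  have hs' : (h < size (iota 0 c))%N by rewrite size_iota.
  have /permP H := perm_set_nth k.+1 hs'; rewrite nA // in H.
  apply/permP => z; have := H z; rewrite iE /= !count_cat /=; count_lia.
- apply: wf_tpoly_flatten; rewrite all_map; apply/allP => h.
  rewrite mem_iota add0n => /andP[_ hs] /=.
  have hs' : (h < size (iota c.+1 s.-1))%N by rewrite size_iota.
  apply: wf_mulB; last by apply: wP; lia.
    by rewrite /= size_cat size_del_nth // !size_iota; lia.
  have /permP H := perm_del_nth hs'; rewrite nB // in H.
  apply/permP => z; have := H z; rewrite iE /= !count_cat /=; count_lia.
- apply: wf_tpoly_flatten; rewrite all_map; apply/allP => h.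
  rewrite mem_iota add0n => /andP[_ hs] /=.
  have hs' : (h < size (iota 0 c))%N by rewrite size_iota.
  apply: wf_mulB; last by apply: wP; lia.
    by rewrite size_cat size_rcons size_del_nth // !size_iota; lia.
  have /permP H := perm_del_nth hs'; rewrite nA // in H.
  apply/permP => z; have := H z; rewrite iE -cats1 /= !count_cat /=; count_lia.
Qed.

Lemma poly_wf d s : (s <= d.+3)%N -> wf_tpoly d.+3 (pks_poly d s).
Proof.
move=> sk; rewrite wf_tpoly_cat low_wf // andbT /lead_part.
by case: eqP => // _; exact: wf_leading.
Qed.

Lemma wf_all_fac f P : wf_tpoly f P -> all (fun a => all wf_fac (mfac a)) P.
Proof. by apply: sub_all => a /andP[]. Qed.

Lemma poly_small d s : (s < 2)%N -> pks_poly d s = [::].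
Proof. by case: d => [|d]; case: s => [|[|s]]. Qed.

End Polynomials.

(** * Evaluation of the recursion *)

Section Recursion.
Context {R : realType} {N : nat} (M Om : set 'rV[R]_N).
Local Notation E := 'rV[R]_N.
Hypothesis tM : tube M Om.
Local Notation tdr := (tderR M).
Local Notation tangent := (tangent M).
Local Notation evP := (evP M).
Local Notation nbv := (nbv M).

Section Names.
Variables (J Xs : seq E) (X e : E).
Let env := nth 0 (rcons (J ++ X :: Xs) e).
Let c := size J.
Let s1 := size Xs.

Let envE : env = nth 0 (J ++ X :: rcons Xs e).
Proof. by rewrite /env rcons_cat. Qed.

Let names_J : [seq env i | i <- iota 0 c] = J.
Proof. by rewrite envE map_nth_iota0 ?take_size_cat // size_cat leq_addr. Qed.

Let names_Xs : [seq env i | i <- iota c.+1 s1] = Xs.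
Proof.
rewrite envE map_nth_iota; last by rewrite size_cat /= size_rcons; lia.
by rewrite drop_cat ltnNge leqnSn /= subSnn /= drop0 -cats1 take_size_cat.
Qed.

Let name_X : env c = X.
Proof. by rewrite envE nth_cat ltnn subnn. Qed.

Let name_Xh h : (h < s1)%N -> env (c.+1 + h)%N = nth 0 Xs h.
Proof.
move=> hs; rewrite envE nth_cat addSn ltnNge leqW ?leq_addr //= subSn ?leq_addr //=.
by rewrite addKn nth_rcons hs.
Qed.

Let name_Jh h : (h < c)%N -> env h = nth 0 J h.
Proof. by move=> hc; rewrite envE nth_cat hc. Qed.

Let name_e : env (c + s1).+1 = e.
Proof.
by rewrite /env nth_rcons size_cat /= addnS ltnn eqxx.
Qed.

Let map_del (f : nat -> E) (t : seq nat) h :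
  [seq f i | i <- del_nth h t] = del_nth h [seq f i | i <- t].
Proof. by rewrite /del_nth map_cat map_take map_drop. Qed.

Lemma names_corr h : (h < s1)%N ->
  [seq env i | i <- iota 0 c ++ set_nth 0%N (iota c.+1 s1) h (c + s1).+1] = J ++ set_nth 0 Xs h e.
Proof. by move=> hs; rewrite map_cat names_J (map_set_nth _ 0%N 0) ?size_iota // names_Xs name_e. Qed.

Lemma names_up h : (h < c)%N ->
  [seq env i | i <- set_nth 0%N (iota 0 c) h (c + s1).+1 ++ iota c.+1 s1] = set_nth 0 J h e ++ Xs.
Proof. by move=> hs; rewrite map_cat (map_set_nth _ 0%N 0) ?size_iota // names_J names_Xs name_e. Qed.

Lemma names_low h :
  [seq env i | i <- (c + s1).+1 :: iota 0 c ++ del_nth h (iota c.+1 s1)] = e :: J ++ del_nth h Xs.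
Proof. by rewrite /= map_cat map_del names_J names_Xs name_e. Qed.

Lemma names_last h :
  [seq env i | i <- del_nth h (iota 0 c) ++ rcons (iota c.+1 s1) (c + s1).+1] =
    del_nth h J ++ rcons Xs e.
Proof. by rewrite map_cat map_del map_rcons names_J names_Xs name_e. Qed.

Lemma names_all : [/\ env c = X, env (c + s1).+1 = e,
  forall h, (h < s1)%N -> env (c.+1 + h)%N = nth 0 Xs h &
  forall h, (h < c)%N -> env h = nth 0 J h].
Proof. by split; [exact: name_X|exact: name_e|exact: name_Xh|exact: name_Jh]. Qed.

End Names.

Lemma all_set_nth (p : pred nat) (t : seq nat) h z : (h < size t)%N ->
  p z -> all p t -> all p (set_nth 0%N t h z).
Proof.
move=> hs pz pt; rewrite set_nthE hs all_cat /= pz.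
by move: pt; rewrite -{1}(cat_take_drop h t) (drop_nth 0%N hs) all_cat /= => /and3P[-> _ ->].
Qed.

Lemma all_del_nth (p : pred nat) (t : seq nat) h : all p t -> all p (del_nth h t).
Proof.
move=> pt; apply/allP => i; rewrite /del_nth mem_cat => /orP[/mem_take|/mem_drop]; exact: allP.
Qed.

Lemma all_iota_lt a n b : (a + n <= b)%N -> all (fun i => (i < b)%N) (iota a n).
Proof. by move=> H; apply/allP => i; rewrite mem_iota => /andP[_ /leq_trans]; apply. Qed.

Lemma formal_cov_cat p P Q : formal_cov p (P ++ Q) = formal_cov p P ++ formal_cov p Q.
Proof. by rewrite /formal_cov map_cat flatten_cat. Qed.

Lemma low_rec d s : (2 <= s)%N -> low d.+1 s = low_step d (low d) s.
Proof. by move=> s2; rewrite /= ltnNge s2. Qed.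

Lemma formal_cov_lead d s : (2 <= s)%N -> (s <= d.+4)%N ->
  formal_cov (d.+4 - s) (lead_part d.+3 s.-1) = lead_part d.+4 s.
Proof.
move=> s2 sk; rewrite /lead_part /=.
have -> : (s.-1 == d.+2) = (s == d.+3) by case: s s2 {sk}.
case: eqP => // ->; rewrite subSnn /formal_cov /= /leading /=.
by rewrite !subSS !subn0 map_bump_ge.
Qed.

(** The terms of the formal recursion, evaluated. The first two lines are the
    covariant derivative when the Xs are tangent; the derivative is taken with
    constant arguments. *)
Lemma poly_rec d s J Xs x X : M x -> tangent x X ->
  (2 <= s)%N -> (s <= d.+4)%N -> size J = (d.+4 - s)%N -> size Xs = s.-1 ->
  evP x (pks_poly d.+1 s) (J ++ X :: Xs) =
    tdr x X (fun y => evP y (pks_poly d s.-1) (J ++ Xs)) +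
    \sum_(h <- iota 0 s.-1) \sum_q nbv 0 x (ebase q) [:: X; nth 0 Xs h] *
       evP x (pks_poly d s.-1) (J ++ set_nth 0 Xs h (ebase q)) -
    \sum_(h <- iota 0 (d.+4 - s)) \sum_q nbv 0 x (nth 0 J h) [:: ebase q; X] *
       evP x (pks_poly d s.-1) (set_nth 0 J h (ebase q) ++ Xs) -
    \sum_(h <- iota 0 s.-1) \sum_q nbv 0 x (ebase q) [:: X; nth 0 Xs h] *
       evP x (pks_poly d (s - 2)) (ebase q :: J ++ del_nth h Xs) +
    \sum_(h <- iota 0 (d.+4 - s)) \sum_q nbv 0 x (nth 0 J h) [:: ebase q; X] *
       evP x (pks_poly d s) (del_nth h J ++ rcons Xs (ebase q)).
Proof.
move=> Mx tX s2 sk szJ szX.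
have szk : (size J + size Xs)%N = d.+3 by rewrite szJ szX; lia.
have szA : size (J ++ X :: Xs) = d.+4 by rewrite size_cat /= addnS szk.
have wP : all (fun a => all wf_fac (mfac a)) (pks_poly d s.-1).
  by apply: wf_all_fac; apply: poly_wf; lia.
rewrite (tdr_evP tM J Xs Mx tX wP) size_cat szk szJ.
have -> : pks_poly d.+1 s = lead_part d.+4 s ++ low d.+1 s by [].
rewrite low_rec // /low_step -!/(pks_poly _ _) !evP_cat.
have -> : evP x (formal_cov (d.+4 - s) (pks_poly d s.-1)) (J ++ X :: Xs) =
   evP x (lead_part d.+4 s) (J ++ X :: Xs) + evP x (formal_cov (d.+4 - s) (low d s.-1)) (J ++ X :: Xs).
  by rewrite -evP_cat -formal_cov_lead // -formal_cov_cat.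
rewrite !evP_flatten.
have ckE : d.+4 = (size J + size Xs).+1 by rewrite szk.
have iA : all (fun i => (i < d.+3.+2)%N) (iota 0 (d.+4 - s)) by apply: all_iota_lt; lia.
have iB : all (fun i => (i < d.+3.+2)%N) (iota (d.+4 - s).+1 s.-1) by apply: all_iota_lt; lia.
have -> : \sum_(h <- iota 0 s.-1) evP x (mulB 1 d.+3 d.+4 (d.+4 - s) ((d.+4 - s).+1 + h)
     (iota 0 (d.+4 - s) ++ set_nth 0%N (iota (d.+4 - s).+1 s.-1) h d.+4) (pks_poly d s.-1)) (J ++ X :: Xs) =
   \sum_(h <- iota 0 s.-1) \sum_q nbv 0 x (ebase q) [:: X; nth 0 Xs h] *
       evP x (pks_poly d s.-1) (J ++ set_nth 0 Xs h (ebase q)).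
  apply: eq_big_seq => h; rewrite mem_iota add0n => /andP[_ hs].
  rewrite evP_mulB //; last first.
  - by rewrite all_cat iA all_set_nth // size_iota.
  - by lia.
  - by lia.
  - by rewrite size_cat size_set_nth_in !size_iota //; lia.
  rewrite mul1r; apply: eq_bigr => q _; rewrite -?szJ -?szX in hs; rewrite -szJ -szX ckE.
  by have [-> -> /(_ h hs) -> _] := names_all J Xs X (ebase q); rewrite names_corr.
have -> : \sum_(h <- iota 0 (d.+4 - s)) evP x (mulB (-1) d.+3 h d.+4 (d.+4 - s)
     (set_nth 0%N (iota 0 (d.+4 - s)) h d.+4 ++ iota (d.+4 - s).+1 s.-1) (pks_poly d s.-1)) (J ++ X :: Xs) =
   - \sum_(h <- iota 0 (d.+4 - s)) \sum_q nbv 0 x (nth 0 J h) [:: ebase q; X] *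
       evP x (pks_poly d s.-1) (set_nth 0 J h (ebase q) ++ Xs).
  rewrite -sumrN; apply: eq_big_seq => h; rewrite mem_iota add0n => /andP[_ hs].
  rewrite evP_mulB //; last first.
  - by rewrite all_cat iB andbT all_set_nth // size_iota.
  - by lia.
  - by lia.
  - by rewrite size_cat size_set_nth_in !size_iota //; lia.
  rewrite mulN1r; congr (- _); apply: eq_bigr => q _; rewrite -?szJ -?szX in hs; rewrite -szJ -szX ckE.
  by have [-> -> _ /(_ h hs) ->] := names_all J Xs X (ebase q); rewrite names_up.
have -> : \sum_(h <- iota 0 s.-1) evP x (mulB (-1) d.+3 d.+4 (d.+4 - s) ((d.+4 - s).+1 + h)
     (d.+4 :: iota 0 (d.+4 - s) ++ del_nth h (iota (d.+4 - s).+1 s.-1)) (pks_poly d (s - 2))) (J ++ X :: Xs) =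
   - \sum_(h <- iota 0 s.-1) \sum_q nbv 0 x (ebase q) [:: X; nth 0 Xs h] *
       evP x (pks_poly d (s - 2)) (ebase q :: J ++ del_nth h Xs).
  rewrite -sumrN; apply: eq_big_seq => h; rewrite mem_iota add0n => /andP[_ hs].
  rewrite evP_mulB //; last first.
  - by rewrite /= ltnSn all_cat iA all_del_nth.
  - by lia.
  - by lia.
  - by rewrite /= size_cat size_del_nth !size_iota //; lia.
  rewrite mulN1r; congr (- _); apply: eq_bigr => q _; rewrite -?szJ -?szX in hs; rewrite -szJ -szX ckE.
  by have [-> -> /(_ h hs) -> _] := names_all J Xs X (ebase q); rewrite names_low.
have -> : \sum_(h <- iota 0 (d.+4 - s)) evP x (mulB 1 d.+3 h d.+4 (d.+4 - s)
     (del_nth h (iota 0 (d.+4 - s)) ++ rcons (iota (d.+4 - s).+1 s.-1) d.+4) (pks_poly d s)) (J ++ X :: Xs) =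
   \sum_(h <- iota 0 (d.+4 - s)) \sum_q nbv 0 x (nth 0 J h) [:: ebase q; X] *
       evP x (pks_poly d s) (del_nth h J ++ rcons Xs (ebase q)).
  apply: eq_big_seq => h; rewrite mem_iota add0n => /andP[_ hs].
  rewrite evP_mulB //; last first.
  - by rewrite all_cat all_del_nth //= all_rcons ltnSn iB.
  - by lia.
  - by lia.
  - by rewrite size_cat size_rcons size_del_nth !size_iota //; lia.
  rewrite mul1r; apply: eq_bigr => q _; rewrite -?szJ -?szX in hs; rewrite -szJ -szX ckE.
  by have [-> -> _ /(_ h hs) ->] := names_all J Xs X (ebase q); rewrite names_last.
by rewrite -!addrA.
Qed.

End Recursion.

(** * Evaluation of the tensors p^{k,s} *)

Lemma sum_iota_ord (V : nmodType) (n : nat) (F : nat -> V) :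
  \sum_(h <- iota 0 n) F h = \sum_(h < n) F h.
Proof. by rewrite -(big_mkord xpredT) /index_iota subn0. Qed.

Section PTensor.
Context {R : realType} {N : nat} (M Om : set 'rV[R]_N).
Local Notation E := 'rV[R]_N.
Hypothesis tM : tube M Om.
Local Notation tdr := (tderR M).
Local Notation prj := (prj M).
Local Notation tangent := (tangent M).
Local Notation evP := (evP M).
Local Notation nbv := (nbv M).
Local Notation DA := (DA M).
Local Notation smM := (smM M Om).
Local Notation vsm := (vsm M Om).
Local Notation vals gs x := [seq g x | g : E -> E <- gs].

Let M_Om : M `<=` Om. Proof. by case: tM => -[]. Qed.

Lemma sum_tuple0 (V : nmodType) (I : finType) (F : 0.-tuple I -> V) :
  \sum_(r : 0.-tuple I) F r = F [tuple].
Proof. by apply: big_pred1 => t; rewrite (tuple0 t); apply/esym/eqP. Qed.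

Lemma evP_leading d x u Vs : size Vs = d.+2 ->
  evP x [:: leading d.+3] (u :: Vs) = nbv d x u Vs.
Proof.
move=> sz; rewrite evP_cons evP_nil addr0 /evM /= mul1r sum_tuple0 big_seq1 /=.
rewrite cats0 /evF /= !subSS subn0; congr (nbv d x u _).
rewrite -[[:: _, _ & _]]/([seq nth 0 (u :: Vs) i | i <- iota 1 d.+2]) map_nth_iota /=.
  by rewrite drop0 take_oversize ?sz.
by rewrite sz subSS subn0.
Qed.

Lemma nbv0_ebase x q Vs : nbv 0 x (ebase q) Vs = bform M q x Vs.
Proof. exact: nbv_ebase. Qed.

Lemma sffv_coord x X V q : sffv M x X V 0 q = nbv 0 x (ebase q) [:: X; V].
Proof. by rewrite mxE nbv0_ebase. Qed.

(** The arguments at which a covariant derivative evaluates T are tangent, so T may be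
    replaced by G where they agree on tangent vectors. G has to vanish when a slot is
    zero, because the correction terms have nabla_X (P V) = 0 in a slot. *)
Lemma cov_tangent s (T : tensor) (G : E -> seq E -> R) x V0 Vs : M x -> size Vs = s ->
  (forall y Ws, M y -> size Ws = s -> {in Ws, forall W, tangent y W} -> T y Ws = G y Ws) ->
  (forall pre post, (size pre + (size post).+1)%N = s -> G x (pre ++ 0 :: post) = 0) ->
  cov M T x (V0 :: Vs) =
    tdr x (prj x V0) (fun y => G y [seq prj y (prj x V) | V <- Vs]).
Proof.
move=> Mx sz TG G0; rewrite covE /covd /= -prjE.
have tX := prj_tangent tM V0 Mx.
rewrite big1 ?subr0.
  rewrite -tdrE; apply: tdr_eq => y My.
  have -> : [seq text M X y | X <- [seq prj x V | V <- Vs]] = [seq prj y (prj x V) | V <- Vs].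
    by rewrite -map_comp /text -prjE.
  rewrite TG ?size_map // => W /mapP[V _ ->]; exact: (prj_tangent tM).
move=> [h hs] _ /=; rewrite size_map in hs.
have tV V : tangent x (prj x V) := prj_tangent tM V Mx.
have tn : tangent x (nth 0 [seq prj x V | V <- Vs] h) by rewrite (nth_map 0).
rewrite (nabla_text tM) // (shapev_eq0 tM) // set_nth_cat ?size_map //.
have t0 : tangent x 0 by have := tangent_lin tM (-1) Mx tX tX; rewrite scaleN1r addNr.
have szd : (size (take h [seq prj x V | V <- Vs]) + (size (drop h.+1 [seq prj x V | V <- Vs])).+1)%N = s.
  by rewrite size_takel ?size_map ?(ltnW hs) // size_drop size_map; lia.
rewrite TG ?G0 //; first by rewrite size_cat.
move=> W; rewrite mem_cat inE => /or3P[/mem_take/mapP[V _ ->]//|/eqP ->//|/mem_drop/mapP[V _ ->]//].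
Qed.

Definition ptr : set E -> nat -> nat -> seq 'I_N -> tensor := sealed (@ptensor_rec R N).

Lemma ptrE : ptr = @ptensor_rec R N. Proof. exact: sealedE. Qed.

Lemma ptr_small d s j x X : (s < 2)%N -> ptr M d s j x X = 0.
Proof. by rewrite ptrE; case: d => [|d] /=; case: s => [|[|s]]. Qed.

Lemma ptr_rec d s j x X0 Xs : (2 <= s)%N -> let k := d.+2 in
  ptr M d.+1 s j x (X0 :: Xs) =
      cov M (ptr M d s.-1 j) x (X0 :: Xs)
      - \sum_(h < k.+1 - s) \sum_(r < N)
          ptr M d s.-1 (set_nth r j h r) x Xs * bform M (nth r j h) x [:: ebase r; X0]
      - \sum_(h < s.-1) \sum_(r < N)
          ptr M d (s - 2) (r :: j) x (del_nth h Xs) * bform M r x [:: X0; nth 0 Xs h]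
      + \sum_(h < k.+1 - s) \sum_(r < N)
          ptr M d s (del_nth h j) x (rcons Xs (ebase r)) * bform M (nth r j h) x [:: ebase r; X0].
Proof. by move=> s2 k; rewrite ptrE bformE covE [LHS]/= ltnNge s2. Qed.

Lemma ptr0 s j x X : ptr M 0 s j x X = if s == 2%N then dotv (nth 0 X 0) (nth 0 X 1) else 0.
Proof. by rewrite ptrE. Qed.

Lemma dotv_prj2 y Z W : M y -> dotv (prj y Z) (prj y W) = DA [:: Z; W] y.
Proof. by move=> My; rewrite (prj_sym tM) // (prjK tM) // -(prj_sym tM) // (prj_DA tM). Qed.

(** p^{3,2}_j = B^j: the only nonzero term of the recursion contracts B with the metric
    p^{2,2}. *)
Lemma ptr1_2 j x X0 X1 : M x -> ptr M 1 2 [:: j] x [:: X0; X1] = bform M j x [:: X0; X1].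
Proof.
move=> Mx; rewrite ptr_rec // /=.
rewrite (@cov_tangent 1 _ (fun _ _ => 0)) //; last by move=> y Ws _ _ _; rewrite ptr0.
rewrite (tdr_cst _ (prj_tangent tM X0 Mx)) !big_ord_recl !big_ord0 !addr0.
rewrite big1 => [|r _]; last by rewrite ptr0 mul0r.
rewrite big1 => [|r _]; last by rewrite ptr0 mul0r.
rewrite !subr0 add0r (bform_sym tM) // .
transitivity (\sum_r X1 0 r * bform M j x [:: ebase r; X0]).
  by apply: eq_bigr => r _; rewrite ptr0 /= dotv_basis.
have [Bl _ _] := smooth_form_bform tM j.
symmetry; exact: (@multilin_basis _ _ 2 _ [::] X1 [:: X0] (Bl x Mx) erefl).
Qed.

(** The metric is parallel: on tangent fields it is D^2 A, whose derivative D^3 A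
    vanishes on tangent vectors. *)
Lemma ptr1_3 j x X : M x -> size X = 3%N -> ptr M 1 3 j x X = 0.
Proof.
move=> Mx; case: X => [|X0 [|X1 [|X2 []]]] // _; rewrite ptr_rec //.
rewrite (@cov_tangent 2 _ (fun y Ws => dotv (nth 0 Ws 0) (nth 0 Ws 1))) //; last first.
- by move=> [|p [|? ?]] [|z [|? ?]]; rewrite ?addSn ?addnS //= ?dot0v ?dotv0.
- by move=> y Ws My _ _; rewrite ptr0.
rewrite /= !big_ord0 subr0 addr0 big1 ?subr0.
  have tX V := prj_tangent tM V Mx.
  have H y : M y -> dotv (prj y (prj x X1)) (prj y (prj x X2)) = DA [:: prj x X1; prj x X2] y.
    by exact: dotv_prj2.
  rewrite (tdr_eq x (prj x X0) H) (tdr_DA tM _ Mx (tX X0)).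
  exact: (DA_tangent3 tM Mx (tX _) (tX _) (tX _)).
by move=> h _; apply: big1 => r _; rewrite ptr0 mul0r.
Qed.

(** From k = 3 on every slot is filled by a form that projects its arguments; the
    metric of k = 2 does not. *)
Lemma ptr_prj d s j x X : M x -> (s <= d.+3)%N -> size j = (d.+3 - s)%N -> size X = s ->
  ptr M d.+1 s j x X = ptr M d.+1 s j x [seq prj x V | V <- X].
Proof.
move=> Mx; elim: d s j X => [|d IH] s j X sk szj szX.
  have [s2|s2] := ltnP s 2; first by rewrite !ptr_small.
  case: s sk szj szX s2 => [|[|[|[|s]]]] // _ szj szX _.
    case: j szj => [|j []] // _; case: X szX => [|X0 [|X1 []]] // _ /=.
    by rewrite !ptr1_2 // (bform_prj1 tM) // (bform_prj2 tM).
  by rewrite !ptr1_3 ?size_map.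
have [s2|s2] := ltnP s 2; first by rewrite !ptr_small.
case: X szX => [|X0 Xs] szX; first by rewrite -szX in s2.
have szXs : size Xs = s.-1 by rewrite -szX.
rewrite /= !ptr_rec //; congr (_ - _ - _ + _).
- rewrite covE /covd /= -!prjE.
  have mm : [seq prj x V | V <- [seq prj x V | V <- Xs]] = [seq prj x V | V <- Xs].
    by rewrite -map_comp; apply: eq_map => V /=; exact: (prjK tM).
  by rewrite (prjK tM _ Mx) mm.
- apply: eq_bigr => -[h hs] _; apply: eq_bigr => r _ /=.
  rewrite -IH ?(bform_prj2 tM) //; try lia.
  by rewrite size_set_nth_in ?szj //; lia.
- apply: eq_bigr => -[h hs] _; apply: eq_bigr => r _ /=.
  have hs' : (h < size Xs)%N by rewrite szXs.
  have -> : del_nth h [seq prj x V | V <- Xs] = [seq prj x V | V <- del_nth h Xs].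
    by rewrite /del_nth map_cat map_take map_drop.
  rewrite -IH ?(nth_map 0) ?(bform_prj1 tM) ?(bform_prj2 tM) //=; try lia.
  by rewrite size_del_nth // szXs; lia.
- apply: eq_bigr => -[h hs] _; apply: eq_bigr => r _ /=.
  have szd : size (del_nth h j) = (d.+3 - s)%N by rewrite size_del_nth szj //; lia.
  rewrite (bform_prj2 tM) // IH //; try lia; last by rewrite size_rcons szXs; lia.
  congr (_ * _); rewrite [RHS]IH //; try lia; last by rewrite size_rcons size_map szXs; lia.
  congr (ptr _ _ _ _ _ _); rewrite !map_rcons -map_comp; congr rcons.
  by apply: eq_map => V /=; rewrite (prjK tM).
Qed.

(** The derivative along the fields P V, for V tangent, adds the terms with B(X, V) to the
    derivative at constant arguments. *)
Lemma tdr_evP_prj J Xs P x X : M x -> tangent x X -> {in Xs, forall V, tangent x V} ->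
  wf_tpoly (size J + size Xs) P ->
  tdr x X (fun y => evP y P (J ++ [seq prj y V | V <- Xs])) =
    tdr x X (fun y => evP y P (J ++ Xs)) +
    \sum_(h <- iota 0 (size Xs)) \sum_q nbv 0 x (ebase q) [:: X; nth 0 Xs h] *
       evP x P (J ++ set_nth 0 Xs h (ebase q)).
Proof.
move=> Mx tX tXs wP.
pose gs := [seq (fun y : E => prj y V) | V <- Xs].
have mE y : vals gs y = [seq prj y V | V <- Xs] by rewrite /gs -map_comp.
have gsm h : vsm (nth (fun=> 0) gs h).
  case: (ltnP h (size Xs)) => hs; last by rewrite nth_default ?size_map //; exact: vsm_cst.
  by rewrite (nth_map 0) //; exact: (vsm_prj tM).
have evl y : M y -> multilin (size J + size Xs) (evP y P) by move=> My; exact: (evP_multilin tM My wP).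
have evs Vs : size Vs = (size J + size Xs)%N -> smM (fun y => evP y P Vs).
  by move=> _; exact: (smM_evP tM Vs (wf_all_fac wP)).
have szg : (size J + size gs)%N = (size J + size Xs)%N by rewrite size_map.
have [_] := tdr_multilin tM Mx tX evl evs gsm szg.
under eq_fun do rewrite mE; move=> ->; rewrite mE.
have mx : [seq prj x V | V <- Xs] = Xs.
  by rewrite -[RHS]map_id; apply/eq_in_map => V VX; rewrite (prj_id tM) //; exact: tXs.
rewrite mx; congr (_ + _); rewrite size_map sum_iota_ord; apply: eq_bigr => -[h hs] _ /=.
rewrite (multilin_set_nth _ (evl x Mx)) //; apply: eq_bigr => q _; congr (_ * _).
rewrite (nth_map 0) // (dvec_tangent tM) ?sffv_coord //.
by apply: tXs; rewrite mem_nth.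
Qed.

(** The projection is symmetric, so that it may be moved from one factor of a
    contraction to the other. *)
Lemma sum_prj_basis x (F G : E -> R) : M x ->
  (forall a u v, F (a *: u + v) = a * F u + F v) ->
  (forall a u v, G (a *: u + v) = a * G u + G v) ->
  \sum_r F (prj x (ebase r)) * G (ebase r) = \sum_r F (ebase r) * G (prj x (ebase r)).
Proof.
move=> Mx Fl Gl.
have exp (H : E -> R) : (forall a u v, H (a *: u + v) = a * H u + H v) ->
    forall V, H V = \sum_i V 0 i * H (ebase i).
  move=> Hl V.
  have Hm : multilin 1 (fun Vs => H (head 0 Vs)).
    by move=> [|p pre] a u v [|z post] //=; rewrite ?addSn ?addnS.
  exact: (multilin_basis (pre := [::]) (post := [::]) V Hm erefl).
transitivity (\sum_r \sum_i prj x (ebase r) 0 i * F (ebase i) * G (ebase r)).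
  by apply: eq_bigr => r _; rewrite (exp F Fl) mulr_suml.
rewrite exchange_big /=; apply: eq_bigr => i _.
rewrite (exp G Gl (prj x (ebase i))) mulr_sumr; apply: eq_bigr => r _.
rewrite mulrCA -mulrA; congr (_ * _).
by rewrite -[LHS]dotv_basis (prj_sym tM) // dotvC dotv_basis.
Qed.

(** Induction on k along the common recursion. The last term contracts a tangent slot
    with all basis vectors; since B projects its arguments, only their
    projections matter there, and the induction hypothesis applies to them. *)
Lemma ptr_evP d s j x X : M x -> (s <= d.+3)%N -> size j = (d.+3 - s)%N -> size X = s ->
  {in X, forall V, tangent x V} ->
  ptr M d.+1 s j x X = evP x (pks_poly d s) ([seq ebase i | i <- j] ++ X).
Proof.
elim: d s j x X => [|d IH] s j x X Mx sk szj szX tX.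
  have [s2|s2] := ltnP s 2; first by rewrite ptr_small // poly_small // evP_nil.
  case: s sk szj szX s2 => [|[|[|[|s]]]] // _ szj szX _.
    case: j szj => [|j []] // _; case: X szX tX => [|X0 [|X1 []]] // _ _.
    rewrite ptr1_2 // -nbv0_ebase -[RHS]/(evP x [:: leading 3] (ebase j :: [:: X0; X1])).
    by rewrite evP_leading.
  by rewrite ptr1_3 // -[pks_poly 0 3]/([::] : tpoly) evP_nil.
have [s2|s2] := ltnP s 2; first by rewrite ptr_small // poly_small // evP_nil.
case: X szX tX => [|X0 Xs] szX tX; first by rewrite -szX in s2.
have szXs : size Xs = s.-1 by rewrite -szX.
have tX0 : tangent x X0 by apply: tX; rewrite mem_head.
have tXs : {in Xs, forall V, tangent x V} by move=> V VX; apply: tX; rewrite inE VX orbT.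
have szJ : size [seq (ebase i : E) | i <- j] = (d.+4 - s)%N by rewrite size_map.
have nJ h r : (h < d.+4 - s)%N -> nth 0 [seq ebase i | i <- j] h = ebase (nth r j h) :> E.
  by move=> hs; rewrite (nth_map r) // szj.
rewrite (poly_rec tM) //.
rewrite ptr_rec //.
have mulC (c : nat) (F G : nat -> 'I_N -> R) : \sum_(h <- iota 0 c) \sum_q F h q * G h q = \sum_(h < c) \sum_q G h q * F h q.
  by rewrite sum_iota_ord; apply: eq_bigr => h _; apply: eq_bigr => q _; rewrite mulrC.
have wP : wf_tpoly (size [seq (ebase i : E) | i <- j] + size Xs) (pks_poly d s.-1).
  have -> : (size [seq (ebase i : E) | i <- j] + size Xs)%N = d.+3 by rewrite szJ szXs; lia.
  by apply: poly_wf; lia.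
congr (_ - _ - _ + _).
- rewrite (@cov_tangent s.-1 _ (fun y Ws => evP y (pks_poly d s.-1) ([seq ebase i | i <- j] ++ Ws))) //; last 2 first.
  + by move=> y Ws My szW tW; apply: IH => //; rewrite ?szj; lia.
  + move=> pre post sz; rewrite catA; apply: (multilin0 (evP_multilin tM Mx wP)).
    by rewrite size_cat -addnA sz szXs.
  rewrite (prj_id tM Mx tX0).
  have mx : [seq prj x V | V <- Xs] = Xs.
    by rewrite -[RHS]map_id; apply/eq_in_map => V VX; rewrite (prj_id tM) //; exact: tXs.
  have -> : (fun y => evP y (pks_poly d s.-1) ([seq ebase i | i <- j] ++ [seq prj y (prj x V) | V <- Xs])) =
    (fun y => evP y (pks_poly d s.-1) ([seq ebase i | i <- j] ++ [seq prj y V | V <- Xs])).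
    by apply: funext => y; rewrite -{2}mx -map_comp.
  by rewrite tdr_evP_prj // szXs.
- rewrite mulC; apply: eq_bigr => -[h hs] _; apply: eq_bigr => r _ /=.
  rewrite IH //; last 2 first.
  + by lia.
  + by rewrite size_set_nth_in szj //; lia.
  by rewrite (nJ _ r) // nbv0_ebase (map_set_nth _ r 0) ?szj.
- rewrite mulC; apply: eq_bigr => -[h hs] _; apply: eq_bigr => r _ /=.
  rewrite IH ?nbv0_ebase //=; try by lia.
  + by rewrite size_del_nth szXs //; lia.
  + by move=> V; rewrite /del_nth mem_cat => /orP[/mem_take|/mem_drop]; exact: tXs.
- rewrite mulC; apply: eq_bigr => -[h hs] _ /=.
  have [jh Hj] : exists jh, forall r, nth r j h = jh.
    case: j szj {szJ nJ wP} => [|a j'] szj; first by move: hs; rewrite -szj.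
    by exists (nth a (a :: j') h) => r; apply: set_nth_default; rewrite szj.
  have szd : size (del_nth h j) = (d.+3 - s)%N by rewrite size_del_nth szj //; lia.
  have sd : (s <= d.+3)%N by lia.
  have delJ : [seq (ebase i : E) | i <- del_nth h j] = del_nth h [seq ebase i | i <- j].
    by rewrite /del_nth map_cat map_take map_drop.
  (* Contraction of p^{k,s} with B over the basis, as a pairing of two linear
     functions. *)
  pose F (v : E) := evP x (pks_poly d s) (del_nth h [seq ebase i | i <- j] ++ rcons Xs v).
  pose G (v : E) := bform M jh x [:: v; X0].
  have Fl a u v : F (a *: u + v) = a * F u + F v.
    rewrite /F -!cats1 !catA; apply: (evP_multilin tM Mx (poly_wf sd)).
    by rewrite size_cat size_del_nth ?szJ //= szXs; lia.
  have Gl a u v : G (a *: u + v) = a * G u + G v.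
    have [Bl _ _] := smooth_form_bform tM jh.
    exact: (Bl x Mx [::] a u v [:: X0] erefl).
  transitivity (\sum_r F (prj x (ebase r)) * G (ebase r)).
    apply: eq_bigr => r _; rewrite Hj (ptr_prj Mx sd szd); last by rewrite size_rcons szXs; lia.
    congr (_ * _); rewrite map_rcons; have -> : [seq prj x V | V <- Xs] = Xs.
      by rewrite -[RHS]map_id; apply/eq_in_map => V VX; rewrite (prj_id tM) //; exact: tXs.
    rewrite IH // ?delJ //; first by rewrite size_rcons szXs; lia.
    move=> V; rewrite mem_rcons inE => /orP[/eqP ->|]; last exact: tXs.
    exact: (prj_tangent tM).
  rewrite (sum_prj_basis Mx Fl Gl); apply: eq_bigr => r _.
  by rewrite (nJ _ r) // Hj nbv0_ebase /F /G (bform_prj1 tM).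
Qed.

End PTensor.

(** * The derivatives of A at points of M *)

Section Derivatives.
Context {R : realType} {N : nat} (M Om : set 'rV[R]_N).
Local Notation E := 'rV[R]_N.
Hypothesis tM : tube M Om.
Local Notation tdr := (tderR M).
Local Notation prj := (prj M).
Local Notation tangent := (tangent M).
Local Notation evP := (evP M).
Local Notation nbv := (nbv M).
Local Notation DA := (DA M).
Local Notation smM := (smM M Om).
Local Notation vsm := (vsm M Om).
Local Notation vals gs x := [seq g x | g : E -> E <- gs].

Let M_Om : M `<=` Om. Proof. by case: tM => -[]. Qed.

Lemma multilin_set_nth_l s (T : seq E -> R) (Vs post : seq E) h (v : E) : multilin s T ->
  (size Vs + size post)%N = s -> (h < size Vs)%N ->
  T (set_nth 0 Vs h v ++ post) = \sum_i v 0 i * T (set_nth 0 Vs h (ebase i) ++ post).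
Proof.
move=> H sz hs; rewrite set_nth_cat // -catA /= (multilin_basis _ H).
  by apply: eq_bigr => i _; rewrite set_nth_cat // -catA.
by rewrite size_takel ?(ltnW hs) // size_cat size_drop -sz; lia.
Qed.

Lemma set_nth_catl (A B : seq E) h v : (h < size A)%N ->
  set_nth 0 (A ++ B) h v = set_nth 0 A h v ++ B.
Proof.
by elim: A h => //= a A IH [|h] //= hA; rewrite IH.
Qed.

Lemma set_nth_catr (A B : seq E) h v :
  set_nth 0 (A ++ B) (size A + h) v = A ++ set_nth 0 B h v.
Proof. by elim: A => //= a A IH; rewrite IH. Qed.

Lemma tdr_multilin2 s (T : E -> seq E -> R) gs1 gs2 x X :
  M x -> tangent x X ->
  (forall y, M y -> multilin s (T y)) ->
  (forall Vs, size Vs = s -> smM (fun y => T y Vs)) ->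
  (forall h, vsm (nth (fun=> 0) gs1 h)) -> (forall h, vsm (nth (fun=> 0) gs2 h)) ->
  (size gs1 + size gs2)%N = s ->
  let A y := vals gs1 y in let B y := vals gs2 y in
  tdr x X (fun y => T y (A y ++ B y)) =
    tdr x X (fun y => T y (A x ++ B x)) +
    \sum_(h <- iota 0 (size gs1)) T x (set_nth 0 (A x) h (dvec M x X (nth (fun=> 0) gs1 h)) ++ B x) +
    \sum_(h <- iota 0 (size gs2)) T x (A x ++ set_nth 0 (B x) h (dvec M x X (nth (fun=> 0) gs2 h))).
Proof.
move=> Mx tX Tl Ts v1 v2 sz A B.
have vs h : vsm (nth (fun=> 0) (gs1 ++ gs2) h) by rewrite nth_cat; case: ltnP.
have szg : (size ([::] : seq E) + size (gs1 ++ gs2))%N = s by rewrite size_cat.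
have [_] := tdr_multilin tM Mx tX Tl Ts vs szg.
have ABE y : [::] ++ vals (gs1 ++ gs2) y = A y ++ B y.
  by rewrite /= map_cat.
under eq_fun do rewrite ABE; move=> ->; rewrite ABE -addrA; congr (_ + _).
pose F h := T x (set_nth 0 (A x ++ B x) h (dvec M x X (nth (fun=> 0) (gs1 ++ gs2) h))).
transitivity (\sum_(h < size (gs1 ++ gs2)) F h).
  by apply: eq_bigr => h _; rewrite /F /= map_cat.
rewrite -(sum_iota_ord (size (gs1 ++ gs2)) F) size_cat iotaD big_cat add0n; congr (_ + _).
  apply: eq_big_seq => h; rewrite mem_iota add0n => /andP[_ hs].
  by rewrite /F nth_cat hs set_nth_catl ?size_map.
have -> : iota (size gs1) (size gs2) = [seq (size gs1 + h)%N | h <- iota 0 (size gs2)].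
  by rewrite -iotaDl addn0.
rewrite big_map; apply: eq_big_seq => h; rewrite mem_iota add0n => /andP[_ hs].
rewrite /F nth_cat ltnNge leq_addr /= addKn.
have -> : size gs1 = size (A x) by rewrite size_map.
by rewrite set_nth_catr.
Qed.

Lemma multilinN s (T : seq E -> R) pre v post : multilin s T ->
  (size pre + (size post).+1)%N = s -> T (pre ++ (- v) :: post) = - T (pre ++ v :: post).
Proof.
move=> H sz; have := H pre (-1) v 0 post sz.
by rewrite scaleN1r addr0 mulN1r (multilin0 H sz) addr0.
Qed.

Lemma nbv0_sym x u V W : M x -> nbv 0 x u [:: V; W] = nbv 0 x u [:: W; V].
Proof. by move=> Mx; apply: eq_bigr => k _; congr (_ * _); exact: (bform_sym tM). Qed.

Lemma perm_set_del (s : seq E) h v : (h < size s)%N ->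
  perm_eq (set_nth 0 s h v) (v :: del_nth h s).
Proof.
move=> hs; apply/permP => a; rewrite set_nth_cat // /del_nth /= !count_cat /=.
by move: (count _ _) (count _ _) (nat_of_bool _) => b1 b2 b3; lia.
Qed.

Lemma normal_prj x V : M x -> normal M x V <-> prj x V = 0.
Proof. by case: tM => _ _ _ H _; exact: H. Qed.

(** At most one argument is not normal; by symmetry it is moved to the last place. *)
Lemma DA_small s x Ns Xs : M x -> (s < 2)%N -> (2 <= size Ns)%N -> size Xs = s ->
  {in Ns, forall V, prj x V = 0} -> DA (Xs ++ Ns) x = 0.
Proof.
move=> Mx s2 szN szX nN.
have nN' V : V \in Ns -> normal M x V by move=> VN; apply/(normal_prj _ Mx); exact: nN.
have [_ _ _ _ T5] := tM.
case: Xs szX => [|X [|? ?]] szX; last by move: s2; rewrite -szX.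
  case/lastP: Ns szN nN' {nN} => // Ns V; rewrite size_rcons ltnS => szN nN'.
  apply: T5 => //; first by rewrite -size_eq0 -lt0n.
  by move=> v vN; apply: nN'; rewrite mem_rcons inE vN orbT.
rewrite (DA_perm tM (t := rcons Ns X) _ (M_Om Mx)); last by rewrite perm_sym perm_rcons.
by apply: T5 => //; rewrite -size_eq0 -lt0n ltnW.
Qed.

(** It is the derivative of P V, whose tangential part is the shape operator of
    the tangent vector V, that is zero. *)
Lemma sffv_normal x X V : M x -> tangent x X -> tangent x V -> prj x (sffv M x X V) = 0.
Proof.
move=> Mx tX tV; rewrite -(dvec_tangent tM Mx tX tV) (prj_dvec tM _ Mx tX).
exact: (shapev_eq0 tM).
Qed.

Lemma shapev_is_tangent x X V : M x -> tangent x X -> tangent x (shapev M x X V).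
Proof. by move=> Mx tX; rewrite -(prj_dvec tM _ Mx tX); exact: (prj_tangent tM). Qed.

Lemma map_field_val x (f : E -> E -> E) (Vs : seq E) :
  {in Vs, forall V, f V x = V} -> vals [seq f V | V <- Vs] x = Vs.
Proof.
by move=> H; rewrite -map_comp -[RHS]map_id; apply/eq_in_map => V /H.
Qed.

Lemma vsm_fields (f : E -> E -> E) (Vs : seq E) h :
  (forall V, vsm (f V)) -> vsm (nth (fun=> 0) [seq f V | V <- Vs] h).
Proof.
move=> fv; case: (ltnP h (size Vs)) => hs; first by rewrite (nth_map 0).
by rewrite nth_default ?size_map //; exact: vsm_cst.
Qed.

(** The induction hypothesis is an identity between functions on M when the vectors
    are extended by the fields P X_h and N_h - P N_h. Its derivative along X equates the
    two sums of the Leibniz rule; a derivative of a tangent field is the normal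
    vector B(X, X_h), and of a normal field the tangent vector minus the shape
    operator, so that the induction hypothesis applies again to the terms with A. *)
Lemma DA_evP d s x Ns Xs : M x -> (s <= d.+3)%N -> size Ns = (d.+3 - s)%N -> size Xs = s ->
  {in Ns, forall V, prj x V = 0} -> {in Xs, forall V, tangent x V} ->
  DA (Xs ++ Ns) x = evP x (pks_poly d s) (Ns ++ Xs).
Proof.
elim: d s x Ns Xs => [|d IH] s x Ns Xs Mx sk szN szX nN tX.
  have [s2|s2] := ltnP s 2.
    by rewrite poly_small // evP_nil (@DA_small s) // szN; lia.
  case: s sk szN szX s2 => [|[|[|[|s]]]] // _ szN szX _.
    case: Ns szN {nN} => [|V []] // _; case: Xs szX tX => [|X0 [|X1 []]] // _ tX.
    have t0 : tangent x X0 by apply: tX; rewrite !inE eqxx.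
    have t1 : tangent x X1 by apply: tX; rewrite !inE eqxx orbT.
    rewrite -[RHS]/(evP x [:: leading 3] (V :: [:: X0; X1])) evP_leading //=.
    rewrite (DA_basis tM [:: X0; X1] V [::] Mx); apply: eq_bigr => k _.
    rewrite -[nb M 0 k x _]/(bform M k x [:: X0; X1]) (bform_DA tM _ _ _ Mx).
    by rewrite !(prj_id tM).
  case: Ns szN {nN} => // _; case: Xs szX tX => [|X0 [|X1 [|X2 []]]] // _ tX.
  rewrite -[pks_poly 0 3]/([::] : tpoly) evP_nil.
  by apply: (DA_tangent3 tM) => //; apply: tX; rewrite !inE eqxx ?orbT.
have [s2|s2] := ltnP s 2.
  by rewrite poly_small // evP_nil (@DA_small s) // szN; lia.
case: Xs szX tX => [|X Xs] szX tX; first by rewrite -szX in s2.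
have szXs : size Xs = s.-1 by rewrite -szX.
have tX0 : tangent x X by apply: tX; rewrite mem_head.
have tXs : {in Xs, forall V, tangent x V} by move=> V VX; apply: tX; rewrite inE VX orbT.
pose fX (V y : E) := prj y V; pose fN (V y : E) := V - prj y V.
pose gX := [seq fX V | V <- Xs]; pose gN := [seq fN V | V <- Ns].
have vX h : vsm (nth (fun=> 0) gX h) by apply: vsm_fields => V; exact: (vsm_prj tM).
have vN h : vsm (nth (fun=> 0) gN h) by apply: vsm_fields => V; exact: (vsm_nprj tM).
have valX : vals gX x = Xs.
  by apply: map_field_val => V VX; exact: (prj_id tM Mx (tXs _ VX)).
have valN : vals gN x = Ns.
  by apply: map_field_val => V VN; rewrite /fN (nN _ VN) subr0.
have dX h : (h < size Xs)%N -> dvec M x X (nth (fun=> 0) gX h) = sffv M x X (nth 0 Xs h).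
  move=> hs; rewrite (nth_map 0) // (dvec_tangent tM) //.
  by apply: tXs; rewrite mem_nth.
have dN h : (h < size Ns)%N -> dvec M x X (nth (fun=> 0) gN h) = - shapev M x X (nth 0 Ns h).
  move=> hs; rewrite (nth_map 0) // (dvec_nprj tM) // (dvec_normal tM) //.
  by apply: nN; rewrite mem_nth.
have szXN : (size Xs + size Ns)%N = d.+3 by rewrite szXs szN; lia.
have szNX : (size Ns + size Xs)%N = d.+3 by rewrite addnC.
have szg1 : (size gX + size gN)%N = d.+3 by rewrite !size_map.
have szg2 : (size gN + size gX)%N = d.+3 by rewrite addnC.
have DAl y : M y -> multilin d.+3 (fun Vs => DA Vs y).
  by move=> My; exact: (DA_multilin tM (M_Om My)).
have DAs Vs : size Vs = d.+3 -> smM (fun y => DA Vs y) by move=> _; exact: (smM_DA tM).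
have s1k : (s.-1 <= d.+3)%N by lia.
have Pl y : M y -> multilin d.+3 (evP y (pks_poly d s.-1)).
  by move=> My; exact: (evP_multilin tM My (poly_wf s1k)).
have Ps Vs : size Vs = d.+3 -> smM (fun y => evP y (pks_poly d s.-1) Vs).
  by move=> _; exact: (smM_evP tM Vs (wf_all_fac (poly_wf s1k))).
have EL := tdr_multilin2 Mx tX0 DAl DAs vX vN szg1.
have ER := tdr_multilin2 Mx tX0 Pl Ps vN vX szg2.
have fE y : M y -> DA (vals gX y ++ vals gN y) y =
    evP y (pks_poly d s.-1) (vals gN y ++ vals gX y).
  move=> My; apply: IH => //.
  - by rewrite !size_map szN; lia.
  - by rewrite !size_map.
  - move=> V; rewrite /gN -map_comp => /mapP[W _ ->] /=; rewrite /fN.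
    have := prj_lin tM (-1) (prj y W) W My.
    by rewrite !scaleN1r (prjK tM) // addNr addrC.
  - by move=> V; rewrite /gX -map_comp => /mapP[W _ ->] /=; exact: (prj_tangent tM).
rewrite /= (tdr_eq x X fE) ER valX valN !size_map (tdr_DA tM _ Mx tX0) {ER fE} in EL.
have szc : size Ns = (d.+4 - s)%N by [].
rewrite (poly_rec tM) //.
(* The terms of poly_rec in which a tangent argument of the polynomial is
   replaced by B(X, X_h) are those from the derivatives of the tangent fields. *)
have c1 : \sum_(h <- iota 0 (size Xs)) \sum_q nbv 0 x (ebase q) [:: X; nth 0 Xs h] *
       evP x (pks_poly d s.-1) (Ns ++ set_nth 0 Xs h (ebase q)) =
    \sum_(h <- iota 0 (size Xs)) evP x (pks_poly d s.-1)
       (Ns ++ set_nth 0 Xs h (dvec M x X (nth (fun=> 0) gX h))).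
  apply: eq_big_seq => h; rewrite mem_iota add0n => /andP[_ hs].
  rewrite (multilin_set_nth _ (Pl x Mx)) // dX //.
  by apply: eq_bigr => q _; rewrite sffv_coord.
(* Likewise for the normal arguments, with a sign from N_h - P N_h. *)
have c2 : \sum_(h <- iota 0 (size Ns)) \sum_q nbv 0 x (nth 0 Ns h) [:: ebase q; X] *
       evP x (pks_poly d s.-1) (set_nth 0 Ns h (ebase q) ++ Xs) =
    - \sum_(h <- iota 0 (size Ns)) evP x (pks_poly d s.-1)
       (set_nth 0 Ns h (dvec M x X (nth (fun=> 0) gN h)) ++ Xs).
  rewrite -sumrN; apply: eq_big_seq => h; rewrite mem_iota add0n => /andP[_ hs].
  rewrite (multilin_set_nth_l _ (Pl x Mx)) // dN // -sumrN.
  by apply: eq_bigr => q _; rewrite mxE shapev_nbv (nbv0_sym _ X _ Mx) mulNr opprK.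
(* On the side of A, a tangent slot that receives the normal vector B(X, X_h)
   leaves s - 2 tangent ones. *)
have c3 : \sum_(h <- iota 0 (size Xs)) \sum_q nbv 0 x (ebase q) [:: X; nth 0 Xs h] *
       evP x (pks_poly d (s - 2)) (ebase q :: Ns ++ del_nth h Xs) =
    \sum_(h <- iota 0 (size Xs)) DA (set_nth 0 Xs h (dvec M x X (nth (fun=> 0) gX h)) ++ Ns) x.
  apply: eq_big_seq => h; rewrite mem_iota add0n => /andP[_ hs].
  have tXh : tangent x (nth 0 Xs h) by apply: tXs; rewrite mem_nth.
  rewrite dX //; set b := sffv _ _ _ _.
  have szd : size (del_nth h Xs) = (s - 2)%N by rewrite size_del_nth // szXs; lia.
  rewrite (DA_perm tM (t := del_nth h Xs ++ b :: Ns) _ (M_Om Mx)); last first.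
    rewrite -cat1s perm_sym perm_catCA catA perm_cat2r cat1s perm_sym.
    exact: perm_set_del.
  rewrite (IH (s - 2)%N) //; last 4 first.
  - by lia.
  - by rewrite /= szc; lia.
  - by move=> V; rewrite inE => /orP[/eqP ->|]; [exact: sffv_normal|exact: nN].
  - by move=> V; rewrite /del_nth mem_cat => /orP[/mem_take|/mem_drop]; exact: tXs.
  have s2k : (s - 2 <= d.+3)%N by lia.
  rewrite (multilin_basis (pre := [::]) b (evP_multilin tM Mx (poly_wf s2k))).
    by apply: eq_bigr => q _; rewrite sffv_coord.
  by rewrite /= size_cat szd szc; lia.
(* A normal slot that receives a shape operator leaves s tangent ones. *)
have c4 : \sum_(h <- iota 0 (size Ns)) \sum_q nbv 0 x (nth 0 Ns h) [:: ebase q; X] *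
       evP x (pks_poly d s) (del_nth h Ns ++ rcons Xs (ebase q)) =
    - \sum_(h <- iota 0 (size Ns)) DA (Xs ++ set_nth 0 Ns h (dvec M x X (nth (fun=> 0) gN h))) x.
  rewrite -sumrN; apply: eq_big_seq => h; rewrite mem_iota add0n => /andP[_ hs].
  have sk' : (s <= d.+3)%N by move: hs; rewrite szc; lia.
  have szd : size (del_nth h Ns) = (d.+3 - s)%N by rewrite size_del_nth // szc; lia.
  rewrite dN //; set w := shapev _ _ _ _.
  have -> : DA (Xs ++ set_nth 0 Ns h (- w)) x = - DA (Xs ++ set_nth 0 Ns h w) x.
    rewrite !set_nth_cat // !catA (multilinN _ (DAl x Mx)) //.
    by rewrite size_cat size_takel ?(ltnW hs) // size_drop -addnA -szXN -subSn // subSS subnKC // ltnW.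
  rewrite opprK (DA_perm tM (t := rcons Xs w ++ del_nth h Ns) _ (M_Om Mx)); last first.
    by rewrite cat_rcons perm_cat2l; exact: perm_set_del.
  rewrite (IH s) //; last 3 first.
  - by rewrite size_rcons szXs; lia.
  - by move=> V; rewrite /del_nth mem_cat => /orP[/mem_take|/mem_drop]; exact: nN.
  - move=> V; rewrite mem_rcons inE => /orP[/eqP ->|]; last exact: tXs.
    exact: shapev_is_tangent.
  rewrite -!cats1 !catA (multilin_basis (post := [::]) w (evP_multilin tM Mx (poly_wf sk'))).
    by apply: eq_bigr => q _; rewrite /w shapev_nbv cats1 rcons_cat (nbv0_sym _ X _ Mx).
  by rewrite size_cat szd szXs /=; lia.
rewrite szXs szc in c1 c2 c3 c4 EL.
rewrite c1 c2 c3 c4 {c1 c2 c3 c4}.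
move: EL; move: (\sum_(_ <- _) _) (\sum_(_ <- _) _) (\sum_(_ <- _) _) (\sum_(_ <- _) _).
by move=> a1 a2 a3 a4; move: (tdr _ _ _) (DA _ _) => t u E; lra.
Qed.

Lemma multilin_expand n s (T : seq E -> R) (pre Vs : seq E) : multilin s T ->
  size Vs = n -> (size pre + n)%N = s ->
  T (pre ++ Vs) = \sum_(r : n.-tuple 'I_N)
     (\prod_(p <- zip Vs r) p.1 0 p.2) * T (pre ++ [seq ebase i | i <- r]).
Proof.
move=> Tl; elim: n pre Vs => [|n IH] pre [|V Vs] // szV szs.
  by rewrite sum_tuple0 big_nil mul1r.
have szV' : size Vs = n by case: szV.
rewrite (@sum_tupleS _ N n (fun r => (\prod_(p <- zip (V :: Vs) r) p.1 0 p.2) * T (pre ++ [seq ebase i | i <- r]))).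
rewrite (multilin_basis V Tl); last by rewrite szV'.
apply: eq_bigr => q _; rewrite -cat_rcons IH ?size_rcons ?addSnnS // mulr_sumr.
by apply: eq_bigr => r _; rewrite /= big_cons /= mulrA cat_rcons.
Qed.

Lemma partials_DA (i : seq 'I_N) : partials i (AM M) = DA [seq ebase j | j <- i].
Proof. by elim: i => [|j i IH]; rewrite ?DA_nil //= IH DA_cons. Qed.

Lemma DA_sum k x (W : 'I_k -> E) : M x ->
  \sum_(i : k.-tuple 'I_N) partials i (AM M) x * \prod_(h < k) W h 0 (tnth i h) =
    DA [seq W h | h <- enum 'I_k] x.
Proof.
move=> Mx; have szW : size [seq W h | h <- enum 'I_k] = k by rewrite size_map size_enum_ord.
rewrite -[X in DA X x]cat0s (multilin_expand (DA_multilin tM (M_Om Mx)) szW erefl).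
apply: eq_bigr => r _; rewrite partials_DA mulrC; congr (_ * _).
have rE : (r : seq 'I_N) = [seq tnth r h | h <- enum 'I_k] by rewrite map_tnth_enum.
by rewrite [X in zip _ X]rE zip_map big_map big_enum.
Qed.

(** The product over the slots of tangent plus normal part is distributed; the set S
    collects the slots with the tangent part, which symmetry moves to the front. *)
Lemma Ak_split k x (V : k.-tuple E) : M x ->
  Ak M x V = \sum_(S : {set 'I_k})
    DA ([seq prj x (tnth V i) | i <- enum S] ++
        [seq tnth V i - prj x (tnth V i) | i <- enum (~: S)]) x.
Proof.
move=> Mx; rewrite /Ak.
pose P h := prj x (tnth V h); pose Q h := tnth V h - prj x (tnth V h).
transitivity (\sum_(i : k.-tuple 'I_N) \sum_(S : {set 'I_k})
   partials i (AM M) x * \prod_(h < k) (if h \in S then P h else Q h) 0 (tnth i h)).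
  apply: eq_bigr => i _; rewrite -mulr_sumr; congr (_ * _).
  transitivity (\prod_(h < k) (P h 0 (tnth i h) + Q h 0 (tnth i h))).
    by apply: eq_bigr => h _; rewrite /P /Q !mxE [RHS]addrC subrK.
  rewrite bigA_distr; apply: eq_bigr => S _; apply: eq_bigr => h _.
  by case: (h \in S).
rewrite exchange_big /=; apply: eq_bigr => S _.
rewrite (DA_sum (fun h => if h \in S then P h else Q h) Mx).
have -> : [seq prj x (tnth V i) | i <- enum S] = [seq if h \in S then P h else Q h | h <- enum S].
  by apply/eq_in_map => h; rewrite mem_enum => ->.
have -> : [seq tnth V i - prj x (tnth V i) | i <- enum (~: S)] =
    [seq if h \in S then P h else Q h | h <- enum (~: S)].
  by apply/eq_in_map => h; rewrite mem_enum inE => /negbTE ->.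
rewrite -map_cat; apply: (DA_perm tM); last exact: M_Om.
apply: perm_map; apply: uniq_perm; first exact: enum_uniq.
  rewrite cat_uniq !enum_uniq /= andbT; apply/hasPn => h.
  by rewrite !mem_enum inE.
by move=> h; rewrite mem_cat !mem_enum !inE orbN.
Qed.

Lemma Ak_evP d x (V : d.+3.-tuple E) : M x ->
  Ak M x V = \sum_(S : {set 'I_d.+3})
    evP x (pks_poly d #|S|)
      ([seq tnth V i - prj x (tnth V i) | i <- enum (~: S)] ++
       [seq prj x (tnth V i) | i <- enum S]).
Proof.
move=> Mx; rewrite Ak_split //; apply: eq_bigr => S _.
have cS : (#|S| <= d.+3)%N by rewrite -[X in (_ <= X)%N]card_ord max_card.
apply: DA_evP => //.
- by rewrite size_map -cardE; have := cardsC S; rewrite card_ord => cSE; apply/eqP; rewrite -(eqn_add2l #|S|) subnKC // cSE.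
- by rewrite size_map -cardE.
- move=> W /mapP[h _ ->]; have := prj_lin tM (-1) (prj x (tnth V h)) (tnth V h) Mx.
  by rewrite !scaleN1r (prjK tM) // addNr addrC.
- by move=> W /mapP[h _ ->]; exact: (prj_tangent tM).
Qed.

End Derivatives.

Theorem corollary2p4 (R : realType) (k : nat) (hk : (3 <= k)%N) :
  exists (P : nat -> tpoly) (LOT : tpoly),
    (* formal properties of the polynomials P s expressing p^{k,s} *)
    (forall s, (s <= k)%N -> wf_tpoly k (P s)) /\
    (forall s, (s <= k)%N -> all (fun d => (d <= k - 3)%N) (orders (P s))) /\
    (forall s, (s <= k)%N ->
       ((k - 3)%N \in orders (P s)) = (s == k.-1)) /\
    P k.-1 = leading k :: LOT /\
    all (fun d => (d < k - 3)%N) (orders LOT) /\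
    forall (n m : nat) (M : set 'rV[R]_(n + m)),
      smooth_submanifold M -> compact M ->
      forall x, M x ->
        (forall (s : nat) (j : seq 'I_(n + m)) (X : seq 'rV[R]_(n + m)),
           (s <= k)%N -> size j = (k - s)%N -> size X = s ->
           (forall h, (h < s)%N -> tangent M x (nth 0 X h)) ->
           ptensor M k s j x X =
             eval_tpoly M x (P s) ([seq ebase i | i <- j] ++ X)) /\
        (forall (j1 : 'I_(n + m)) (X : seq 'rV[R]_(n + m)),
           size X = k.-1 ->
           (forall h, (h < k.-1)%N -> tangent M x (nth 0 X h)) ->
           ptensor M k k.-1 [:: j1] x X =
             nablaB M (k - 3) j1 x X + eval_tpoly M x LOT (ebase j1 :: X)) /\
        (forall V : k.-tuple 'rV[R]_(n + m),
           Ak M x V =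
             \sum_(S : {set 'I_k})
               eval_tpoly M x (P #|S|)
                 ([seq nproj M x (tnth V i) | i <- enum (~: S)] ++
                  [seq tproj M x (tnth V i) | i <- enum S])).
Proof.
case: k hk => [|[|[|d]]] // _.
have d3 : (d.+3 - 3)%N = d by rewrite !subSS subn0.
have loE : pks_poly d d.+2 = leading d.+3 :: low d d.+2 by rewrite /pks_poly /lead_part eqxx.
have low_lt s i : i \in orders (low d s) -> (i < d)%N by exact: (allP (low_ord d s)).
have ordE s : orders (pks_poly d s) = (if s == d.+2 then [:: d] else [::]) ++ orders (low d s).
  by rewrite /pks_poly /lead_part /=; case: eqP => //= _; rewrite /orders /= d3.
exists (pks_poly d), (low d d.+2); do 5?split.
- exact: poly_wf.
- move=> s _; rewrite d3 ordE; apply/allP => i; rewrite mem_cat => /orP[|/low_lt/ltnW//].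
  by case: eqP => // _; rewrite inE => /eqP ->.
- move=> s _; rewrite d3 ordE mem_cat; have -> : (d \in orders (low d s)) = false.
    by apply/negP => /low_lt; rewrite ltnn.
  by rewrite orbF /=; case: eqP => // _; rewrite inE eqxx.
- exact: loE.
- by rewrite d3; exact: low_ord.
move=> n m M Ms Mc x Mx.
have [Om tM] := tube_ex Ms Mc (ex_intro _ x Mx).
have pE s j (X : seq 'rV[R]_(n + m)) : (s <= d.+3)%N -> size j = (d.+3 - s)%N -> size X = s ->
    (forall h, (h < s)%N -> tangent M x (nth 0 X h)) ->
    ptensor M d.+3 s j x X = eval_tpoly M x (pks_poly d s) ([seq ebase i | i <- j] ++ X).
  move=> sk szj szX tX; rewrite eval_tpolyE -(ptr_evP tM Mx sk szj szX) ?ptrE //.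
  move=> V VX; rewrite -(nth_index 0 VX); apply: tX.
  by rewrite -szX index_mem.
split; [|split] => //.
- move=> j1 X szX tX; rewrite pE //=; last by rewrite subSnn.
  rewrite loE eval_tpolyE -cat1s evP_cat eval_tpolyE; congr (_ + _).
  by rewrite evP_leading // nbv_ebase nbE d3.
- move=> V; rewrite (Ak_evP tM V Mx); apply: eq_bigr => S _.
  by rewrite eval_tpolyE /nproj -prjE.
Qed.
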